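(* A finite space $X$ is schematic if and only if $U_p$ is schematic for any $p\in X$.
   Context: All rings are commutative with unit. A ringed finite space is a ringed space $(X,\mathcal O)$ with $X$ a finite topological space. For $p\in X$, $U_p$ is the smallest open subset containing $p$ (with the restricted sheaf of rings); $p\le q$ means $q\in U_p$. The stalk is $\mathcal O_p=\mathcal O(U_p)$, with restriction morphisms $\mathcal O_p\to\mathcal O_q$ for $p\le q$. A finite space is a ringed finite space all of whose restriction morphisms are flat. An $\mathcal O$-module is quasi-coherent if it is locally a cokernel of a morphism between free modules of arbitrary rank. All spaces and morphisms are over a fixed commutative base ring $k$ (i.e. over the one-point ringed space $( *,k)$; $k=\mathbb Z$ imposes no restriction, and the notion below does not depend on $k$). $X\times X=X\times_kX$ is the product topological space with $\mathcal O_{(x,y)}=\mathcal O_x\otimes_k\mathcal O_y$. A finite space $X$ is schematic if $R^i\delta_*\mathcal O_X$ is quasi-coherent for all $i\ge0$, where $\delta\colon X\to X\times X$ is the diagonal morphism. *)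

(* Defs.v *)
From HB Require Import structures.
From mathcomp Require Import all_boot all_order all_algebra.
From mathcomp Require Import generic_quotient ring_quotient.
From mathcomp Require Import all_classical.
From mathcomp Require Import topology_structure product_topology.
From mathcomp Require Import initial_topology subtype_topology.

Set Implicit Arguments.
Unset Strict Implicit.
Unset Printing Implicit Defensive.

Import GRing.Theory.

Local Open Scope classical_set_scope.
Local Open Scope ring_scope.
Local Open Scope quotient_scope.

(** Rings may be zero, hence [comPzRingType] rather than [comNzRingType]. *)

Definition restr_scalars (R S : pzRingType) (f : {rmorphism R -> S})
  (M : Type) : Type := M.

Section RestrictionOfScalars.
Variables (R S : pzRingType) (f : {rmorphism R -> S}) (M : lmodType S).

HB.instance Definition _ := GRing.Zmodule.on (restr_scalars f M).

Definition restr_scale (a : R) (m : restr_scalars f M) : restr_scalars f M :=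
  f a *: (m : M).

Lemma restr_scaleA a b m : restr_scale a (restr_scale b m) = restr_scale (a * b) m.
Proof. by rewrite /restr_scale scalerA rmorphM. Qed.
Lemma restr_scale1 : left_id 1 restr_scale.
Proof. by move=> m; rewrite /restr_scale rmorph1 scale1r. Qed.
Lemma restr_scaleDr : right_distributive restr_scale +%R.
Proof. by move=> a m n; rewrite /restr_scale scalerDr. Qed.
Lemma restr_scaleDl m : {morph restr_scale^~ m : a b / a + b}.
Proof. by move=> a b; rewrite /restr_scale rmorphD scalerDl. Qed.

HB.instance Definition _ := GRing.Zmodule_isLmodule.Build R (restr_scalars f M)
  restr_scaleA restr_scale1 restr_scaleDr restr_scaleDl.
End RestrictionOfScalars.

(** An element of M ⊗_R N is represented by a formal sum of pure tensors, i.e.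
    a list of pairs.  Two formal sums are identified when every R-balanced
    biadditive map into an abelian group takes the same value on both.  This is
    the relation generated by the usual relations: apply it to the universal
    balanced map.  Negation needs no coefficient, as -(m ⊗ n) = (-m) ⊗ n. *)

Section Tensor.
Variables (R : comPzRingType) (M N : lmodType R).

Definition balanced (G : zmodType) (h : M -> N -> G) : Prop :=
  [/\ forall m m' n, h (m + m') n = h m n + h m' n,
      forall m n n', h m (n + n') = h m n + h m n'
    & forall a m n, h (a *: m) n = h m (a *: n)].

Definition tensor_sum (G : zmodType) (h : M -> N -> G) (s : seq (M * N)) : G :=
  \sum_(u <- s) h u.1 u.2.

Definition tensor_rel (s t : seq (M * N)) : bool :=
  `[< forall (G : zmodType) (h : M -> N -> G), balanced h ->
        tensor_sum h s = tensor_sum h t >].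

Lemma tensor_rel_equiv : equiv_class_of tensor_rel.
Proof.
split=> [s|s t|t s u].
- exact/asboolP.
- by apply/asboolP/asboolP=> e G h bh; rewrite e.
- by move=> /asboolP e1 /asboolP e2; apply/asboolP=> G h bh; rewrite e1 ?e2.
Qed.

Canonical tensor_equiv := EquivRelPack tensor_rel_equiv.
Canonical tensor_encModRel := defaultEncModRel tensor_rel.

Definition tensor : Type := {eq_quot tensor_rel}.
HB.instance Definition _ : EqQuotient (seq (M * N)) tensor_rel tensor :=
  EqQuotient.on tensor.
HB.instance Definition _ := Choice.on tensor.

Lemma tensor_eqP (s t : seq (M * N)) :
  (forall (G : zmodType) (h : M -> N -> G), balanced h ->
     tensor_sum h s = tensor_sum h t) <-> \pi_tensor s = \pi_tensor t.
Proof.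
split=> [e|/eqmodP /asboolP //].
by apply/eqmodP/asboolP.
Qed.

Lemma tensor_eq (s t : seq (M * N)) :
  (forall (G : zmodType) (h : M -> N -> G), balanced h ->
     tensor_sum h s = tensor_sum h t) -> \pi_tensor s = \pi_tensor t.
Proof. by move/tensor_eqP. Qed.

Lemma tensor_repr (s : seq (M * N)) (G : zmodType) (h : M -> N -> G) :
  balanced h -> tensor_sum h (repr (\pi_tensor s)) = tensor_sum h s.
Proof. by move=> bh; apply: (proj2 (tensor_eqP _ _)); rewrite ?reprK. Qed.

Lemma balancedN (G : zmodType) (h : M -> N -> G) : balanced h ->
  forall m n, h (- m) n = - h m n.
Proof.
case=> hD _ _ m n; have h0 : h 0 n = 0.
  by apply: (@addrI _ (h 0 n)); rewrite -hD !addr0.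
by apply: (@addrI _ (h m n)); rewrite -hD !subrr h0.
Qed.

Definition tens (m : M) (n : N) : tensor := \pi_tensor [:: (m, n)].
Definition tensor_zero : tensor := \pi_tensor [::].
Definition tensor_add (x y : tensor) : tensor := \pi_tensor (repr x ++ repr y).
Definition tensor_opp (x : tensor) : tensor :=
  \pi_tensor [seq (- u.1, u.2) | u <- repr x].

Lemma tensor_sum_cat (G : zmodType) (h : M -> N -> G) s t :
  tensor_sum h (s ++ t) = tensor_sum h s + tensor_sum h t.
Proof. exact: big_cat. Qed.

Lemma tensor_sum_opp (G : zmodType) (h : M -> N -> G) s : balanced h ->
  tensor_sum h [seq (- u.1, u.2) | u <- s] = - tensor_sum h s.
Proof.
move=> bh; rewrite /tensor_sum big_map -sumrN; apply: eq_bigr => u _.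
exact: balancedN.
Qed.

Lemma tensor_piD s t : \pi_tensor (s ++ t) = tensor_add (\pi_tensor s) (\pi_tensor t).
Proof.
by apply: tensor_eq => G h bh; rewrite !tensor_sum_cat !tensor_repr.
Qed.

Lemma tensor_piN s :
  \pi_tensor [seq (- u.1, u.2) | u <- s] = tensor_opp (\pi_tensor s).
Proof.
by apply: tensor_eq => G h bh; rewrite !tensor_sum_opp // tensor_repr.
Qed.

Lemma tensor_addA : associative tensor_add.
Proof.
move=> x y z; rewrite -[x]reprK -[y]reprK -[z]reprK.
move: (repr x) (repr y) (repr z) => {x y z} s t u.
by rewrite -(tensor_piD t u) -(tensor_piD s t) -!tensor_piD catA.
Qed.

Lemma tensor_addC : commutative tensor_add.
Proof.
move=> x y; rewrite /tensor_add; apply: tensor_eq => G h bh.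
by rewrite !tensor_sum_cat addrC.
Qed.

Lemma tensor_add0 : left_id tensor_zero tensor_add.
Proof. by move=> x; rewrite -[x]reprK -(tensor_piD [::]). Qed.

Lemma tensor_addN : left_inverse tensor_zero tensor_opp tensor_add.
Proof.
move=> x; rewrite -[x]reprK; move: (repr x) => {x} s.
rewrite -tensor_piN -tensor_piD.
apply: tensor_eq => G h bh.
by rewrite tensor_sum_cat tensor_sum_opp // addNr /tensor_sum big_nil.
Qed.

HB.instance Definition _ := GRing.isZmodule.Build tensor
  tensor_addA tensor_addC tensor_add0 tensor_addN.

Lemma tensor_pi_cat s t : \pi_tensor (s ++ t) = \pi_tensor s + \pi_tensor t.
Proof. exact: tensor_piD. Qed.

Lemma tensor_pi_sum s : \pi_tensor s = \sum_(u <- s) tens u.1 u.2.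
Proof.
elim: s => [|[m n] s IH]; first by rewrite big_nil.
by rewrite big_cons -IH -cat1s tensor_pi_cat.
Qed.

Lemma balanced_tens : balanced tens.
Proof.
split=> [m m' n|m n n'|a m n]; rewrite /tens -?tensor_pi_cat;
  apply: tensor_eq => G h [hl hr hb];
  by rewrite /tensor_sum ?big_cat !big_seq1 /=.
Qed.

Section Lift.
Variables (G : zmodType) (h : M -> N -> G) (bh : balanced h).

Definition tensor_lift of balanced h : tensor -> G :=
  fun x => tensor_sum h (repr x).

Lemma tensor_lift_pi s : tensor_lift bh (\pi_tensor s) = tensor_sum h s.
Proof. exact: tensor_repr. Qed.

Lemma tensor_liftE m n : tensor_lift bh (tens m n) = h m n.
Proof. by rewrite tensor_lift_pi /tensor_sum big_seq1. Qed.

Lemma tensor_lift_zmod : zmod_morphism (tensor_lift bh).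
Proof.
move=> x y; rewrite -[x]reprK -[y]reprK.
move: (repr x) (repr y) => {x y} s t.
have -> : \pi_tensor s - \pi_tensor t =
  \pi_tensor (s ++ [seq (- u.1, u.2) | u <- t]).
  by rewrite tensor_pi_cat tensor_piN.
by rewrite !tensor_lift_pi tensor_sum_cat tensor_sum_opp.
Qed.

HB.instance Definition _ :=
  GRing.isZmodMorphism.Build tensor G (tensor_lift bh) tensor_lift_zmod.
End Lift.

End Tensor.

Section TensorMap.
Variables (R : comPzRingType) (M M' N N' : lmodType R).
Variables (f : {linear M -> M'}) (g : {linear N -> N'}).

Lemma balanced_map : balanced (fun m n => tens (f m) (g n)).
Proof.
have [hl hr hb] := @balanced_tens R M' N'.
split=> [m m' n|m n n'|a m n].
- by rewrite (linearD f) hl.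
- by rewrite (linearD g) hr.
- by rewrite (linearZZ f) (linearZZ g) hb.
Qed.

Definition tensor_map : tensor M N -> tensor M' N' := tensor_lift balanced_map.
End TensorMap.

Definition flat_module (R : comPzRingType) (F : lmodType R) : Prop :=
  forall (M N : lmodType R) (f : {linear M -> N}),
    injective f -> injective (tensor_map f (idfun : {linear F -> F})).

Definition flat_morphism (A B : comPzRingType) (f : {rmorphism A -> B}) : Prop :=
  flat_module (restr_scalars f B^o).

Section AlgebraTensor.
Variables (k A B : comPzRingType).
Variables (f : {rmorphism k -> A}) (g : {rmorphism k -> B}).

Local Notation MA := (restr_scalars f A^o).
Local Notation MB := (restr_scalars g B^o).

Definition atensor : Type := tensor MA MB.

HB.instance Definition _ := GRing.Zmodule.on atensor.

Definition atens (a : A) (b : B) : atensor := tens (a : MA) (b : MB).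

Definition pairs_mul (s t : seq (MA * MB)) : seq (MA * MB) :=
  [seq ((u.1 : A) * (v.1 : A) : MA, (u.2 : B) * (v.2 : B) : MB) | u <- s, v <- t].

Definition atensor_mul (x y : atensor) : atensor :=
  \pi_(tensor MA MB) (pairs_mul (repr (x : tensor MA MB)) (repr (y : tensor MA MB))).

Definition atensor_one : atensor := atens 1 1.

Lemma tensor_sum_mul (G : zmodType) (h : MA -> MB -> G) s t :
  tensor_sum h (pairs_mul s t) =
  \sum_(u <- s) \sum_(v <- t) h ((u.1 : A) * (v.1 : A)) ((u.2 : B) * (v.2 : B)).
Proof. by rewrite /tensor_sum big_allpairs_dep. Qed.

Lemma balanced_mul (G : zmodType) (h : MA -> MB -> G) (c : A) (d : B) :
  balanced h -> balanced (fun (a : MA) (b : MB) => h ((a : A) * c) ((b : B) * d)).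
Proof.
case=> hl hr hb; split=> [a a' b|a b b'|r a b].
- by rewrite mulrDl; exact: hl.
- by rewrite mulrDl; exact: hr.
- by rewrite -[LHS]/(h (f r * a * c) _) -[RHS]/(h _ (g r * b * d)) -!mulrA; exact: hb.
Qed.

Lemma balanced_sum (G : zmodType) (I : Type) (r : seq I) (h : I -> MA -> MB -> G) :
  (forall i, balanced (h i)) ->
  balanced (fun (a : MA) (b : MB) => \sum_(i <- r) h i a b).
Proof.
move=> bh; split=> *; rewrite -?big_split /=; apply: eq_bigr => i _;
  by case: (bh i).
Qed.

Lemma pairs_mulC s t (G : zmodType) (h : MA -> MB -> G) :
  tensor_sum h (pairs_mul s t) = tensor_sum h (pairs_mul t s).
Proof.
rewrite !tensor_sum_mul exchange_big /=; apply: eq_bigr => u _.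
by apply: eq_bigr => v _; rewrite mulrC [X in h _ X]mulrC.
Qed.

Lemma atensor_pi_mul s t :
  atensor_mul (\pi_(tensor MA MB) s) (\pi_(tensor MA MB) t)
  = \pi_(tensor MA MB) (pairs_mul s t).
Proof.
apply: tensor_eq => G h bh.
have key r r' q : \pi_(tensor MA MB) r = \pi_(tensor MA MB) r' ->
    tensor_sum h (pairs_mul r q) = tensor_sum h (pairs_mul r' q).
  move=> /tensor_eqP e; rewrite !tensor_sum_mul.
  pose h' (a : MA) (b : MB) :=
    \sum_(v <- q) h ((a : A) * (v.1 : A)) ((b : B) * (v.2 : B)).
  exact: (e G h' (balanced_sum q (fun v => balanced_mul v.1 v.2 bh))).
rewrite (key _ s) ?reprK // pairs_mulC.
by rewrite (key _ t s) ?reprK // pairs_mulC.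
Qed.

Lemma atensor_mulA : associative atensor_mul.
Proof.
move=> x y z.
rewrite -[x](@reprK _ (tensor MA MB)) -[y](@reprK _ (tensor MA MB)).
rewrite -[z](@reprK _ (tensor MA MB)).
move: (repr _) (repr _) (repr _) => {x y z} s t r; rewrite !atensor_pi_mul.
apply: tensor_eq => G h bh.
rewrite !tensor_sum_mul big_allpairs_dep; apply: eq_bigr => u _.
rewrite big_allpairs_dep; apply: eq_bigr => v _; apply: eq_bigr => w _.
by rewrite !mulrA.
Qed.

Lemma atensor_mulC : commutative atensor_mul.
Proof. by move=> x y; apply: tensor_eq => G h bh; exact: pairs_mulC. Qed.

Lemma atensor_mul1 : left_id atensor_one atensor_mul.
Proof.
move=> x; rewrite -[x](@reprK _ (tensor MA MB)).
move: (repr _) => {x} s; rewrite atensor_pi_mul.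
apply: tensor_eq => G h bh; rewrite tensor_sum_mul big_seq1 /=.
by apply: eq_bigr => v _; rewrite !mul1r.
Qed.

Lemma atensor_mulDl : left_distributive atensor_mul +%R.
Proof.
move=> x y z.
rewrite -[x](@reprK _ (tensor MA MB)) -[y](@reprK _ (tensor MA MB)).
rewrite -[z](@reprK _ (tensor MA MB)).
move: (repr _) (repr _) (repr _) => {x y z} s t r.
rewrite -[_ + _ in LHS](tensor_pi_cat (M := MA) (N := MB)) !atensor_pi_mul.
rewrite -[RHS](tensor_pi_cat (M := MA) (N := MB)).
apply: tensor_eq => G h bh.
by rewrite tensor_sum_cat !tensor_sum_mul big_cat.
Qed.

HB.instance Definition _ := GRing.Zmodule_isComPzRing.Build atensor
  atensor_mulA atensor_mulC atensor_mul1 atensor_mulDl.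

Lemma atensM a b a' b' : atens a b * atens a' b' = atens (a * a') (b * b').
Proof. exact: (atensor_pi_mul [:: (a, b)] [:: (a', b')]). Qed.

Lemma atens_ind (P : atensor -> Prop) :
  P 0 -> (forall a b x, P x -> P (atens a b + x)) -> forall x, P x.
Proof.
move=> P0 PD x; rewrite -[x](@reprK _ (tensor MA MB)) tensor_pi_sum.
elim: (repr _) => [|u s IH]; first by rewrite big_nil.
by rewrite big_cons; exact: PD.
Qed.

Definition atensor_struct (c : k) : atensor := atens (f c) 1.

Lemma atensor_struct_zmod : zmod_morphism atensor_struct.
Proof.
have [hl _ _] := @balanced_tens k MA MB => c d.
rewrite /atensor_struct rmorphB /atens; apply/eqP.
rewrite -subr_eq opprK; apply/eqP.
by rewrite -(hl (f c - f d : MA) (f d : MA)) subrK.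
Qed.

Lemma atensor_struct_monoid : monoid_morphism atensor_struct.
Proof.
split=> [|c d]; first by rewrite /atensor_struct rmorph1.
by rewrite /atensor_struct atensM mulr1 rmorphM.
Qed.

HB.instance Definition _ :=
  GRing.isZmodMorphism.Build k atensor atensor_struct atensor_struct_zmod.
HB.instance Definition _ :=
  GRing.isMonoidMorphism.Build k atensor atensor_struct atensor_struct_monoid.

Section AlgebraLift.
Variables (C : comPzRingType) (i : {rmorphism A -> C}) (j : {rmorphism B -> C}).
Hypothesis ij : forall c, i (f c) = j (g c).

Lemma balanced_alift : balanced (fun (a : MA) (b : MB) => i a * j b).
Proof.
split=> [a a' b|a b b'|c a b].
- by rewrite -mulrDl -rmorphD.
- by rewrite -mulrDr -rmorphD.
- rewrite -[LHS]/(i (f c * a) * j b) -[RHS]/(i a * j (g c * b)).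
  by rewrite !rmorphM ij mulrAC mulrC mulrA.
Qed.

Definition atensor_lift : atensor -> C := tensor_lift balanced_alift.

Lemma atensor_liftE a b : atensor_lift (atens a b) = i a * j b.
Proof. exact: (tensor_liftE balanced_alift). Qed.

Lemma atensor_lift_zmod : zmod_morphism atensor_lift.
Proof. exact: (tensor_lift_zmod balanced_alift). Qed.

HB.instance Definition _ :=
  GRing.isZmodMorphism.Build atensor C atensor_lift atensor_lift_zmod.

Lemma atensor_lift_monoid : monoid_morphism atensor_lift.
Proof.
split=> [|x y]; first by rewrite atensor_liftE !rmorph1 mulr1.
elim/atens_ind: x => [|a b x IHx]; first by rewrite mul0r !raddf0 mul0r.
rewrite mulrDl !raddfD /= mulrDl IHx; congr (_ + _) => {x IHx}.
elim/atens_ind: y => [|c d y IHy]; first by rewrite mulr0 !raddf0 mulr0.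
rewrite mulrDr !raddfD /= mulrDr IHy; congr (_ + _).
by rewrite atensM !atensor_liftE !rmorphM mulrACA.
Qed.

HB.instance Definition _ :=
  GRing.isMonoidMorphism.Build atensor C atensor_lift atensor_lift_monoid.
End AlgebraLift.

Definition atensor_inl (a : A) : atensor := atens a 1.
Definition atensor_inr (b : B) : atensor := atens 1 b.

Lemma atensor_inl_zmod : zmod_morphism atensor_inl.
Proof.
have [hl _ _] := @balanced_tens k MA MB => a a'; apply/eqP.
rewrite /atensor_inl /atens -subr_eq opprK; apply/eqP.
by rewrite -(hl (a - a' : MA) (a' : MA)) subrK.
Qed.

Lemma atensor_inr_zmod : zmod_morphism atensor_inr.
Proof.
have [_ hr _] := @balanced_tens k MA MB => b b'; apply/eqP.
rewrite /atensor_inr /atens -subr_eq opprK; apply/eqP.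
by rewrite -(hr _ (b - b' : MB) (b' : MB)) subrK.
Qed.

Lemma atensor_inl_monoid : monoid_morphism atensor_inl.
Proof. by split=> // a a'; rewrite /atensor_inl atensM mulr1. Qed.

Lemma atensor_inr_monoid : monoid_morphism atensor_inr.
Proof. by split=> // b b'; rewrite /atensor_inr atensM mulr1. Qed.

HB.instance Definition _ :=
  GRing.isZmodMorphism.Build A atensor atensor_inl atensor_inl_zmod.
HB.instance Definition _ :=
  GRing.isMonoidMorphism.Build A atensor atensor_inl atensor_inl_monoid.
HB.instance Definition _ :=
  GRing.isZmodMorphism.Build B atensor atensor_inr atensor_inr_zmod.
HB.instance Definition _ :=
  GRing.isMonoidMorphism.Build B atensor atensor_inr atensor_inr_monoid.

Lemma atensor_in_eq c : atensor_inl (f c) = atensor_inr (g c).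
Proof.
have [_ _ hb] := @balanced_tens k MA MB.
have := hb c (1 : A) (1 : B).
by rewrite -[c *: _ in LHS]/(f c * 1) -[c *: _ in RHS]/(g c * 1) !mulr1.
Qed.
End AlgebraTensor.

Section AlgebraTensorMap.
Variables (k A B A' B' : comPzRingType).
Variables (f : {rmorphism k -> A}) (g : {rmorphism k -> B}).
Variables (f' : {rmorphism k -> A'}) (g' : {rmorphism k -> B'}).
Variables (u : {rmorphism A -> A'}) (v : {rmorphism B -> B'}).
Hypotheses (uf : forall c, u (f c) = f' c) (vg : forall c, v (g c) = g' c).

Lemma atensor_map_compat c :
  (@atensor_inl k A' B' f' g' \o u) (f c) = (@atensor_inr k A' B' f' g' \o v) (g c).
Proof. by rewrite /= uf vg atensor_in_eq. Qed.

Definition atensor_map : {rmorphism atensor f g -> atensor f' g'} :=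
  atensor_lift atensor_map_compat.

Lemma atensor_mapE a b : atensor_map (atens f g a b) = atens f' g' (u a) (v b).
Proof.
rewrite /atensor_map /= atensor_liftE /= /atensor_inl /atensor_inr atensM.
by rewrite mulr1 mul1r.
Qed.
End AlgebraTensorMap.

Section QuotientModule.
Variables (R : pzRingType) (V : lmodType R) (I : zmodClosed V).
Hypothesis IZ : GRing.scaler_closed I.

Definition quotient_mod of GRing.scaler_closed I : Type := Quotient.quot I.
Local Notation lquot := (quotient_mod IZ).
HB.instance Definition _ := GRing.Zmodule.on lquot.

Definition lquot_pi (v : V) : lquot := \pi_(Quotient.quot I) v.

Lemma lquot_piP v w : (lquot_pi v = lquot_pi w) <-> (v - w \in I).
Proof.
rewrite Quotient.idealrBE; split=> [e|/eqP //].
exact/eqP.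
Qed.

Lemma lquot_pi_zmod : zmod_morphism lquot_pi.
Proof. by move=> v w; rewrite /lquot_pi !(Quotient.pi_add, Quotient.pi_opp). Qed.

HB.instance Definition _ :=
  GRing.isZmodMorphism.Build V lquot lquot_pi lquot_pi_zmod.

Lemma lquot_surj (x : lquot) : exists v, x = lquot_pi v.
Proof. by exists (repr (x : Quotient.quot I)); rewrite /lquot_pi reprK. Qed.

Definition lquot_scale (a : R) (x : lquot) : lquot :=
  lquot_pi (a *: repr (x : Quotient.quot I)).

Lemma lquot_scale_pi a v : lquot_scale a (lquot_pi v) = lquot_pi (a *: v).
Proof.
apply/lquot_piP; rewrite -scalerBr; apply: IZ.
by apply/lquot_piP; rewrite /lquot_pi reprK.
Qed.

Lemma lquot_scaleA a b x : lquot_scale a (lquot_scale b x) = lquot_scale (a * b) x.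
Proof. by have [v ->] := lquot_surj x; rewrite !lquot_scale_pi scalerA. Qed.
Lemma lquot_scale1 : left_id 1 lquot_scale.
Proof.
by move=> x; have [v ->] := lquot_surj x; rewrite lquot_scale_pi scale1r.
Qed.
Lemma lquot_scaleDr : right_distributive lquot_scale +%R.
Proof.
move=> a x y; have [v ->] := lquot_surj x; have [w ->] := lquot_surj y.
by rewrite -raddfD !lquot_scale_pi scalerDr raddfD.
Qed.
Lemma lquot_scaleDl x : {morph lquot_scale^~ x : a b / a + b}.
Proof.
move=> a b; have [v ->] := lquot_surj x.
by rewrite !lquot_scale_pi scalerDl raddfD.
Qed.

HB.instance Definition _ := GRing.Zmodule_isLmodule.Build R lquot
  lquot_scaleA lquot_scale1 lquot_scaleDr lquot_scaleDl.
End QuotientModule.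

Section FreeModule.
Variables (I : Type) (R : pzRingType).

Record free_mod : Type := FreeMod {
  fcoef :> I -> R;
  fcoef_finite : finite_set [set i | fcoef i != 0] }.

HB.instance Definition _ := gen_eqMixin free_mod.
HB.instance Definition _ := gen_choiceMixin free_mod.

Lemma free_mod_eq (x y : free_mod) : fcoef x =1 fcoef y -> x = y.
Proof.
case: x y => [x fx] [y fy] /= /funext e; rewrite {x}e in fx *.
by rewrite (Prop_irrelevance fx fy).
Qed.

Lemma free_zero_finite : finite_set [set i | (fun _ : I => 0 : R) i != 0].
Proof.
by apply: (@sub_finite_set _ _ set0) => // i; rewrite /= eqxx.
Qed.
Definition free_zero := FreeMod free_zero_finite.

Lemma free_add_finite (x y : free_mod) : finite_set [set i | x i + y i != 0].
Proof.
have fU : finite_set ([set i | x i != 0] `|` [set i | y i != 0]).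
  by rewrite finite_setU; split; exact: fcoef_finite.
apply: sub_finite_set fU => i /=; apply: contraNP.
move=> /not_orP[/negP /negPn/eqP-> /negP /negPn/eqP->].
by rewrite addr0 eqxx.
Qed.
Definition free_add x y := FreeMod (free_add_finite x y).

Lemma free_opp_finite (x : free_mod) : finite_set [set i | - x i != 0].
Proof.
by apply: sub_finite_set (fcoef_finite x) => i /=; rewrite oppr_eq0.
Qed.
Definition free_opp x := FreeMod (free_opp_finite x).

Lemma free_scale_finite (a : R) (x : free_mod) :
  finite_set [set i | a * x i != 0].
Proof.
apply: sub_finite_set (fcoef_finite x) => i /=.
by apply: contra_neq => ->; rewrite mulr0.
Qed.
Definition free_scale a x := FreeMod (free_scale_finite a x).

Lemma free_addA : associative free_add.
Proof. by move=> x y z; apply: free_mod_eq => i; rewrite /= addrA. Qed.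
Lemma free_addC : commutative free_add.
Proof. by move=> x y; apply: free_mod_eq => i; rewrite /= addrC. Qed.
Lemma free_add0 : left_id free_zero free_add.
Proof. by move=> x; apply: free_mod_eq => i; rewrite /= add0r. Qed.
Lemma free_addN : left_inverse free_zero free_opp free_add.
Proof. by move=> x; apply: free_mod_eq => i; rewrite /= addNr. Qed.

HB.instance Definition _ := GRing.isZmodule.Build free_mod
  free_addA free_addC free_add0 free_addN.

Lemma free_scaleA a b x : free_scale a (free_scale b x) = free_scale (a * b) x.
Proof. by apply: free_mod_eq => i; rewrite /= mulrA. Qed.
Lemma free_scale1 : left_id 1 free_scale.
Proof. by move=> x; apply: free_mod_eq => i; rewrite /= mul1r. Qed.
Lemma free_scaleDr : right_distributive free_scale +%R.
Proof. by move=> a x y; apply: free_mod_eq => i; rewrite /= mulrDr. Qed.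
Lemma free_scaleDl x : {morph free_scale^~ x : a b / a + b}.
Proof. by move=> a b; apply: free_mod_eq => i; rewrite /= mulrDl. Qed.

HB.instance Definition _ := GRing.Zmodule_isLmodule.Build R free_mod
  free_scaleA free_scale1 free_scaleDr free_scaleDl.
End FreeModule.

Section FreeModuleMap.
Variables (I : Type) (R S : pzRingType) (f : {rmorphism R -> S}).

Lemma free_map_finite (x : free_mod I R) : finite_set [set i | f (x i) != 0].
Proof.
apply: sub_finite_set (fcoef_finite x) => i /=.
by apply: contra_neq => ->; rewrite rmorph0.
Qed.
Definition free_map (x : free_mod I R) : free_mod I S :=
  FreeMod (free_map_finite x).

Lemma free_map_linear : linear_for (f \; *:%R) free_map.
Proof.
by move=> a x y; apply: free_mod_eq => i; rewrite /= rmorphD rmorphM.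
Qed.
HB.instance Definition _ :=
  GRing.isLinear.Build R (free_mod I R) (free_mod I S) (f \; *:%R)
    free_map free_map_linear.
End FreeModuleMap.

Section RegularMap.
Variables (R S : pzRingType) (f : {rmorphism R -> S}).

Definition regular_map (a : R^o) : S^o := f a.

Lemma regular_map_linear : linear_for (f \; *:%R) regular_map.
Proof.
by move=> a x y; rewrite -[LHS]/(f (a * x + y)) rmorphD rmorphM.
Qed.
HB.instance Definition _ :=
  GRing.isLinear.Build R R^o S^o (f \; *:%R) regular_map regular_map_linear.
End RegularMap.

Section MinimalOpen.
Variable X : topologicalType.

Definition min_open (p : X) : set X :=
  \bigcap_(V in [set V : set X | open V /\ V p]) V.

(** [leU p q] is p <= q, i.e. q ∈ U_p. *)
Definition leU (p q : X) : Prop := min_open p q.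

Lemma leU_refl p : leU p p.
Proof. by move=> V []. Qed.

Lemma leU_trans p q r : leU p q -> leU q r -> leU p r.
Proof. by move=> pq qr V [oV Vp]; apply: qr; split=> //; apply: pq. Qed.
End MinimalOpen.

Arguments leU_refl {X} p _ _.
Arguments leU_trans {X p q r} _ _ _ _.

Lemma leU_continuous (X Y : topologicalType) (f : X -> Y) (p q : X) :
  continuous f -> leU p q -> leU (f p) (f q).
Proof.
move=> cf pq V [oV Vfp]; apply: (pq (f @^-1` V)); split=> //.
by apply: open_comp => // x _; exact: cf.
Qed.

(** A sheaf on a finite space amounts to its stalks together with the
    restriction maps between them: F(U_p) = F_p, and F(V) is the set of
    families in the product of the F_p, p ∈ V, compatible with the restriction
    maps.  Sheaves of rings and modules are given in this form. *)

Record ringed_finite_space (k : comPzRingType) := RingedFiniteSpace {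
  space :> topologicalType;
  space_finite : finite_set [set: space];
  stalk : space -> comPzRingType;
  res : forall p q : space, leU p q -> {rmorphism stalk p -> stalk q};
  res_id : forall p (h : leU p p) (a : stalk p), res h a = a;
  res_comp : forall p q r (h : leU p q) (h' : leU q r) (h'' : leU p r)
    (a : stalk p), res h' (res h a) = res h'' a;
  struct : forall p, {rmorphism k -> stalk p};
  res_struct : forall p q (h : leU p q) (c : k),
    res h (struct p c) = struct q c }.

Definition finite_space (k : comPzRingType) (X : ringed_finite_space k) : Prop :=
  forall (p q : X) (h : leU p q), flat_morphism (res h).

Section Restriction.
Variables (k : comPzRingType) (X : ringed_finite_space k) (V : set X).

Lemma leU_val (p q : V) : leU p q -> leU (set_val p) (set_val q).
Proof. by apply: leU_continuous; exact: initial_continuous. Qed.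

Lemma restr_finite : finite_set [set: V].
Proof.
apply: (@finite_preimage _ _ setT (set_val : V -> X)); last exact: space_finite.
by move=> p q _ _; exact: val_inj.
Qed.

Definition restr_space : ringed_finite_space k :=
  @RingedFiniteSpace k (V : topologicalType) restr_finite
    (fun p => stalk (set_val p))
    (fun p q h => res (leU_val h))
    (fun p h a => res_id _ a)
    (fun p q r h h' h'' a => res_comp _ _ _ a)
    (fun p => struct (set_val p))
    (fun p q h c => res_struct _ c).
End Restriction.

Section Product.
Variables (k : comPzRingType) (X Y : ringed_finite_space k).

Lemma leU_fst (p q : X * Y) : leU p q -> leU p.1 q.1.
Proof. by apply: leU_continuous => x; exact: cvg_fst. Qed.

Lemma leU_snd (p q : X * Y) : leU p q -> leU p.2 q.2.
Proof. by apply: leU_continuous => x; exact: cvg_snd. Qed.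

Lemma prod_finite : finite_set [set: X * Y].
Proof. by rewrite -setXTT; apply: finite_setX; exact: space_finite. Qed.

Definition prod_stalk (p : X * Y) : comPzRingType :=
  atensor (@struct k X p.1) (@struct k Y p.2).

Definition prod_res (p q : X * Y) (h : leU p q) :
    {rmorphism prod_stalk p -> prod_stalk q} :=
  atensor_map (res_struct (leU_fst h)) (res_struct (leU_snd h)).

Lemma prod_res_id p (h : leU p p) (a : prod_stalk p) : prod_res h a = a.
Proof.
elim/atens_ind: a => [|a b x IH]; first by rewrite rmorph0.
by rewrite rmorphD IH /= atensor_mapE !res_id.
Qed.

Lemma prod_res_comp p q r (h : leU p q) (h' : leU q r) (h'' : leU p r)
  (a : prod_stalk p) : prod_res h' (prod_res h a) = prod_res h'' a.
Proof.
elim/atens_ind: a => [|a b x IH]; first by rewrite !rmorph0.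
rewrite !rmorphD IH /= !atensor_mapE.
by rewrite (res_comp _ _ (leU_fst h'')) (res_comp _ _ (leU_snd h'')).
Qed.

Definition prod_struct (p : X * Y) : {rmorphism k -> prod_stalk p} :=
  @atensor_struct _ _ _ (@struct k X p.1) (@struct k Y p.2).

Lemma prod_res_struct p q (h : leU p q) c :
  prod_res h (prod_struct p c) = prod_struct q c.
Proof. by rewrite /= atensor_mapE res_struct rmorph1. Qed.

Definition prod_space : ringed_finite_space k :=
  @RingedFiniteSpace k (X * Y)%type prod_finite prod_stalk prod_res
    prod_res_id prod_res_comp prod_struct prod_res_struct.
End Product.

(** A morphism of ringed finite spaces over k, with O_Y -> f_* O_X given by
    the maps O_{Y,f(x)} -> O_{X,x}. *)
Record rfs_morphism (k : comPzRingType) (X Y : ringed_finite_space k) := RfsMorphism {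
  rfs_map :> X -> Y;
  rfs_continuous : continuous rfs_map;
  rfs_sharp : forall x, {rmorphism @stalk k Y (rfs_map x) -> @stalk k X x};
  rfs_sharp_res : forall x x' (h : leU x x') (a : stalk (rfs_map x)),
    rfs_sharp x' (res (leU_continuous rfs_continuous h) a) = res h (rfs_sharp x a);
  rfs_sharp_struct : forall x c, rfs_sharp x (struct (rfs_map x) c) = struct x c }.

Section Diagonal.
Variables (k : comPzRingType) (X : ringed_finite_space k).

Definition diag_map (x : X) : prod_space X X := (x, x).

Lemma diag_continuous : continuous diag_map.
Proof. by move=> x; apply: cvg_pair; exact: cvg_id. Qed.

(** The multiplication O_x ⊗_k O_x -> O_x. *)
Definition diag_sharp (x : X) :
    {rmorphism @stalk k (prod_space X X) (diag_map x) -> stalk x} :=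
  @atensor_lift k (stalk x) (stalk x) (struct x) (struct x) (stalk x)
    idfun idfun (fun c => erefl).

Lemma diag_sharp_res x x' (h : leU x x') (a : stalk (diag_map x)) :
  diag_sharp x' (res (leU_continuous diag_continuous h) a) =
  res h (diag_sharp x a).
Proof.
elim/atens_ind: a => [|a b y IH]; first by rewrite !rmorph0.
rewrite !rmorphD IH /= atensor_mapE !atensor_liftE /= rmorphM.
have e c (l : leU x x') : res l c = res h c.
  by rewrite (Prop_irrelevance l h).
by rewrite !e.
Qed.

Lemma diag_sharp_struct x c : diag_sharp x (struct (diag_map x) c) = struct x c.
Proof. by rewrite /= atensor_liftE /= mulr1. Qed.

Definition diag : rfs_morphism X (prod_space X X) :=
  RfsMorphism diag_sharp_res diag_sharp_struct.
End Diagonal.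

Section Modules.
Variables (k : comPzRingType) (X : ringed_finite_space k).

Record omod := OMod {
  mstalk :> forall p : X, lmodType (stalk p);
  mres : forall (p q : X) (h : leU p q),
    {linear mstalk p -> mstalk q | (res h \; *:%R)};
  mres_id : forall p (h : leU p p) (m : mstalk p), mres h m = m;
  mres_comp : forall p q r (h : leU p q) (h' : leU q r) (h'' : leU p r)
    (m : mstalk p), mres h' (mres h m) = mres h'' m }.

Record omod_hom (M N : omod) := OModHom {
  ohom :> forall p, {linear M p -> N p};
  ohom_res : forall p q (h : leU p q) (m : M p),
    ohom q (mres M h m) = mres N h (ohom p m) }.

(** Injectivity and exactness of morphisms of sheaves are tested on stalks. *)

Definition omod_mono (M N : omod) (f : omod_hom M N) : Prop :=
  forall p, injective (f p).

Definition omod_epi (M N : omod) (f : omod_hom M N) : Prop :=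
  forall p n, exists m, f p m = n.

Definition omod_exact (M N P : omod) (f : omod_hom M N) (g : omod_hom N P) : Prop :=
  forall p n, g p n = 0 <-> exists m, f p m = n.

Definition omod_injective (I : omod) : Prop :=
  forall (M N : omod) (i : omod_hom M N) (f : omod_hom M I), omod_mono i ->
    exists g : omod_hom N I, forall p m, g p (i p m) = f p m.

Definition structure_omod : omod :=
  @OMod (fun p => (stalk p)^o) (fun p q h => regular_map (res h))
    (fun p h a => res_id h a)
    (fun p q r h h' h'' a => res_comp h h' h'' a).

Lemma free_omod_id (I : Type) p (h : leU p p) (m : free_mod I (@stalk k X p)) :
  free_map (res h) m = m.
Proof. by apply: free_mod_eq => i; rewrite /= res_id. Qed.

Lemma free_omod_comp (I : Type) p q r (h : leU p q) (h' : leU q r)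
  (h'' : leU p r) (m : free_mod I (@stalk k X p)) :
  free_map (res h') (free_map (res h) m) = free_map (res h'') m.
Proof. by apply: free_mod_eq => i; rewrite /= (res_comp h h' h''). Qed.

Definition free_omod (I : Type) : omod :=
  @OMod (fun p => free_mod I (stalk p)) (fun p q h => free_map (res h))
    (@free_omod_id I) (@free_omod_comp I).

Record inj_resolution (F : omod) := InjResolution {
  rterm :> nat -> omod;
  rdiff : forall n, omod_hom (rterm n) (rterm n.+1);
  raug : omod_hom F (rterm 0);
  rterm_injective : forall n, omod_injective (rterm n);
  raug_mono : omod_mono raug;
  raug_exact : omod_exact raug (rdiff 0);
  rdiff_exact : forall n, omod_exact (rdiff n) (rdiff n.+1) }.
End Modules.

Definition restr_omod (k : comPzRingType) (X : ringed_finite_space k)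
    (V : set X) (M : omod X) : omod (restr_space V) :=
  @OMod k (restr_space V) (fun p => M (set_val p))
    (fun p q h => mres M (leU_val h))
    (fun p h m => mres_id _ m)
    (fun p q r h h' h'' m => mres_comp _ _ _ m).

Definition quasi_coherent (k : comPzRingType) (X : ringed_finite_space k)
    (M : omod X) : Prop :=
  forall p : X, exists V : set X, [/\ open V, V p &
    exists (I J : Type) (u : omod_hom (free_omod (restr_space V) I)
                                      (free_omod (restr_space V) J))
           (v : omod_hom (free_omod (restr_space V) J) (restr_omod V M)),
      omod_epi v /\ omod_exact u v].

(** The stalk of f_* M at y is M(f^-1(U_y)). *)

Section DirectImage.
Variables (k : comPzRingType) (X Y : ringed_finite_space k).
Variable f : rfs_morphism X Y.

Section Stalk.
Variables (M : omod X) (y : Y).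

Record push_stalk : Type := PushStalk {
  psec :> forall x : X, leU y (f x) -> M x;
  psec_compat : forall x x' (h : leU y (f x)) (h' : leU y (f x'))
    (l : leU x x'), mres M l (psec h) = psec h' }.

HB.instance Definition _ := gen_eqMixin push_stalk.
HB.instance Definition _ := gen_choiceMixin push_stalk.

Lemma push_stalk_eq (s t : push_stalk) :
  (forall x (h : leU y (f x)), s x h = t x h) -> s = t.
Proof.
case: s t => [s sc] [t tc] /= e.
have {}e : s = t by apply: functional_extensionality_dep => x; apply/funext => h.
by rewrite {s}e in sc *; rewrite (Prop_irrelevance sc tc).
Qed.

Lemma push_zero_compat x x' (h : leU y (f x)) (h' : leU y (f x'))
  (l : leU x x') : mres M l (0 : M x) = 0.
Proof. exact: linear0. Qed.
Definition push_zero := PushStalk push_zero_compat.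

Lemma push_add_compat (s t : push_stalk) x x' (h : leU y (f x))
  (h' : leU y (f x')) (l : leU x x') :
  mres M l (s x h + t x h) = s x' h' + t x' h'.
Proof. by rewrite linearD !(psec_compat _ h h'). Qed.
Definition push_add s t := PushStalk (push_add_compat s t).

Lemma push_opp_compat (s : push_stalk) x x' (h : leU y (f x))
  (h' : leU y (f x')) (l : leU x x') : mres M l (- s x h) = - s x' h'.
Proof. by rewrite linearN (psec_compat _ h h'). Qed.
Definition push_opp s := PushStalk (push_opp_compat s).

Lemma push_addA : associative push_add.
Proof. by move=> s t u; apply: push_stalk_eq => x h; rewrite /= addrA. Qed.
Lemma push_addC : commutative push_add.
Proof. by move=> s t; apply: push_stalk_eq => x h; rewrite /= addrC. Qed.
Lemma push_add0 : left_id push_zero push_add.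
Proof. by move=> s; apply: push_stalk_eq => x h; rewrite /= add0r. Qed.
Lemma push_addN : left_inverse push_zero push_opp push_add.
Proof. by move=> s; apply: push_stalk_eq => x h; rewrite /= addNr. Qed.

HB.instance Definition _ := GRing.isZmodule.Build push_stalk
  push_addA push_addC push_add0 push_addN.

Lemma push_scale_compat (a : stalk y) (s : push_stalk) x x'
  (h : leU y (f x)) (h' : leU y (f x')) (l : leU x x') :
  mres M l (rfs_sharp f x (res h a) *: s x h) =
  rfs_sharp f x' (res h' a) *: s x' h'.
Proof.
rewrite linearZ /= (psec_compat _ h h') -rfs_sharp_res.
by rewrite (res_comp h _ h').
Qed.
Definition push_scale a s := PushStalk (push_scale_compat a s).

Lemma push_scaleA a b s : push_scale a (push_scale b s) = push_scale (a * b) s.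
Proof. by apply: push_stalk_eq => x h; rewrite /= scalerA !rmorphM. Qed.
Lemma push_scale1 : left_id 1 push_scale.
Proof. by move=> s; apply: push_stalk_eq => x h; rewrite /= !rmorph1 scale1r. Qed.
Lemma push_scaleDr : right_distributive push_scale +%R.
Proof. by move=> a s t; apply: push_stalk_eq => x h; rewrite /= scalerDr. Qed.
Lemma push_scaleDl s : {morph push_scale^~ s : a b / a + b}.
Proof.
by move=> a b; apply: push_stalk_eq => x h; rewrite /= !rmorphD scalerDl.
Qed.

HB.instance Definition _ := GRing.Zmodule_isLmodule.Build (stalk y) push_stalk
  push_scaleA push_scale1 push_scaleDr push_scaleDl.
End Stalk.

Section Res.
Variables (M : omod X) (y z : Y) (l : leU y z).

Definition push_res (s : push_stalk M y) : push_stalk M z :=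
  PushStalk (fun x x' (h : leU z (f x)) (h' : leU z (f x')) =>
    @psec_compat M y s x x' (leU_trans l h) (leU_trans l h')).

Lemma push_res_linear : linear_for (res l \; *:%R) push_res.
Proof.
move=> a s t; apply: push_stalk_eq => x h /=.
by rewrite (res_comp l h (leU_trans l h)).
Qed.
HB.instance Definition _ := GRing.isLinear.Build (stalk y)
  (push_stalk M y) (push_stalk M z) (res l \; *:%R) push_res push_res_linear.
End Res.

Lemma push_res_id (M : omod X) y (l : leU y y) (s : push_stalk M y) :
  push_res l s = s.
Proof.
by apply: push_stalk_eq => x h /=; rewrite (Prop_irrelevance (leU_trans l h) h).
Qed.

Lemma push_res_comp (M : omod X) y z w (l : leU y z) (l' : leU z w)
  (l'' : leU y w) (s : push_stalk M y) :
  push_res l' (push_res l s) = push_res l'' s.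
Proof.
apply: push_stalk_eq => x h /=; congr (psec s _); exact: Prop_irrelevance.
Qed.

Definition push_omod (M : omod X) : omod Y :=
  @OMod k Y (fun y => push_stalk M y) (fun y z l => push_res l)
    (@push_res_id M) (@push_res_comp M).

Section Hom.
Variables (M N : omod X) (g : omod_hom M N).

Section HomStalk.
Variable y : Y.

Lemma push_hom_compat (s : push_stalk M y) x x' (h : leU y (f x))
  (h' : leU y (f x')) (l : leU x x') : mres N l (g x (s x h)) = g x' (s x' h').
Proof. by rewrite -ohom_res (psec_compat _ h h'). Qed.

Definition push_hom_stalk (s : push_stalk M y) : push_stalk N y :=
  PushStalk (push_hom_compat s).

Lemma push_hom_linear : linear push_hom_stalk.
Proof. by move=> a s t; apply: push_stalk_eq => x h; rewrite /= linearP. Qed.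
HB.instance Definition _ := GRing.isLinear.Build (stalk y)
  (push_stalk M y) (push_stalk N y) *:%R push_hom_stalk push_hom_linear.
End HomStalk.

Lemma push_hom_res y z (l : leU y z) (s : push_stalk M y) :
  push_hom_stalk (push_res l s) = push_res l (push_hom_stalk s).
Proof. exact: push_stalk_eq. Qed.

Definition push_hom : omod_hom (push_omod M) (push_omod N) :=
  @OModHom k Y (push_omod M) (push_omod N)
    (fun y => @push_hom_stalk y) push_hom_res.
End Hom.
End DirectImage.

Record omod_complex (k : comPzRingType) (X : ringed_finite_space k) := OModComplex {
  cterm :> nat -> omod X;
  cdiff : forall n, omod_hom (cterm n) (cterm n.+1);
  cdiffK : forall n p (m : cterm n p), cdiff n.+1 p (cdiff n p m) = 0 }.

Section Cohomology.
Variables (k : comPzRingType) (X : ringed_finite_space k).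
Variables (E : omod_complex X) (n : nat).

Section Stalk.
Variable p : X.

Definition cocycle_pred : {pred E n p} := fun m => cdiff E n p m == 0.

Lemma cocycle_closed : GRing.submod_closed cocycle_pred.
Proof.
split=> [|a m m']; rewrite -!topredE /= /cocycle_pred; first by rewrite linear0.
by move=> /eqP e /eqP e'; rewrite linearP e e' scaler0 addr0.
Qed.
HB.instance Definition _ :=
  GRing.isSubmodClosed.Build (stalk p) (E n p) cocycle_pred cocycle_closed.

Record cocycle : Type := Cocycle {
  cval : E n p;
  _ : cval \in cocycle_pred }.
HB.instance Definition _ := [isSub for cval].
HB.instance Definition _ := [Choice of cocycle by <:].
HB.instance Definition _ := [SubChoice_isSubLmodule of cocycle by <:].

(** By convention E^{-1} = 0. *)
Definition is_coboundary : forall i, E i p -> Prop := fun i =>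
  match i with
  | 0 => fun m => m = 0
  | i'.+1 => fun m => exists m', cdiff E i' p m' = m
  end.

Definition coboundary : {pred cocycle} := fun m => `[< is_coboundary (cval m) >].

Lemma is_coboundaryP i (a : stalk p) (m m' : E i p) :
  is_coboundary m -> is_coboundary m' -> is_coboundary (a *: m + m').
Proof.
case: i m m' => [|i] m m' /=; first by move=> -> ->; rewrite scaler0 addr0.
by move=> [x <-] [y <-]; exists (a *: x + y); rewrite linearP.
Qed.

Lemma is_coboundary0 i : @is_coboundary i 0.
Proof. by case: i => [|i] //=; exists 0; rewrite linear0. Qed.

Lemma coboundary_zmod : zmod_closed coboundary.
Proof.
split=> [|m m' /asboolP bm /asboolP bm']; apply/asboolP.
  exact: is_coboundary0.
by rewrite /= addrC -scaleN1r; exact: is_coboundaryP.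
Qed.
HB.instance Definition _ :=
  GRing.isZmodClosed.Build cocycle coboundary coboundary_zmod.

Lemma coboundary_scale : GRing.scaler_closed coboundary.
Proof.
move=> a m /asboolP bm; apply/asboolP; rewrite /= -[_ *: _]addr0.
by apply: is_coboundaryP => //; exact: is_coboundary0.
Qed.

Definition cohomology_stalk : lmodType (stalk p) :=
  quotient_mod coboundary_scale.
End Stalk.

Section Res.
Variables (p q : X) (h : leU p q).

Lemma cocycle_res_subproof (m : cocycle p) : mres (E n) h (cval m) \in @cocycle_pred q.
Proof.
case: m => m /=; rewrite -!topredE /= /cocycle_pred => /eqP e.
by rewrite ohom_res e linear0.
Qed.
Definition cocycle_res (m : cocycle p) : cocycle q :=
  Cocycle (cocycle_res_subproof m).

Lemma coboundary_res (m : cocycle p) :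
  m \in @coboundary p -> cocycle_res m \in @coboundary q.
Proof.
move=> /asboolP bm; apply/asboolP => /=; move: bm.
rewrite /is_coboundary; move: (cval m) => {m}.
case: (n) => [|i] m; first by move=> ->; rewrite linear0.
by move=> [m' <-]; exists (mres (E i) h m'); rewrite ohom_res.
Qed.

Definition cohomology_res (c : cohomology_stalk p) : cohomology_stalk q :=
  lquot_pi _ (cocycle_res (repr (c : Quotient.quot (@coboundary p)))).

Lemma cohomology_res_pi (m : cocycle p) :
  cohomology_res (lquot_pi _ m) = lquot_pi _ (cocycle_res m).
Proof.
apply/lquot_piP; set m' := repr _.
have -> : cocycle_res m' - cocycle_res m = cocycle_res (m' - m).
  by apply: val_inj; rewrite /= linearB.
apply: coboundary_res; apply/(lquot_piP (@coboundary_scale p)).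
by rewrite /lquot_pi reprK.
Qed.

Lemma cohomology_res_linear : linear_for (res h \; *:%R) cohomology_res.
Proof.
move=> a c d; have [x ->] := lquot_surj c; have [y ->] := lquot_surj d.
rewrite -[a *: _]/(lquot_scale a _) lquot_scale_pi -raddfD !cohomology_res_pi.
rewrite -[(_ \; _) a _]/(lquot_scale (res h a) _) lquot_scale_pi -raddfD.
by congr lquot_pi; apply: val_inj; rewrite /= linearP.
Qed.
HB.instance Definition _ := GRing.isLinear.Build (stalk p)
  (cohomology_stalk p) (cohomology_stalk q) (res h \; *:%R)
  cohomology_res cohomology_res_linear.
End Res.

Lemma cohomology_res_id p (h : leU p p) (c : cohomology_stalk p) :
  cohomology_res h c = c.
Proof.
have [m ->] := lquot_surj c; rewrite cohomology_res_pi.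
by congr lquot_pi; apply: val_inj; rewrite /= mres_id.
Qed.

Lemma cohomology_res_comp p q r (h : leU p q) (h' : leU q r) (h'' : leU p r)
  (c : cohomology_stalk p) :
  cohomology_res h' (cohomology_res h c) = cohomology_res h'' c.
Proof.
have [m ->] := lquot_surj c; rewrite !cohomology_res_pi.
by congr lquot_pi; apply: val_inj; rewrite /= (mres_comp h h' h'').
Qed.

Definition cohomology : omod X :=
  @OMod k X cohomology_stalk (fun p q h => cohomology_res h)
    cohomology_res_id cohomology_res_comp.
End Cohomology.

Section HigherDirectImage.
Variables (k : comPzRingType) (X Y : ringed_finite_space k).
Variables (f : rfs_morphism X Y) (F : omod X).

Lemma push_diffK (I : inj_resolution F) n y (s : push_omod f (I n) y) :
  push_hom f (rdiff I n.+1) y (push_hom f (rdiff I n) y s) = 0.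
Proof.
by apply: push_stalk_eq => x h /=; apply/rdiff_exact; eexists.
Qed.

Definition push_resolution (I : inj_resolution F) : omod_complex Y :=
  OModComplex (@push_diffK I).

(** R^i f_* F, computed by the injective resolution I; up to isomorphism it
    does not depend on I. *)
Definition higher_direct_image (I : inj_resolution F) (i : nat) : omod Y :=
  cohomology (push_resolution I) i.
End HigherDirectImage.

Definition schematic (k : comPzRingType) (X : ringed_finite_space k) : Prop :=
  finite_space X /\
  forall i : nat, exists I : inj_resolution (structure_omod X),
    quasi_coherent (higher_direct_image (diag X) I i).

(* Main.v *)
Require Import Defs.
From HB Require Import structures.
From mathcomp Require Import all_boot all_algebra.
From mathcomp Require Import generic_quotient ring_quotient.
From mathcomp Require Import all_classical topology_structure.
From mathcomp Require Import product_topology initial_topology subtype_topology.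

(** An O-module M is quasi-coherent iff M_p ⊗ O_q -> M_q is bijective for all
    p <= q.  The stalk of R^i δ_* O at (p, q) is H^i(U_p ∩ U_q, O).  If X is
    schematic, so is every U_p, because the preimage of U_p × U_p under δ is U_p
    and an injective resolution of O restricts to one on U_p.

    Conversely, fix p <= p' and an injective resolution J of O.  For an open
    V ⊆ U_p, the complex J(V) ⊗_{O_p} O_p' is quasi-isomorphic to J(V ∩ U_p').
    For V = U_x this says that O_x ⊗ O_p' = O(U_x ∩ U_p') and that
    H^i(U_x ∩ U_p', O) = 0 for i > 0, and both follow from U_p being schematic.
    The general case is an induction on V by Mayer-Vietoris, with x minimal in V
    and V = U_x ∪ (V - {y <= x}); the tensor product preserves the
    Mayer-Vietoris sequences because O_p -> O_p' is flat.  Taking cohomology with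
    V = U_p ∩ U_q gives the base change of R^i δ_* O from (p, q) to (p', q), and
    a step in each factor suffices. *)

Set Implicit Arguments.
Unset Strict Implicit.
Unset Printing Implicit Defensive.

Import GRing.Theory.

Local Open Scope classical_set_scope.
Local Open Scope ring_scope.
Local Open Scope quotient_scope.

(** * Quotients, submodules, products and free modules *)

(** The vanishing on U_x ∩ U_p' is a comparison of two points of U_p × U_p. At (p, x) the stalk of
    R^i δ_* O is H^i(U_x, O), which is zero for i > 0 because U_x has a least point, so that
    sections over it are germs. Base change from (p, x) to (p', x) carries this to H^i(U_x ∩ U_p',
    O). In degree 0 the same move gives O_x ⊗ O_p', once base change over O_p ⊗_k O_x is brought
    back to O_p by M ⊗_(A ⊗ C) (B ⊗ C) = M ⊗_A B. That identity is also the reason for moving one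
    factor of X × X at a time: each step then rests on a single flat map O_p -> O_p'.

    The definition of schematic offers some resolution of O on U_p for each degree, unrelated to J.
    Vanishing is therefore carried from one resolution to another by a homotopy equivalence, and
    injectives are shown to restrict to injectives on open sets.

    Quasi-isomorphisms are stated as acyclicity of cones, so that Mayer-Vietoris becomes a chase
    among acyclic complexes. *)

Definition additive_pack (U V : zmodType) (g : U -> V) (gB : zmod_morphism g) :
    {additive U -> V} :=
  HB.pack g (GRing.isZmodMorphism.Build U V g gB).

Definition semilinear_pack (R S : pzRingType) (f : {rmorphism R -> S})
    (U : lmodType R) (V : lmodType S) (g : U -> V)
    (gl : linear_for (f \; *:%R) g) : {linear U -> V | (f \; *:%R)} :=
  HB.pack g (GRing.isLinear.Build R U V (f \; *:%R) g gl).

Definition linear_pack (R : pzRingType) (U V : lmodType R) (g : U -> V)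
    (gl : linear g) : {linear U -> V} :=
  HB.pack g (GRing.isLinear.Build R U V *:%R g gl).

Section Quotients.
Variables (R : pzRingType) (V : lmodType R).

Record submodule := Submodule {
  sub_in :> V -> Prop;
  sub_in0 : sub_in 0;
  sub_inP : forall a x y, sub_in x -> sub_in y -> sub_in (a *: x + y) }.

Variable K : submodule.

Lemma sub_inZ a x : K x -> K (a *: x).
Proof. by move=> Kx; rewrite -[_ *: _]addr0; apply: sub_inP => //; exact: sub_in0. Qed.

Definition sub_pred : {pred V} := fun x => `[< K x >].

Lemma sub_predP x : reflect (K x) (x \in sub_pred).
Proof. exact: asboolP. Qed.

Lemma sub_pred_submod : GRing.submod_closed sub_pred.
Proof.
split=> [|a x y /sub_predP Kx /sub_predP Ky]; apply/sub_predP.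
  exact: sub_in0.
exact: sub_inP.
Qed.
HB.instance Definition _ :=
  GRing.isSubmodClosed.Build R V sub_pred sub_pred_submod.

Lemma sub_pred_scale : GRing.scaler_closed sub_pred.
Proof. by move=> a x /sub_predP Kx; apply/sub_predP; exact: sub_inZ. Qed.

Definition modq : lmodType R := quotient_mod sub_pred_scale.
Definition qpi (x : V) : modq := lquot_pi sub_pred_scale x.

Lemma qpi_linear : linear qpi.
Proof.
move=> a x y; rewrite -[RHS]/(lquot_scale a (qpi x) + qpi y).
by rewrite /qpi lquot_scale_pi -raddfD.
Qed.
HB.instance Definition _ := GRing.isLinear.Build R V modq *:%R qpi qpi_linear.

Lemma qpi_surj (c : modq) : exists x, c = qpi x.
Proof. exact: lquot_surj. Qed.

Lemma qpi_eq0 x : qpi x = 0 <-> K x.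
Proof.
rewrite -(linear0 qpi); split=> [/lquot_piP|Kx]; first by rewrite subr0 => /sub_predP.
by apply/lquot_piP; rewrite subr0; apply/sub_predP.
Qed.

Definition qrepr (c : modq) : V := repr (c : Quotient.quot sub_pred).

Lemma qreprK c : qpi (qrepr c) = c.
Proof. by rewrite /qpi /lquot_pi reprK. Qed.

(** Maps out of the quotient are defined by evaluation at [qrepr]. The chosen representative differs
    from [x] by an element of [K], so the choice disappears. *)
Lemma qrepr_lift (G : zmodType) (h : V -> G) : zmod_morphism h ->
  (forall x, K x -> h x = 0) -> forall x, h (qrepr (qpi x)) = h x.
Proof.
move=> hB hK x; apply/eqP; rewrite -subr_eq0 -hB; apply/eqP/hK.
by apply/qpi_eq0; rewrite linearB /= qreprK subrr.
Qed.

Record submod : Type := SubMod { smval : V; _ : smval \in sub_pred }.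
HB.instance Definition _ := [isSub for smval].
HB.instance Definition _ := [Choice of submod by <:].
HB.instance Definition _ := [SubChoice_isSubLmodule of submod by <:].

Lemma smvalP (x : submod) : K (smval x).
Proof. by apply/sub_predP; case: x. Qed.

Definition submod_in x (Kx : K x) : submod := SubMod (introT (sub_predP x) Kx).

Lemma smval_linear : linear smval.
Proof. by move=> a x y; rewrite -[smval]/(val : submod -> V) linearP. Qed.
HB.instance Definition _ := GRing.isLinear.Build R submod V *:%R smval smval_linear.

Lemma smval_inj : injective smval.
Proof. exact: val_inj. Qed.
End Quotients.

Section KernelImage.
Variables (R : pzRingType) (U V : lmodType R) (f : {linear U -> V}).

Definition kernel : submodule U.
Proof.
exists (fun x => f x = 0) => [|a x y fx fy]; first exact: linear0.
by rewrite linearP fx fy scaler0 addr0.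
Defined.

Definition image : submodule V.
Proof.
exists (fun y => exists x, f x = y) => [|a _ _ [x <-] [y <-]].
  by exists 0; rewrite linear0.
by exists (a *: x + y); rewrite linearP.
Defined.
End KernelImage.


(** * Products of modules over different rings *)

Section Families.
Variables (A : pzRingType) (I : Type) (R : I -> pzRingType).
Variables (rho : forall i, {rmorphism A -> R i}) (M : forall i, lmodType (R i)).

(** The argument is a phantom. It records the ring maps through which [A] acts, so that the module
    structure can be inferred from the type. Sections, products of skyscrapers and extensions by
    zero all have this form. *)
Definition family of (forall i, {rmorphism A -> R i}) : Type := forall i, M i.
Local Notation fam := (family rho).

HB.instance Definition _ := gen_eqMixin fam.
HB.instance Definition _ := gen_choiceMixin fam.

Lemma fam_eq (s t : fam) : (forall i, s i = t i) -> s = t.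
Proof. by move=> e; apply: functional_extensionality_dep. Qed.

Definition fam_zero : fam := fun i => 0.
Definition fam_add (s t : fam) : fam := fun i => s i + t i.
Definition fam_opp (s : fam) : fam := fun i => - s i.
Definition fam_scale (a : A) (s : fam) : fam := fun i => rho i a *: s i.

Lemma fam_addA : associative fam_add.
Proof. by move=> s t u; apply: fam_eq => i; rewrite /fam_add addrA. Qed.
Lemma fam_addC : commutative fam_add.
Proof. by move=> s t; apply: fam_eq => i; rewrite /fam_add addrC. Qed.
Lemma fam_add0 : left_id fam_zero fam_add.
Proof. by move=> s; apply: fam_eq => i; rewrite /fam_add add0r. Qed.
Lemma fam_addN : left_inverse fam_zero fam_opp fam_add.
Proof. by move=> s; apply: fam_eq => i; rewrite /fam_add addNr. Qed.
HB.instance Definition _ := GRing.isZmodule.Build fam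
  fam_addA fam_addC fam_add0 fam_addN.

Lemma fam_scaleA a b s : fam_scale a (fam_scale b s) = fam_scale (a * b) s.
Proof. by apply: fam_eq => i; rewrite /fam_scale scalerA rmorphM. Qed.
Lemma fam_scale1 : left_id 1 fam_scale.
Proof. by move=> s; apply: fam_eq => i; rewrite /fam_scale rmorph1 scale1r. Qed.
Lemma fam_scaleDr : right_distributive fam_scale +%R.
Proof. by move=> a s t; apply: fam_eq => i; exact: scalerDr. Qed.
Lemma fam_scaleDl s : {morph fam_scale^~ s : a b / a + b}.
Proof.
by move=> a b; apply: fam_eq => i; rewrite /fam_scale rmorphD; exact: scalerDl.
Qed.
HB.instance Definition _ := GRing.Zmodule_isLmodule.Build A fam
  fam_scaleA fam_scale1 fam_scaleDr fam_scaleDl.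

Lemma famP a (s t : fam) i : (a *: s + t) i = rho i a *: s i + t i.
Proof. by []. Qed.
End Families.

(** * Maps out of free modules *)

Section FreeEval.
Variables (I : Type) (R : pzRingType) (G : zmodType) (c : I -> R -> G).
Hypothesis cB : forall i, zmod_morphism (c i).

(** The target is only an abelian group and the [c i] are only additive, which covers maps into
    tensor products and into Z-modules as well as linear maps. *)
Definition free_eval (x : free_mod I R) : G :=
  \sum_(i \in [set i : {classic I} | x i != 0]) c i (x i).

Lemma free_eval_seq (s : seq {classic I}) (x : free_mod I R) : uniq s ->
  (forall i, x i != 0 -> i \in s) -> free_eval x = \sum_(i <- s) c i (x i).
Proof.
move=> us xs; have c0 i : c i 0 = 0 by have := cB i 0 0; rewrite !subrr.
rewrite /free_eval (@fsbig_fwiden _ _ _ _ s) //.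
by move=> i [_ /=]; case: (eqVneq (x i) 0) => [-> _|].
Qed.

Lemma free_suppU (x y : free_mod I R) : exists2 s : seq {classic I}, uniq s &
  forall i, (x i != 0) || (y i != 0) -> i \in s.
Proof.
have /finite_seqP[s es] :
    finite_set ([set i : {classic I} | x i != 0] `|` [set i | y i != 0]).
  by rewrite finite_setU; split; exact: fcoef_finite.
exists (undup s); first exact: undup_uniq.
move=> i /orP xy; apply: etrans (mem_undup s i) _.
by move: es; rewrite predeqE => /(_ i)[+ _]; exact.
Qed.

Lemma free_eval_zmod : zmod_morphism free_eval.
Proof.
move=> x y; have [s us xys] := free_suppU x y.
have sB i : (x - y) i != 0 -> i \in s.
  move=> /= xyi; apply: xys; apply: contraNT xyi; rewrite negb_or !negbK.
  by move=> /andP[/eqP-> /eqP->]; rewrite oppr0 addr0.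
have sx i : x i != 0 -> i \in s by move=> xi; apply: xys; rewrite xi.
have sy i : y i != 0 -> i \in s by move=> yi; apply: xys; rewrite yi orbT.
rewrite (free_eval_seq us sx) (free_eval_seq us sy) (free_eval_seq us sB) -sumrB.
by apply: eq_bigr => i _; rewrite /= cB.
Qed.
End FreeEval.

Section FreeGen.
Variables (I : Type) (R : pzRingType).

Lemma free_gen_finite (i : I) (a : R) :
  finite_set [set j | (if `[< i = j >] then a else 0) != 0].
Proof.
apply: (@sub_finite_set _ _ [set i]); last exact: finite_set1.
by move=> j /=; case: asboolP => // _; rewrite eqxx.
Qed.

Definition free_gen (i : I) (a : R) : free_mod I R := FreeMod (free_gen_finite i a).

Lemma free_gen_zmod i : zmod_morphism (free_gen i).
Proof.
move=> a b; apply: free_mod_eq => j /=.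
by case: asboolP; rewrite ?subr0 ?oppr0 ?addr0.
Qed.

Lemma free_eval_gen (G : zmodType) (c : I -> R -> G) :
  (forall i, zmod_morphism (c i)) -> forall i a, free_eval c (free_gen i a) = c i a.
Proof.
move=> cB i a; rewrite (free_eval_seq cB (s := [:: (i : {classic I})])) //.
  by rewrite big_seq1 /=; case: asboolP.
move=> j /=; case: asboolP => [<- _|_]; last by rewrite eqxx.
by rewrite (mem_seq1 (i : {classic I})); apply/eqP.
Qed.

Lemma free_eval_id (x : free_mod I R) : free_eval free_gen x = x.
Proof.
have [s us xs] := free_suppU x x.
rewrite (free_eval_seq free_gen_zmod us) => [|i xi]; last by apply: xs; rewrite xi.
apply: free_mod_eq => j; rewrite -[LHS]/((@fcoef _ _)^~ j _).
have mB : {morph (@fcoef I R)^~ j : u v / u + v} by [].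
rewrite (big_morph _ mB (erefl : (0 : free_mod I R) j = 0)) /=.
have [js|js] := boolP ((j : {classic I}) \in s).
  rewrite (bigD1_seq (j : {classic I})) //= big1 => [|i ij].
    by rewrite addr0; case: asboolP.
  by case: asboolP ij => // ->; rewrite eqxx.
have -> : x j = 0.
  by apply/eqP; apply: contraNT js => xj; apply: xs; rewrite xj.
apply: big1_seq => i /= js'; case: asboolP => // ij; move: js.
by rewrite -ij js'.
Qed.

Lemma free_mod_ind (P : free_mod I R -> Prop) :
  P 0 -> (forall x y, P x -> P y -> P (x + y)) -> (forall i a, P (free_gen i a)) ->
  forall x, P x.
Proof.
move=> P0 PD Pg x; rewrite -[x]free_eval_id.
have [s us xs] := free_suppU x x.
rewrite (free_eval_seq free_gen_zmod us) => [|i xi]; last by apply: xs; rewrite xi.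
by elim/big_rec: _ => // i y _; exact: PD.
Qed.

Lemma free_gen_scale (a b : R) i : free_gen i (a * b) = a *: free_gen i b.
Proof. by apply: free_mod_eq => j /=; case: asboolP; rewrite ?mulr0. Qed.
End FreeGen.

Lemma free_map_gen (I : Type) (R S : pzRingType) (f : {rmorphism R -> S}) i a :
  free_map f (@free_gen I R i a) = free_gen i (f a).
Proof. by apply: free_mod_eq => j /=; case: asboolP => // _; rewrite rmorph0. Qed.

(** * Exactness of the tensor product *)

Section ZmodQuotient.
Variables (G : zmodType) (P : G -> Prop).
Hypotheses (P0 : P 0) (PB : forall x y, P x -> P y -> P (x - y)).

(** The closure proofs are arguments so that the subgroup structure can be inferred from the
    predicate. *)
Definition zsub_pred of P 0 & (forall x y, P x -> P y -> P (x - y)) : {pred G} :=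
  fun x => `[< P x >].
Local Notation K := (zsub_pred P0 PB).

Lemma zsub_closed : zmod_closed K.
Proof.
by split=> [|x y /asboolP Px /asboolP Py]; apply/asboolP => //; exact: PB.
Qed.
HB.instance Definition _ := GRing.isZmodClosed.Build G K zsub_closed.

Definition zquot : zmodType := Quotient.quot K.
Definition zpi (x : G) : zquot := \pi_(Quotient.quot K) x.

Lemma zpi_zmod : zmod_morphism zpi.
Proof. by move=> x y; rewrite /zpi !(Quotient.pi_add, Quotient.pi_opp). Qed.
HB.instance Definition _ := GRing.isZmodMorphism.Build G zquot zpi zpi_zmod.

Lemma zpi_surj (c : zquot) : exists x, c = zpi x.
Proof. by exists (repr c); rewrite /zpi reprK. Qed.

Lemma zpi_eq0 x : zpi x = 0 <-> P x.
Proof.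
rewrite -(raddf0 zpi) -[x in P x]subr0; split=> [/eqP|Px].
  by rewrite -[_ == _]/(_ == _ %[mod Quotient.quot K]) -Quotient.idealrBE => /asboolP.
by apply/eqP; rewrite -[_ == _]/(_ == _ %[mod Quotient.quot K]) -Quotient.idealrBE; apply/asboolP.
Qed.
End ZmodQuotient.

Section TensorFunctor.
Variables (R : comPzRingType) (F : lmodType R).
Local Notation T M := (tensor M F).

Lemma tensor_ind (M : lmodType R) (P : T M -> Prop) :
  P 0 -> (forall x y, P x -> P y -> P (x + y)) -> (forall m b, P (tens m b)) ->
  forall t, P t.
Proof.
move=> P0 PD Pt t; rewrite -[t]reprK tensor_pi_sum.
by elim/big_rec: _ => // u y _; exact: PD.
Qed.

Lemma tensDl (M : lmodType R) (m m' : M) (b : F) :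
  tens (m + m') b = tens m b + tens m' b.
Proof. by have [-> _ _] := @balanced_tens R M F. Qed.

Lemma tensDr (M : lmodType R) (m : M) (b b' : F) :
  tens m (b + b') = tens m b + tens m b'.
Proof. by have [_ -> _] := @balanced_tens R M F. Qed.

Lemma tensZ (M : lmodType R) a (m : M) (b : F) : tens (a *: m) b = tens m (a *: b).
Proof. by have [_ _ ->] := @balanced_tens R M F. Qed.

Lemma tens0l (M : lmodType R) (b : F) : tens (0 : M) b = 0.
Proof. by apply: (@addrI _ (tens 0 b)); rewrite -tensDl !addr0. Qed.

Lemma tensBl (M : lmodType R) (m m' : M) (b : F) :
  tens (m - m') b = tens m b - tens m' b.
Proof. by rewrite tensDl (balancedN (@balanced_tens R M F)). Qed.

Definition tmap (M N : lmodType R) (f : {linear M -> N}) : T M -> T N :=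
  tensor_map f (idfun : {linear F -> F}).
HB.instance Definition _ (M N : lmodType R) (f : {linear M -> N}) :=
  GRing.isZmodMorphism.Build (T M) (T N) (tmap f) (tensor_lift_zmod _).

Lemma tmapE (M N : lmodType R) (f : {linear M -> N}) m b :
  tmap f (tens m b) = tens (f m) b.
Proof. exact: tensor_liftE. Qed.

Lemma tmap_comp (M N P : lmodType R) (f : {linear M -> N}) (g : {linear N -> P})
    (h : {linear M -> P}) : (forall m, g (f m) = h m) ->
  forall t, tmap g (tmap f t) = tmap h t.
Proof.
move=> e; elim/tensor_ind => [|x y IHx IHy|m b]; first by rewrite !raddf0.
  by rewrite !raddfD /= IHx IHy.
by rewrite !tmapE e.
Qed.

Lemma tmap_null (M N : lmodType R) (f : {linear M -> N}) :
  (forall m, f m = 0) -> forall t, tmap f t = 0.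
Proof.
move=> e; elim/tensor_ind => [|x y IHx IHy|m b]; first by rewrite !raddf0.
  by rewrite !raddfD /= IHx IHy addr0.
by rewrite !tmapE e tens0l.
Qed.

Lemma tmap_surj (M N : lmodType R) (f : {linear M -> N}) :
  (forall n, exists m, f m = n) -> forall t, exists t', tmap f t' = t.
Proof.
move=> fs; elim/tensor_ind => [|x y [x' <-] [y' <-]|n b].
- by exists 0; rewrite raddf0.
- by exists (x' + y'); rewrite raddfD.
- by have [m <-] := fs n; exists (tens m b); rewrite tmapE.
Qed.

Hypothesis flatF : flat_module F.

Lemma tmap_inj (M N : lmodType R) (f : {linear M -> N}) :
  injective f -> injective (tmap f).
Proof. exact: flatF. Qed.

Section Exact.
Variables (M N P : lmodType R) (f : {linear M -> N}) (g : {linear N -> P}).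
Hypothesis fg : forall n, g n = 0 -> exists m, f m = n.

Let im (t : T N) := exists t', tmap f t' = t.

Let im0 : im 0. Proof. by exists 0; rewrite raddf0. Qed.

Let imB x y : im x -> im y -> im (x - y).
Proof. by move=> [x' <-] [y' <-]; exists (x' - y'); rewrite raddfB. Qed.

(** Induces (N / ker g) ⊗ F -> (N ⊗ F) / im(f ⊗ F), well defined because ker g lies in the image of
    [f]. *)
Let inv (c : modq (kernel g)) (b : F) : zquot im0 imB := zpi _ _ (tens (qrepr c) b).

Let inv_pi n b : inv (qpi _ n) b = zpi _ _ (tens n b).
Proof.
apply: (qrepr_lift (h := fun n => zpi im0 imB (tens n b))) => [x y|x gx].
  by rewrite tensBl raddfB.
by apply/zpi_eq0; have [m <-] := fg gx; exists (tens m b); rewrite tmapE.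
Qed.

Let inv_balanced : balanced inv.
Proof.
split=> [c c' b|c b b'|a c b].
- have [n ->] := qpi_surj c; have [n' ->] := qpi_surj c'.
  by rewrite -linearD !inv_pi tensDl raddfD.
- by rewrite /inv tensDr raddfD.
- by have [n ->] := qpi_surj c; rewrite -linearZ !inv_pi tensZ.
Qed.

Let gbar (c : modq (kernel g)) : P := g (qrepr c).

Let gbar_pi n : gbar (qpi _ n) = g n.
Proof. by apply: qrepr_lift => // x y; rewrite linearB. Qed.

Let gbar_linear : linear gbar.
Proof.
move=> a c c'; have [n ->] := qpi_surj c; have [n' ->] := qpi_surj c'.
by rewrite -linearP !gbar_pi linearP.
Qed.

(** The map [g] factors through an injection of N / ker g into P, which stays injective after
    tensoring by flatness. An element killed by g ⊗ F therefore vanishes in (N / ker g) ⊗ F, and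
    [inv] sends it to its class modulo im(f ⊗ F). *)
Lemma tmap_exact t : tmap g t = 0 -> exists t', tmap f t' = t.
Proof.
pose G := linear_pack gbar_linear.
have Ginj : injective G.
  move=> c c'; have [n ->] := qpi_surj c; have [n' ->] := qpi_surj c'.
  rewrite -![G _]/(gbar _) !gbar_pi => /eqP; rewrite -subr_eq0 -linearB => /eqP gnn.
  by apply/eqP; rewrite -subr_eq0 -linearB; apply/eqP/qpi_eq0.
move=> gt; have pit : tmap (qpi (kernel g)) t = 0.
  apply: (tmap_inj Ginj); rewrite raddf0 (tmap_comp (h := g)) //.
have e x : tensor_lift inv_balanced (tmap (qpi (kernel g)) x) = zpi im0 imB x.
  elim/tensor_ind: x => [|x y IHx IHy|m b]; first by rewrite !raddf0.
    by rewrite !raddfD /= IHx IHy.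
  by rewrite tmapE tensor_liftE inv_pi.
by have := e t; rewrite pit raddf0 => /esym/zpi_eq0.
Qed.
End Exact.

Section Pullback.
Variables (N N1 N2 N3 : lmodType R).
Variables (f1 : {linear N -> N1}) (f2 : {linear N -> N2}).
Variables (g1 : {linear N1 -> N3}) (g2 : {linear N2 -> N3}).
Hypothesis fg : forall n, g1 (f1 n) = g2 (f2 n).
Hypothesis f_inj : forall n, f1 n = 0 -> f2 n = 0 -> n = 0.
Hypothesis f_glue : forall n1 n2, g1 n1 = g2 n2 -> exists n, f1 n = n1 /\ f2 n = n2.
Hypothesis g2_surj : forall n3, exists n2, g2 n2 = n3.

Let i : {linear submod (kernel f1) -> N} := @smval R N (kernel f1).

Let i2_linear : linear (fun x => f2 (i x)).
Proof. by move=> a x y; rewrite !linearP. Qed.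
Let i2 := linear_pack i2_linear.

(** An element killed by f1 ⊗ F comes from ker f1 ⊗ F, and ker f1 embeds into N2 by [f2], so
    flatness applies. *)
Lemma tmap_pullback_inj t : tmap f1 t = 0 -> tmap f2 t = 0 -> t = 0.
Proof.
move=> t1 t2; have [u uE] : exists u, tmap i u = t.
  by apply: tmap_exact t1 => n fn; exists (submod_in (K := kernel f1) fn).
suff u0 : u = 0 by rewrite -uE u0 raddf0.
have i2_inj : injective i2.
  move=> x y; rewrite -![i2 _]/(f2 (i _)) => /eqP; rewrite -subr_eq0 -!linearB.
  move=> /eqP f2xy; apply: smval_inj; apply/eqP; rewrite -subr_eq0 -linearB.
  by apply/eqP; apply: f_inj f2xy; exact: (smvalP (x - y)).
by apply: (tmap_inj i2_inj); rewrite raddf0 -t2 -uE (tmap_comp (h := i2)).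
Qed.

(** [f1] is surjective because [g2] is, so [t1] lifts. The error in the second component is killed
    by g2 ⊗ F, hence comes from ker f1 ⊗ F by exactness of ker f1 -> N2 -> N3, and can be corrected
    without changing the first component. *)
Lemma tmap_pullback_glue t1 t2 : tmap g1 t1 = tmap g2 t2 ->
  exists t, tmap f1 t = t1 /\ tmap f2 t = t2.
Proof.
move=> e; have [t tE] : exists t, tmap f1 t = t1.
  apply: tmap_surj => n1; have [n2 /esym/f_glue[n [fn _]]] := g2_surj (g1 n1).
  by exists n.
have [u uE] : exists u, tmap i2 u = t2 - tmap f2 t.
  apply: (@tmap_exact _ _ _ i2 g2) => [n2 gn2|].
    have [|n [fn fn2]] := f_glue (n1 := 0) (n2 := n2); first by rewrite linear0.
    by exists (submod_in (K := kernel f1) fn).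
  rewrite raddfB /= -e -tE; apply/eqP; rewrite subr_eq0; apply/eqP.
  have gf_linear : linear (fun n => g1 (f1 n)) by move=> a x y; rewrite !linearP.
  rewrite (tmap_comp (h := linear_pack gf_linear)) //.
  by rewrite (tmap_comp (h := linear_pack gf_linear)) // => n; rewrite -fg.
exists (t + tmap i u); rewrite !raddfD /= tE; split; last first.
  by rewrite (tmap_comp (f := i) (h := i2)) // uE addrC subrK.
have fi_linear : linear (fun x => f1 (i x)) by move=> a x y; rewrite !linearP.
rewrite (tmap_comp (f := i) (h := linear_pack fi_linear)) //.
by rewrite tmap_null ?addr0 // => x; exact: (smvalP x).
Qed.
End Pullback.
End TensorFunctor.

(** * Base change and mapping cones *)

Section BaseChange.
Variables (A B : comPzRingType) (f : {rmorphism A -> B}).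
Local Notation FB := (restr_scalars f B^o).

Section Def.
Variables (N : lmodType A) (N' : lmodType B) (phi : {linear N -> N' | (f \; *:%R)}).

Lemma balanced_scale : balanced (fun (n : N) (b : FB) => (b : B) *: phi n).
Proof.
split=> [n n' b|n b b'|a n b]; first by rewrite linearD scalerDr.
  exact: scalerDl.
by rewrite linearZ /= scalerA mulrC.
Qed.

Definition extend_scalars : tensor N FB -> N' := tensor_lift balanced_scale.
HB.instance Definition _ :=
  GRing.isZmodMorphism.Build (tensor N FB) N' extend_scalars (tensor_lift_zmod _).

Lemma extend_scalarsE n (b : B) : extend_scalars (tens n (b : FB)) = b *: phi n.
Proof. exact: (tensor_liftE balanced_scale). Qed.

Definition base_change : Prop :=
  (forall n', exists t, extend_scalars t = n') /\
  (forall t, extend_scalars t = 0 -> t = 0).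
End Def.

Lemma extend_scalars_tmap (M N : lmodType A) (M' N' : lmodType B)
    (phi : {linear M -> M' | (f \; *:%R)}) (psi : {linear N -> N' | (f \; *:%R)})
    (u : {linear M -> N}) (v : {linear M' -> N'}) :
  (forall m, psi (u m) = v (phi m)) ->
  forall t, extend_scalars psi (tmap u t) = v (extend_scalars phi t).
Proof.
move=> e; elim/tensor_ind => [|x y IHx IHy|m b]; first by rewrite !raddf0.
  by rewrite !raddfD /= IHx IHy.
by rewrite tmapE !extend_scalarsE e linearZ.
Qed.
End BaseChange.

(** Exactness of the mapping cone of phi : K -> L, spelled out on pairs
    (k, l) ∈ K^(n+1) × L^n.  It says that phi is a quasi-isomorphism. *)
Definition cone_acyclic (K L : nat -> zmodType) (dK : forall n, K n -> K n.+1)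
    (dL : forall n, L n -> L n.+1) (phi : forall n, K n -> L n) : Prop :=
  [/\ forall k : K 0, dK 0 k = 0 -> phi 0 k = 0 -> k = 0,
      forall (k : K 1) (l : L 0), dK 1 k = 0 -> phi 1 k = dL 0 l ->
        exists k', dK 0 k' = k /\ phi 0 k' = l
    & forall n (k : K n.+2) (l : L n.+1), dK n.+2 k = 0 -> phi n.+2 k = dL n.+1 l ->
        exists k' l', dK n.+1 k' = k /\ phi n.+1 k' + dL n l' = l].

(** The Mayer-Vietoris argument: K and L are pullbacks over K3 and L3, along
    degreewise surjective maps b2 and v2. *)
Section ConePullback.
Variables (K K1 K2 K3 L L1 L2 L3 : nat -> zmodType).
Variables (d : forall n, {additive K n -> K n.+1}).
Variables (d1 : forall n, {additive K1 n -> K1 n.+1}).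
Variables (d2 : forall n, {additive K2 n -> K2 n.+1}).
Variables (d3 : forall n, {additive K3 n -> K3 n.+1}).
Variables (e : forall n, {additive L n -> L n.+1}).
Variables (e1 : forall n, {additive L1 n -> L1 n.+1}).
Variables (e2 : forall n, {additive L2 n -> L2 n.+1}).
Variables (e3 : forall n, {additive L3 n -> L3 n.+1}).
Variables (phi : forall n, {additive K n -> L n}).
Variables (phi1 : forall n, {additive K1 n -> L1 n}).
Variables (phi2 : forall n, {additive K2 n -> L2 n}).
Variables (phi3 : forall n, {additive K3 n -> L3 n}).
Variables (a1 : forall n, {additive K n -> K1 n}).
Variables (a2 : forall n, {additive K n -> K2 n}).
Variables (b1 : forall n, {additive K1 n -> K3 n}).
Variables (b2 : forall n, {additive K2 n -> K3 n}).
Variables (u1 : forall n, {additive L n -> L1 n}).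
Variables (u2 : forall n, {additive L n -> L2 n}).
Variables (v1 : forall n, {additive L1 n -> L3 n}).
Variables (v2 : forall n, {additive L2 n -> L3 n}).
Hypotheses (dd2 : forall n x, d2 n.+1 (d2 n x) = 0).
Hypotheses (ee2 : forall n x, e2 n.+1 (e2 n x) = 0).
Hypotheses (phid2 : forall n x, phi2 n.+1 (d2 n x) = e2 n (phi2 n x)).
Hypotheses (a1d : forall n x, a1 n.+1 (d n x) = d1 n (a1 n x)).
Hypotheses (a2d : forall n x, a2 n.+1 (d n x) = d2 n (a2 n x)).
Hypotheses (b1d : forall n x, b1 n.+1 (d1 n x) = d3 n (b1 n x)).
Hypotheses (b2d : forall n x, b2 n.+1 (d2 n x) = d3 n (b2 n x)).
Hypotheses (u1d : forall n x, u1 n.+1 (e n x) = e1 n (u1 n x)).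
Hypotheses (u2d : forall n x, u2 n.+1 (e n x) = e2 n (u2 n x)).
Hypotheses (v1d : forall n x, v1 n.+1 (e1 n x) = e3 n (v1 n x)).
Hypotheses (v2d : forall n x, v2 n.+1 (e2 n x) = e3 n (v2 n x)).
Hypotheses (a1p : forall n x, u1 n (phi n x) = phi1 n (a1 n x)).
Hypotheses (a2p : forall n x, u2 n (phi n x) = phi2 n (a2 n x)).
Hypotheses (b1p : forall n x, v1 n (phi1 n x) = phi3 n (b1 n x)).
Hypotheses (b2p : forall n x, v2 n (phi2 n x) = phi3 n (b2 n x)).
Hypotheses (ba : forall n x, b1 n (a1 n x) = b2 n (a2 n x)).
Hypotheses (vu : forall n x, v1 n (u1 n x) = v2 n (u2 n x)).
Hypotheses (a_inj : forall n x, a1 n x = 0 -> a2 n x = 0 -> x = 0).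
Hypotheses (u_inj : forall n x, u1 n x = 0 -> u2 n x = 0 -> x = 0).
Hypotheses (a_glue : forall n x y, b1 n x = b2 n y -> exists z, a1 n z = x /\ a2 n z = y).
Hypotheses (u_glue : forall n x y, v1 n x = v2 n y -> exists z, u1 n z = x /\ u2 n z = y).
Hypotheses (b2_surj : forall n x, exists y, b2 n y = x).
Hypotheses (v2_surj : forall n x, exists y, v2 n y = x).

Let a_ext n x y : a1 n x = a1 n y -> a2 n x = a2 n y -> x = y.
Proof.
move=> e1' e2'; apply/eqP; rewrite -subr_eq0; apply/eqP.
by apply: a_inj; rewrite raddfB /= ?e1' ?e2' subrr.
Qed.

Let u_ext n x y : u1 n x = u1 n y -> u2 n x = u2 n y -> x = y.
Proof.
move=> e1' e2'; apply/eqP; rewrite -subr_eq0; apply/eqP.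
by apply: u_inj; rewrite raddfB /= ?e1' ?e2' subrr.
Qed.

(** The cones form a short exact sequence 0 -> C -> C1 ⊕ C2 -> C3 -> 0. Solutions found in C1 and C2
    differ over C3 by a cocycle, hence by a boundary, and this boundary lifts to C2 by surjectivity.
    In the two lowest degrees the difference is already zero. *)
Lemma cone_acyclic_pullback :
  cone_acyclic d1 e1 phi1 -> cone_acyclic d2 e2 phi2 -> cone_acyclic d3 e3 phi3 ->
  cone_acyclic d e phi.
Proof.
move=> [A0 A1 A2] [B0 B1 B2] [C0 C1 C2]; split.
- move=> k dk pk; apply: a_inj; [apply: A0|apply: B0].
  + by rewrite -a1d dk raddf0.
  + by rewrite -a1p pk raddf0.
  + by rewrite -a2d dk raddf0.
  + by rewrite -a2p pk raddf0.
- move=> k l dk pk.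
  have [||k1 [dk1 pk1]] := A1 (a1 1 k) (u1 0 l).
  + by rewrite -a1d dk raddf0.
  + by rewrite -a1p pk u1d.
  have [||k2 [dk2 pk2]] := B1 (a2 1 k) (u2 0 l).
  + by rewrite -a2d dk raddf0.
  + by rewrite -a2p pk u2d.
  have [|k' [ak1 ak2]] := @a_glue 0 k1 k2.
    apply/eqP; rewrite -subr_eq0; apply/eqP; apply: C0.
      by rewrite raddfB /= -b1d -b2d dk1 dk2 ba subrr.
    by rewrite raddfB /= -b1p -b2p pk1 pk2 vu subrr.
  exists k'; split.
    by apply: a_ext; rewrite ?a1d ?a2d ?ak1 ?ak2.
  by apply: u_ext; rewrite ?a1p ?a2p ?ak1 ?ak2.
- move=> n k l dk pk.
  have [||k1 [l1 [dk1 pk1]]] := A2 n (a1 n.+2 k) (u1 n.+1 l).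
  + by rewrite -a1d dk raddf0.
  + by rewrite -a1p pk u1d.
  have [||k2 [l2 [dk2 pk2]]] := B2 n (a2 n.+2 k) (u2 n.+1 l).
  + by rewrite -a2d dk raddf0.
  + by rewrite -a2p pk u2d.
  (* The second solution is changed by a boundary of the second cone until it agrees with the first
     one over K3 and L3. *)
  have [k2' [l2' [dk2' [pk2' [ek el]]]]] : exists k2' l2', d2 n.+1 k2' = a2 n.+2 k /\
      (phi2 n.+1 k2' + e2 n l2' = u2 n.+1 l /\
      (b1 n.+1 k1 = b2 n.+1 k2' /\ v1 n l1 = v2 n l2')).
    have dk12 : d3 n.+1 (b1 n.+1 k1 - b2 n.+1 k2) = 0.
      by rewrite raddfB /= -b1d -b2d dk1 dk2 ba subrr.
    have pk12 : phi3 n.+1 (b1 n.+1 k1 - b2 n.+1 k2) = e3 n (v2 n l2 - v1 n l1).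
      rewrite !raddfB /= -b1p -b2p -v1d -v2d.
      apply/eqP; rewrite subr_eq addrAC -raddfD /= [e2 _ _ + _]addrC pk2 -vu -pk1.
      by rewrite raddfD /= addrK.
    (* The term in L is taken in L2 and killed by [e2], so that subtracting it does no harm. For n =
       0 it is 0; otherwise it is [e2] of a lift of the term given by the cone over K3. *)
    have [k3 [l3 [dk3 pk3]]] : exists k3 l3, d3 n k3 = b1 n.+1 k1 - b2 n.+1 k2 /\
        phi3 n k3 + v2 n l3 = v2 n l2 - v1 n l1 /\ e2 n l3 = 0.
      case: (n) k1 k2 l1 l2 {dk1 dk2 pk1 pk2} dk12 pk12 => [|m] k1 k2 l1 l2 dk12 pk12.
        have [k3 [dk3 pk3]] := C1 _ _ dk12 pk12.
        by exists k3, 0; rewrite !raddf0 addr0.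
      have [k3 [l3 [dk3 pk3]]] := C2 _ _ _ dk12 pk12.
      have [l3' l3E] := v2_surj l3.
      by exists k3, (e2 m l3'); rewrite ee2 v2d l3E.
    have [k3' k3E] := b2_surj k3.
    exists (k2 + d2 n k3'), (l2 - phi2 n k3' - l3).
    have [pk3' el3] := pk3; split; first by rewrite raddfD /= dd2 addr0.
    split; [|split].
    + by rewrite raddfD !raddfB /= phid2 el3 subr0 addrACA subrr addr0.
    + by rewrite raddfD /= b2d k3E dk3 addrC subrK.
    + by rewrite !raddfB /= b2p k3E -addrA -opprD pk3' subKr.
  have [k' [ak1 ak2]] := a_glue ek.
  have [l' [ul1 ul2]] := u_glue el.
  exists k', l'; split.
    by apply: a_ext; rewrite ?a1d ?a2d ?ak1 ?ak2.
  by apply: u_ext; rewrite raddfD /= ?a1p ?a2p ?u1d ?u2d ?ak1 ?ak2 ?ul1 ?ul2.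
Qed.
End ConePullback.

Section ConeResolution.
Variables (K L : nat -> zmodType) (KA LA : zmodType).
Variables (d : forall n, {additive K n -> K n.+1}).
Variables (e : forall n, {additive L n -> L n.+1}).
Variables (phi : forall n, {additive K n -> L n}).
Variables (i : {additive KA -> K 0}) (j : {additive LA -> L 0}) (psi : {additive KA -> LA}).
Hypotheses (phid : forall n x, phi n.+1 (d n x) = e n (phi n x)).
Hypotheses (di : forall x, d 0 (i x) = 0) (phii : forall x, phi 0 (i x) = j (psi x)).
Hypotheses (i_exact : forall k, d 0 k = 0 -> exists x, i x = k).
Hypotheses (d_exact : forall n k, d n.+1 k = 0 -> exists k', d n k' = k).
Hypotheses (j_inj : forall x, j x = 0 -> x = 0).
Hypotheses (j_exact : forall l, e 0 l = 0 -> exists x, j x = l).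
Hypotheses (e_exact : forall n l, e n.+1 l = 0 -> exists l', e n l' = l).
Hypotheses (psi_inj : forall x, psi x = 0 -> x = 0).
Hypotheses (psi_surj : forall y, exists x, psi x = y).

(** Both complexes are exact in positive degrees, and their kernels in degree 0 are the images of
    [i] and [j]; a bijection [psi] between the augmentations thus forces a quasi-isomorphism. *)
Lemma cone_acyclic_resolution : cone_acyclic d e phi.
Proof.
split=> [k dk pk|k l dk pk|n k l dk pk].
- have [x xE] := i_exact dk; rewrite -xE in pk *.
  by rewrite (psi_inj (x := x)) ?raddf0 //; apply: j_inj; rewrite -phii.
- have [k' k'E] := d_exact dk.
  have [y yE] : exists y, j y = l - phi 0 k'.
    by apply: j_exact; rewrite raddfB /= -phid k'E pk subrr.
  have [x xE] := psi_surj y; exists (k' + i x).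
  by rewrite !raddfD /= di addr0 phii xE yE addrC subrK.
- have [k' k'E] := d_exact dk.
  have [l' l'E] : exists l', e n l' = l - phi n.+1 k'.
    by apply: e_exact; rewrite raddfB /= -phid k'E pk subrr.
  by exists k', l'; rewrite l'E addrC subrK.
Qed.
End ConeResolution.

(** * Cohomology under flat base change *)

Section CohomologyBaseChange.
Variables (k : comPzRingType) (X : ringed_finite_space k) (E : omod_complex X).

Definition cohomology_pi n p (m : cocycle E n p) : cohomology E n p :=
  lquot_pi (@coboundary_scale k X E n p) m.

Lemma cohomology_pi_linear n p : linear (@cohomology_pi n p).
Proof.
move=> a x y; rewrite -[RHS]/(lquot_scale a (cohomology_pi x) + cohomology_pi y).
by rewrite /cohomology_pi lquot_scale_pi -raddfD.
Qed.
HB.instance Definition _ n p := GRing.isLinear.Build (stalk p) (cocycle E n p)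
  (cohomology E n p) *:%R (@cohomology_pi n p) (@cohomology_pi_linear n p).

Lemma cohomology_pi_surj n p (c : cohomology E n p) : exists m, c = cohomology_pi m.
Proof. exact: lquot_surj. Qed.

Lemma cohomology_pi_eq0 n p (m : cocycle E n p) :
  cohomology_pi m = 0 <-> is_coboundary (cval m).
Proof.
rewrite -(linear0 (@cohomology_pi n p)); split=> [/lquot_piP|bm].
  by rewrite subr0 => /asboolP.
by apply/lquot_piP; rewrite subr0; apply/asboolP.
Qed.

Lemma cohomology_res_piE n p q (h : leU p q) (m : cocycle E n p) :
  mres (cohomology E n) h (cohomology_pi m) = cohomology_pi (cocycle_res h m).
Proof. exact: cohomology_res_pi. Qed.

Lemma cvalP n p (m : cocycle E n p) : cdiff E n p (cval m) = 0.
Proof. by case: m => m mz; have := mz; rewrite -topredE => /eqP. Qed.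

Lemma cocycleP n p (m : E n p) : cdiff E n p m = 0 -> exists z : cocycle E n p, cval z = m.
Proof.
move=> dm; have mz : m \in @cocycle_pred k X E n p by rewrite -topredE /= /cocycle_pred dm.
by exists (Cocycle mz).
Qed.

Lemma cval_linear n p : linear (@cval k X E n p).
Proof. by move=> a x y; rewrite -[@cval _ _ _ _ _]/(val : cocycle E n p -> _) linearP. Qed.
HB.instance Definition _ n p := GRing.isLinear.Build (stalk p) (cocycle E n p)
  (E n p) *:%R (@cval k X E n p) (@cval_linear n p).

Section Restriction.
Variables (p q : X) (h : leU p q).
Local Notation F := (restr_scalars (res h) (stalk q)^o).
Local Notation ext M := (extend_scalars (mres M h)).

Definition base_change_qiso : Prop :=
  cone_acyclic (fun n => tmap (cdiff E n p) : tensor _ F -> tensor _ F)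
    (fun n => cdiff E n q) (fun n => ext (E n)).

Hypothesis flat_h : flat_morphism (res h).

(** Elements of H ⊗ O_q are treated as images of elements of Z ⊗ O_q, with Z the cocycles; the
    resulting class is then represented by a cochain computed in the complex. *)
Lemma extend_scalars_cohomology n (z : tensor (cocycle E n p) F) :
  exists w : cocycle E n q, ext (cohomology E n) (tmap (@cohomology_pi n p) z) = cohomology_pi w
    /\ cval w = ext (E n) (tmap (@cval k X E n p) z).
Proof.
elim/tensor_ind: z => [|x y [w [xw wx]] [v [yv vy]]|m b].
- by exists 0; rewrite !raddf0.
- by exists (w + v); rewrite !raddfD /= xw yv wx vy.
- exists (b *: cocycle_res h m); rewrite !tmapE !extend_scalarsE cohomology_res_piE.
  by split; rewrite linearZ.
Qed.

(** By flatness Z^n ⊗ O_q is the kernel of the differential of E_p ⊗ O_q, so cohomology commutes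
    with the tensor product and the quasi-isomorphism induces the base change map. *)
Lemma base_change_cohomology : base_change_qiso ->
  forall n, base_change (mres (cohomology E n) h).
Proof.
move=> [A0 A1 A2] n.
have flatF : flat_module F by [].
have cocycle_lift (t : tensor (E n p) F) : tmap (cdiff E n p) t = 0 ->
    exists z, tmap (@cval k X E n p) z = t.
  apply: (tmap_exact flatF) => m dm; exact: cocycleP.
split=> [c|t].
- have [l ->] := cohomology_pi_surj c.
  (* Acyclicity of the cone at the pair (0, l) provides a cocycle [t] whose extension is
     cohomologous to [l]; in degree 0 it is equal to [l]. *)
  have [t [dt bt]] : exists t : tensor (E n p) F, tmap (cdiff E n p) t = 0 /\
      is_coboundary (cval l - ext (E n) t).
    have := cvalP l; move: (cval l) => {c cocycle_lift}{}l dl.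
    case: n l dl => [|n] l dl.
      have [||t [dt pt]] := A1 0 l; rewrite ?raddf0 //.
      by exists t; rewrite dt pt; split=> //=; rewrite subrr.
    have [||t [l' [dt <-]]] := A2 n 0 l; rewrite ?raddf0 //.
    by exists t; split=> //; exists l'; rewrite addrC addKr.
  have [z zt] := cocycle_lift t dt; exists (tmap (@cohomology_pi n p) z).
  have [w [-> wE]] := extend_scalars_cohomology z; apply/eqP.
  rewrite eq_sym -subr_eq0 -linearB; apply/eqP/cohomology_pi_eq0.
  by rewrite linearB /= wE zt.
- have [z <-] : exists z, tmap (@cohomology_pi n p) z = t.
    by apply: tmap_surj => c; have [m ->] := cohomology_pi_surj c; exists m.
  have [w [-> wE]] := extend_scalars_cohomology z; move=> /cohomology_pi_eq0.
  have dz : tmap (cdiff E n p) (tmap (@cval k X E n p) z) = 0.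
    have d_linear : linear (fun m : cocycle E n p => cdiff E n p (cval m)).
      by move=> a x y; rewrite !linearP.
    rewrite (tmap_comp (h := linear_pack d_linear)) // tmap_null // => m.
    exact: cvalP.
  have val_inj' : injective (tmap (@cval k X E n p) : tensor _ F -> _).
    by apply: (tmap_inj flatF); exact: val_inj.
  rewrite wE => bz.
  (* [z] has the same image in E^n ⊗ O_q as an element [x] built from coboundaries, which is zero in
     cohomology. Injectivity of Z ⊗ O_q -> E ⊗ O_q then identifies the two. *)
  have [x dx xz] : exists2 x : tensor (cocycle E n p) F, tmap (@cohomology_pi n p) x = 0 &
      tmap (@cval k X E n p) x = tmap (@cval k X E n p) z.
    case: (n) z dz bz {wE val_inj' cocycle_lift t w} => [|m] z dz bz.
      by exists 0; rewrite !raddf0 // (A0 _ dz).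
    have [k' k'E] : exists k', tmap (cdiff E m p) k' = tmap (@cval k X E m.+1 p) z.
      case: bz => l' l'E; case: m z dz l' l'E => [|m] z dz l' /esym l'E.
        by have [k' [k'E _]] := A1 _ _ dz l'E; exists k'.
      by have [k' [_ [k'E _]]] := A2 _ _ _ dz l'E; exists k'.
    have cob_cocycle (e : E m p) : cdiff E m p e \in @cocycle_pred k X E m.+1 p.
      by rewrite -topredE /= /cocycle_pred cdiffK.
    have cob_linear : linear (fun e => Cocycle (cob_cocycle e)).
      by move=> a u v; apply: val_inj; rewrite /= !linearP.
    exists (tmap (linear_pack cob_linear) k').
      have pi_linear : linear (fun e => cohomology_pi (Cocycle (cob_cocycle e))).
        by move=> a u v; rewrite -linearP -cob_linear.
      rewrite (tmap_comp (h := linear_pack pi_linear)) // tmap_null // => e.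
      by apply/cohomology_pi_eq0; exists e.
    by rewrite (tmap_comp (h := cdiff E m p)).
  by rewrite -(val_inj' _ _ xz) dx.
Qed.
End Restriction.
End CohomologyBaseChange.

(** * Changing the base rings *)

Section ChangeOfBase.
Variables (A B A' B' : comPzRingType) (f : {rmorphism A -> B}) (f' : {rmorphism A' -> B'}).
Variables (i : {rmorphism A -> A'}) (j : {rmorphism B -> B'}).
Hypothesis fi : forall a, f' (i a) = j (f a).
Local Notation FB := (restr_scalars f B^o).
Local Notation FB' := (restr_scalars f' B'^o).
Variables (N : lmodType A) (N' : lmodType B) (phi : {linear N -> N' | (f \; *:%R)}).
Variables (M : lmodType A') (M' : lmodType B') (psi : {linear M -> M' | (f' \; *:%R)}).
Variables (al : {linear N -> M | (i \; *:%R)}) (be : {linear N' -> M' | (j \; *:%R)}).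
Hypothesis ab : forall n, psi (al n) = be (phi n).

Lemma balanced_change_base : balanced (fun (n : N) (b : FB) => tens (al n) (j b : FB')).
Proof.
split=> [n n' b|n b b'|a n b].
- by rewrite linearD tensDl.
- by rewrite -tensDr -[(j b : FB') + _]/(j b + j b' : B') -rmorphD.
- by rewrite linearZ /= tensZ -[i a *: _]/(f' (i a) * j b) fi -rmorphM.
Qed.

Definition change_base : tensor N FB -> tensor M FB' := tensor_lift balanced_change_base.
HB.instance Definition _ := GRing.isZmodMorphism.Build (tensor N FB) (tensor M FB')
  change_base (tensor_lift_zmod _).

Lemma change_baseE n b : change_base (tens n (b : FB)) = tens (al n) (j b : FB').
Proof. exact: (tensor_liftE balanced_change_base). Qed.

Lemma extend_change_base t : extend_scalars psi (change_base t) = be (extend_scalars phi t).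
Proof.
elim/tensor_ind: t => [|x y IHx IHy|n b]; first by rewrite !raddf0.
  by rewrite !raddfD /= IHx IHy.
by rewrite change_baseE !extend_scalarsE ab linearZ.
Qed.

Hypothesis al_surj : forall m, exists n, al n = m.
Hypothesis be_inj : forall n', be n' = 0 -> n' = 0.
Hypothesis B'_gen : forall b', exists s : seq (B * A'), b' = \sum_(u <- s) j u.1 * f' u.2.

(** [B'_gen] says that B ⊗ A' -> B' is surjective, and m ⊗ j(b) f'(a') equals a' m ⊗ j(b), whose
    first entry lies in the image of [al]. *)
Lemma change_base_surj t' : exists t, change_base t = t'.
Proof.
elim/tensor_ind: t' => [|x y [x' <-] [y' <-]|m b'].
- by exists 0; rewrite raddf0.
- by exists (x' + y'); rewrite raddfD.
have [s ->] := B'_gen b'; elim: s => [|[b a'] s [t tE]].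
  exists 0; rewrite raddf0 big_nil.
  by rewrite -[0 in RHS](scale0r (1 : FB')) -tensZ scale0r tens0l.
have [n nE] := al_surj (a' *: m); exists (tens n (b : FB) + t).
rewrite raddfD /= change_baseE nE tE big_cons tensZ /= -tensDr.
by congr (tens _ (_ + _)); exact: mulrC.
Qed.

(** In the square formed by [change_base], [be] and the two extension maps, the composite [be] after
    the extension of [phi] is bijective. As [change_base] is surjective, the extension of [psi] is
    bijective too. *)
Lemma base_change_extend : (forall m', exists n', be n' = m') ->
  base_change phi -> base_change psi.
Proof.
move=> be_surj [phi_surj phi_inj]; split=> [m'|t'].
  have [n' <-] := be_surj m'; have [t <-] := phi_surj n'.
  by exists (change_base t); exact: extend_change_base.
have [t <-] := change_base_surj t'; rewrite extend_change_base => /be_inj/phi_inj->.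
by rewrite raddf0.
Qed.

Lemma base_change_descend : (forall t, change_base t = 0 -> t = 0) ->
  base_change psi -> base_change phi.
Proof.
move=> theta_inj [psi_surj psi_inj]; split=> [n'|t phit]; last first.
  by apply: theta_inj; apply: psi_inj; rewrite extend_change_base phit raddf0.
have [t' t'E] := psi_surj (be n'); have [t tE] := change_base_surj t'.
exists t; apply/eqP; rewrite -subr_eq0; apply/eqP/be_inj.
by rewrite raddfB /= -t'E -tE extend_change_base subrr.
Qed.
End ChangeOfBase.

Section TensorBase.
Variables (k A B C : comPzRingType) (f : {rmorphism A -> B}).
Variables (sA : {rmorphism k -> A}) (sB : {rmorphism k -> B}) (sC : {rmorphism k -> C}).
Hypothesis fs : forall c, f (sA c) = sB c.
Variable f' : {rmorphism atensor sA sC -> atensor sB sC}.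
Hypothesis f'E : forall a c, f' (atens sA sC a c) = atens sB sC (f a) c.
Variables (N : lmodType A) (N' : lmodType B) (phi : {linear N -> N' | (f \; *:%R)}).
Variables (M : lmodType (atensor sA sC)) (M' : lmodType (atensor sB sC)).
Variables (psi : {linear M -> M' | (f' \; *:%R)}).
Variables (al : {linear N -> M | (@atensor_inl _ _ _ sA sC \; *:%R)}).
Variables (be : {linear N' -> M' | (@atensor_inl _ _ _ sB sC \; *:%R)}).
Hypothesis ab : forall n, psi (al n) = be (phi n).
Hypotheses (al_inj : forall n, al n = 0 -> n = 0) (al_surj : forall m, exists n, al n = m).
Hypothesis be_inj : forall n', be n' = 0 -> n' = 0.
Local Notation FB := (restr_scalars f B^o).
Local Notation FB' := (restr_scalars f' (atensor sB sC)^o).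
Local Notation inC := (@atensor_inr _ _ _ sA sC).

Let fi a : f' (atensor_inl sA sC a) = atensor_inl sB sC (f a).
Proof. exact: f'E. Qed.

Lemma atensor_gen (b' : atensor sB sC) :
  exists s : seq (B * atensor sA sC), b' = \sum_(u <- s) atensor_inl sB sC u.1 * f' u.2.
Proof.
elim/atens_ind: b' => [|b c x [s ->]]; first by exists [::]; rewrite big_nil.
exists ((b, atens sA sC 1 c) :: s); rewrite big_cons /= f'E rmorph1.
by rewrite /atensor_inl atensM mulr1 mul1r.
Qed.

(** M ⊗ (B ⊗ C) -> N ⊗ B sends m ⊗ (b ⊗ c) to al^-1(c m) ⊗ b, which inverts
    [change_base]. *)
Let ali (m : M) : N := projT1 (cid (al_surj m)).

Let aliK m : al (ali m) = m.
Proof. exact: projT2 (cid (al_surj m)). Qed.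

Let al_eq n n' : al n = al n' -> n = n'.
Proof.
move=> e; apply/eqP; rewrite -subr_eq0; apply/eqP/al_inj.
by rewrite linearB /= e subrr.
Qed.

Let aliD m m' : ali (m + m') = ali m + ali m'.
Proof. by apply: al_eq; rewrite linearD /= !aliK. Qed.

Let aliZ a m : ali (atensor_inl sA sC a *: m) = a *: ali m.
Proof. by apply: al_eq; rewrite linearZ /= !aliK. Qed.

Let balanced_retract m : balanced
  (fun (b : restr_scalars sB B^o) (c : restr_scalars sC C^o) => tens (ali (inC c *: m)) (b : FB)).
Proof.
split=> [b b' c|b c c'|x b c].
- exact: tensDr.
- by rewrite -tensDl -aliD -scalerDl -rmorphD.
- have inCZ : inC (sC x * c) = atensor_inl sA sC (sA x) * inC c.
    by rewrite atensor_in_eq -rmorphM.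
  rewrite -[x *: b]/(sB x * b) -[x *: c]/(sC x * c) inCZ.
  by rewrite -scalerA aliZ tensZ -fs.
Qed.

Let retract (m : M) (b' : FB') : tensor N FB := tensor_lift (balanced_retract m) b'.

Let retractE m b c : retract m (atens sB sC b c) = tens (ali (inC c *: m)) (b : FB).
Proof. exact: (tensor_liftE (balanced_retract m)). Qed.

Let retractDr m b b' : retract m (b + b') = retract m b + retract m b'.
Proof. exact: (raddfD (tensor_lift (balanced_retract m))). Qed.

Let retract0r m : retract m 0 = 0.
Proof. exact: (raddf0 (tensor_lift (balanced_retract m))). Qed.

Let retractDl m m' b : retract (m + m') b = retract m b + retract m' b.
Proof.
elim/atens_ind: b => [|b c x IH]; first by rewrite !retract0r addr0.
by rewrite !retractDr IH !retractE scalerDr aliD tensDl addrACA.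
Qed.

Let balanced_retract' : balanced retract.
Proof.
split=> [m m' b|m b b'|a' m b']; [exact: retractDl|exact: retractDr|].
rewrite -[a' *: b']/(f' a' * (b' : atensor sB sC)).
elim/atens_ind: b' => [|b c x IH]; first by rewrite mulr0 !retract0r.
rewrite mulrDr !retractDr IH; congr (_ + _) => {x IH}.
elim/atens_ind: a' => [|a c' x IH].
  rewrite scale0r rmorph0 mul0r retract0r retractE scaler0.
  suff -> : ali 0 = 0 by rewrite tens0l.
  by apply: al_eq; rewrite aliK linear0.
rewrite scalerDl retractDl IH rmorphD mulrDl retractDr; congr (_ + _) => {x IH}.
rewrite f'E atensM !retractE scalerA mulrC.
have -> : atens sA sC a c' * inC c = atensor_inl sA sC a * inC (c' * c).
  by rewrite /atensor_inl /atensor_inr !atensM mulr1 mul1r.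
by rewrite -scalerA aliZ tensZ.
Qed.

(** For A' = A ⊗ C and B' = B ⊗ C the surjection [change_base] has the retraction built above, so it
    is an isomorphism. This descends base change from a stalk of the product space to a stalk of one
    factor. *)
Lemma base_change_tensor : base_change psi -> base_change phi.
Proof.
apply: (base_change_descend (fi := fi) ab al_surj be_inj atensor_gen).
have retractK t : tensor_lift balanced_retract' (change_base fi al t) = t.
  elim/tensor_ind: t => [|x y IHx IHy|n b]; first by rewrite !raddf0.
    by rewrite !raddfD /= IHx IHy.
  rewrite change_baseE tensor_liftE retractE rmorph1 scale1r.
  by congr tens; apply: al_eq; rewrite aliK.
by move=> t t0; rewrite -(retractK t) t0 raddf0.
Qed.
End TensorBase.

(** * Transitivity of base change *)

Section BaseChangeComp.
Variables (A B C : comPzRingType) (f : {rmorphism A -> B}) (g : {rmorphism B -> C}).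
Variables (h : {rmorphism A -> C}) (hE : forall a, h a = g (f a)).
Variables (N : lmodType A) (N' : lmodType B) (N'' : lmodType C).
Variables (phi : {linear N -> N' | (f \; *:%R)}) (psi : {linear N' -> N'' | (g \; *:%R)}).
Variables (chi : {linear N -> N'' | (h \; *:%R)}) (chiE : forall n, chi n = psi (phi n)).
Local Notation Ff := (restr_scalars f B^o).
Local Notation Fg := (restr_scalars g C^o).
Local Notation Fh := (restr_scalars h C^o).

Let lam_balanced (c : C) : balanced (fun (n : N) (b : Ff) => tens n (g b * c : Fh)).
Proof.
split=> [n n' b|n b b'|a n b]; first by rewrite tensDl.
  rewrite -tensDr; congr tens; rewrite -[RHS]/(g b * c + g b' * c) -mulrDl -rmorphD.
  by [].
rewrite tensZ; congr tens; rewrite -[LHS]/(h a * (g b * c)) hE.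
by rewrite -[a *: b]/(f a * b) rmorphM mulrA.
Qed.

(** Sends n ⊗ b to n ⊗ g(b) c. Together with the inverse of the extension of [phi] it inverts the
    map N ⊗_A C -> N' ⊗_B C. *)
Let lam c : tensor N Ff -> tensor N Fh := tensor_lift (lam_balanced c).

Let lamD c c' t : lam (c + c') t = lam c t + lam c' t.
Proof.
rewrite /lam; elim/tensor_ind: t => [|x y IHx IHy|n b]; first by rewrite !raddf0 addr0.
  by rewrite !raddfD /= IHx IHy addrACA.
by rewrite !tensor_liftE mulrDr -[RHS]tensDr.
Qed.

Let lamDr c t t' : lam c (t + t') = lam c t + lam c t'.
Proof. exact: raddfD. Qed.

Hypothesis phi_bc : base_change phi.

Let inv (n' : N') := projT1 (cid (phi_bc.1 n')).

Let invK n' : extend_scalars phi (inv n') = n'.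
Proof. exact: projT2 (cid (phi_bc.1 n')). Qed.

Let inv_eq t n' : extend_scalars phi t = n' -> inv n' = t.
Proof.
move=> e; apply/eqP; rewrite -subr_eq0; apply/eqP/phi_bc.2.
by rewrite raddfB /= invK e subrr.
Qed.

Let invD n n' : inv (n + n') = inv n + inv n'.
Proof. by apply: inv_eq; rewrite raddfD /= !invK. Qed.

Let ret_balanced : balanced (fun (n' : N') (c : Fg) => lam c (inv n')).
Proof.
split=> [n n' c|n c c'|b n c].
- by rewrite invD lamDr.
- exact: lamD.
- have [t <-] := phi_bc.1 n; rewrite (inv_eq (erefl _)).
  elim/tensor_ind: t => [|x y IHx IHy|m b'].
  + by rewrite !raddf0 (inv_eq (raddf0 _)) /lam !raddf0.
  + by rewrite !raddfD /= invD !lamDr IHx IHy.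
  + rewrite extend_scalarsE scalerA (inv_eq (t := tens m (b * b' : Ff))).
      rewrite /lam !tensor_liftE -[b *: c]/(g b * c) rmorphM mulrAC [g b * c in RHS]mulrC.
      by congr tens; rewrite -mulrA mulrC mulrA [RHS]mulrC -mulrA mulrC.
    exact: extend_scalarsE.
Qed.

Let theta_balanced : balanced (fun (n : N) (c : Fh) => tens (phi n) (c : Fg)).
Proof.
split=> [n n' c|n c c'|a n c]; first by rewrite linearD tensDl.
  exact: tensDr.
by rewrite linearZ /= tensZ; congr tens; rewrite -[RHS]/(h a * c) hE.
Qed.

(** Since N' is N ⊗_A B, the map [theta] is the isomorphism of N ⊗_A C with (N ⊗_A B) ⊗_B C. It
    carries the extension of [psi] to that of [chi]. *)
Lemma base_change_comp : base_change psi -> base_change chi.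
Proof.
move=> [psi_surj psi_inj]; pose theta := tensor_lift theta_balanced.
have thetaE t : extend_scalars psi (theta t) = extend_scalars chi t.
  rewrite /theta; elim/tensor_ind: t => [|x y IHx IHy|n c]; first by rewrite !raddf0.
    by rewrite !raddfD /= IHx IHy.
  by rewrite tensor_liftE !extend_scalarsE chiE.
pose ret := tensor_lift ret_balanced.
have retE t : theta (ret t) = t.
  rewrite /theta /ret; elim/tensor_ind: t => [|x y IHx IHy|n' c]; first by rewrite !raddf0.
    by rewrite !raddfD /= IHx IHy.
  have [t <-] := phi_bc.1 n'; rewrite tensor_liftE (inv_eq (erefl _)) /lam.
  elim/tensor_ind: t => [|x y IHx IHy|n b]; first by rewrite !raddf0 tens0l.
    by rewrite !raddfD /= IHx IHy tensDl.
  by rewrite !tensor_liftE extend_scalarsE tensZ.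
have retK t : ret (theta t) = t.
  rewrite /theta /ret; elim/tensor_ind: t => [|x y IHx IHy|n c]; first by rewrite !raddf0.
    by rewrite !raddfD /= IHx IHy.
  rewrite !tensor_liftE (inv_eq (t := tens n (1 : Ff))) ?extend_scalarsE ?scale1r //.
  by rewrite /lam tensor_liftE rmorph1 mul1r.
split=> [n''|t chit].
  by have [t <-] := psi_surj n''; exists (ret t); rewrite -thetaE retE.
by rewrite -(retK t) (psi_inj (theta t)) ?thetaE // /ret raddf0.
Qed.
End BaseChangeComp.

(** * Quasi-coherence as base change between stalks *)

Definition free_lin_fun (I : Type) (R : pzRingType) (M : lmodType R) (g : I -> M)
  (x : free_mod I R) : M := free_eval (fun i (a : R) => a *: g i) x.

Section FreeLin.
Variables (I : Type) (R : pzRingType) (M : lmodType R) (g : I -> M).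

Let scale_zmod i : zmod_morphism (fun a : R => a *: g i).
Proof. by move=> a b; rewrite scalerBl. Qed.

Lemma free_lin_linear : linear (free_lin_fun g).
Proof.
pose F := additive_pack (free_eval_zmod scale_zmod).
move=> a x y; rewrite -![free_lin_fun g _]/(F _) raddfD; congr (_ + _).
elim/free_mod_ind: x => [|u v IHu IHv|i b].
- by rewrite scaler0 (raddf0 F) scaler0.
- by rewrite scalerDr !(raddfD F) IHu IHv scalerDr.
- by rewrite -free_gen_scale -![F _]/(free_eval _ _) !free_eval_gen // scalerA.
Qed.
HB.instance Definition _ := GRing.isLinear.Build R (free_mod I R) M *:%R
  (free_lin_fun g) free_lin_linear.

Lemma free_lin_gen i a : free_lin_fun g (free_gen i a) = a *: g i.
Proof. by rewrite /free_lin_fun free_eval_gen. Qed.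
End FreeLin.

Section Presentations.
Variables (A B : comPzRingType) (f : {rmorphism A -> B}).
Local Notation FB := (restr_scalars f B^o).

Lemma base_change_free (I : Type) : base_change (free_map f : free_mod I A -> free_mod I B).
Proof.
have tens_zmod i : zmod_morphism (fun b : B => tens (free_gen i 1 : free_mod I A) (b : FB)).
  move=> b b'; apply/eqP; rewrite eq_sym subr_eq -tensDr; apply/eqP; congr tens.
  by rewrite -[RHS]/(b - b' + b') subrK.
pose ret := additive_pack (free_eval_zmod tens_zmod).
split=> [y|t].
  elim/free_mod_ind: y => [|x y [x' <-] [y' <-]|i b]; first by exists 0; rewrite raddf0.
    by exists (x' + y'); rewrite raddfD.
  exists (tens (free_gen i 1) (b : FB)).
  by rewrite extend_scalarsE /= free_map_gen rmorph1 -free_gen_scale mulr1.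
have retK : ret (extend_scalars (free_map f) t) = t.
  elim/tensor_ind: t => [|x y IHx IHy|x b]; first by rewrite !raddf0.
    by rewrite (raddfD (extend_scalars _)) (raddfD ret) IHx IHy.
  rewrite extend_scalarsE /=.
  elim/free_mod_ind: x => [|x y IHx IHy|i a].
  - by rewrite (raddf0 (free_map f)) scaler0 tens0l; exact: (raddf0 ret).
  - by rewrite (raddfD (free_map f)) scalerDr tensDl -IHx -IHy; exact: (raddfD ret).
  rewrite free_map_gen -free_gen_scale free_eval_gen //.
  rewrite -[in RHS](mulr1 a) free_gen_scale tensZ; congr tens.
  by rewrite -[RHS]/(f a * b) mulrC.
by move=> t0; rewrite -retK t0 raddf0.
Qed.

Variables (I J : Type) (N : lmodType A) (N' : lmodType B).
Variables (phi : {linear N -> N' | (f \; *:%R)}).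
Variables (u : {linear free_mod I A -> free_mod J A}) (v : {linear free_mod J A -> N}).
Variables (u' : {linear free_mod I B -> free_mod J B}) (v' : {linear free_mod J B -> N'}).
Hypotheses (uu' : forall x, u' (free_map f x) = free_map f (u x)).
Hypotheses (vv' : forall x, phi (v x) = v' (free_map f x)).
Hypotheses (v_epi : forall n, exists x, v x = n) (v'_epi : forall n, exists x, v' x = n).
Hypotheses (vu : forall x, v (u x) = 0) (v'_exact : forall x, v' x = 0 -> exists y, u' y = x).

(** On free modules base change is bijective. A kernel element, lifted to the free module, is killed
    by [v'], hence lies in the image of [u']; pulled back through the free modules it lies in the
    image of u ⊗ B, which [v] kills. *)
Lemma base_change_presentation : base_change phi.
Proof.
have [fs fi] := base_change_free J.
have extv t : extend_scalars phi (tmap v t) = v' (extend_scalars (free_map f) t).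
  exact: extend_scalars_tmap.
split=> [n'|t].
  have [x <-] := v'_epi n'; have [t <-] := fs x.
  by exists (tmap v t).
have [z <-] := tmap_surj (F := FB) v_epi t.
rewrite extv => /v'_exact[y]; have [w <-] := (base_change_free I).1 y.
rewrite -(extend_scalars_tmap (phi := free_map f) (psi := free_map f) (u := u));
  last by move=> m; rewrite uu'.
move/eqP; rewrite -subr_eq0 -raddfB => /eqP/fi/eqP; rewrite subr_eq0 => /eqP <-.
have vu_linear : linear (fun x => v (u x)) by move=> a x x'; rewrite !linearP.
by rewrite (tmap_comp (h := linear_pack vu_linear)) // tmap_null.
Qed.
End Presentations.

(** * Minimal open sets and the specialization order *)

Section FiniteTopology.
Variables (k : comPzRingType) (X : ringed_finite_space k).

(** One open neighbourhood of [p] missing q is chosen for each of the finitely many q outside U_p;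
    their intersection is U_p. *)
Lemma open_min_open (p : X) : open (min_open p).
Proof.
have /finite_seqP[s es] := space_finite X.
have [O [oO Op Os]] : exists O : set X, [/\ open O, O p &
    forall q, q \in s -> O q -> leU p q].
  elim: s {es} => [|q s [O [oO Op Os]]].
    by exists setT; split=> //; exact: openT.
  have [l|] := pselect (leU p q).
    by exists O; split=> // r; rewrite inE => /orP[/eqP-> _|/Os]; first exact: l.
  move=> /existsNP[W /not_implyP[[oW Wp] nWq]].
  exists (O `&` W); split=> //; first exact: openI.
  by move=> r; rewrite inE => /orP[/eqP-> []|/Os Or [/Or]].
suff -> : min_open p = O by [].
apply/seteqP; split=> q; first by apply.
by apply: Os; have : [set: X] q by []; rewrite es.
Qed.
End FiniteTopology.

Lemma leU_sub (X : topologicalType) (V : set X) (p q : V) :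
  leU (set_val p) (set_val q) -> leU p q.
Proof.
move=> l W [[O oO <-] Op]; exact: (l O (conj oO Op)).
Qed.

Lemma leU_prod (X Y : topologicalType) (p q : X * Y) :
  leU p.1 q.1 -> leU p.2 q.2 -> leU p q.
Proof.
move=> l1 l2 W [oW Wp].
have [[P Q] /= [nP nQ] PQ] : nbhs p W by exact: open_nbhs_nbhs.
apply: PQ; split=> /=; apply: interior_subset.
  by apply: (l1 P^°); split=> //; exact: open_interior.
by apply: (l2 Q^°); split=> //; exact: open_interior.
Qed.

(** An open set containing [p] contains U_p and so [q]; a single local presentation thus presents
    both stalks. *)
Lemma quasi_coherent_base_change (k : comPzRingType) (X : ringed_finite_space k)
    (M : omod X) (p q : X) (h : leU p q) :
  quasi_coherent M -> base_change (mres M h).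
Proof.
move=> /(_ p)[V [oV Vp [I [J [u [v [v_epi uv]]]]]]].
have Vq : V q by exact: h.
pose p' : V := SigSub (mem_set Vp); pose q' : V := SigSub (mem_set Vq).
have h' : leU p' q' by exact: leU_sub.
have bc : base_change (mres (restr_omod V M) h').
  apply: (base_change_presentation (u := u p') (u' := u q') (v := v p') (v' := v q')).
  - by move=> x; exact: (ohom_res u h').
  - by move=> x; exact: esym (ohom_res v h' x).
  - exact: v_epi.
  - exact: v_epi.
  - by move=> x; apply/uv; exists x.
  - by move=> x /uv.
by rewrite (Prop_irrelevance h (leU_val h')).
Qed.

(** * A presentation on U_p from base change *)

Section QuasiCoherence.
Variables (k : comPzRingType) (X : ringed_finite_space k) (M : omod X).
Hypothesis bc : forall (p q : X) (h : leU p q), base_change (mres M h).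
Variable p : X.
Local Notation V := (min_open p).

Let hV (x : V) : leU p (set_val x).
Proof. exact: set_valP. Qed.

Local Notation O x := (stalk (set_val (x : V))).

(** The tautological presentation of M_p has one generator for each element and one relation for
    each element of the kernel of [w]. It is carried to the stalks over U_p by restriction. *)
Let v_fun (x : V) := free_lin_fun (fun m : M p => mres M (hV x) m) :
  {linear free_mod (M p) (O x) -> M (set_val x)}.

Let v_res (x y : V) (h : leU x y) (m : free_mod (M p) (O x)) :
  v_fun y (free_map (res (leU_val h)) m) = mres M (leU_val h) (v_fun x m).
Proof.
rewrite /v_fun; elim/free_mod_ind: m => [|a b IHa IHb|i a]; first by rewrite !raddf0.
  by rewrite !raddfD /= IHa IHb.
by rewrite free_map_gen /= !free_lin_gen linearZ /= (mres_comp _ _ (hV y)).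
Qed.

Let v : omod_hom (free_omod (restr_space V) (M p)) (restr_omod V M) :=
  @OModHom _ _ (free_omod (restr_space V) (M p)) (restr_omod V M) v_fun v_res.

Let w : {linear free_mod (M p) (stalk p) -> M p} := free_lin_fun id.

Let ker := {z : free_mod (M p) (stalk p) | w z = 0}.

Let u_fun (x : V) := free_lin_fun (fun z : ker => free_map (res (hV x)) (sval z)) :
  {linear free_mod ker (O x) -> free_mod (M p) (O x)}.

Let u_res (x y : V) (h : leU x y) (m : free_mod ker (O x)) :
  u_fun y (free_map (res (leU_val h)) m) = free_map (res (leU_val h)) (u_fun x m).
Proof.
rewrite /u_fun; elim/free_mod_ind: m => [|a b IHa IHb|i a]; first by rewrite !raddf0.
  by rewrite !raddfD /= IHa IHb.
rewrite free_map_gen /= !free_lin_gen linearZ /=; congr (_ *: _).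
by apply: free_mod_eq => m /=; rewrite (res_comp _ _ (hV y)).
Qed.

Let u : omod_hom (free_omod (restr_space V) ker) (free_omod (restr_space V) (M p)) :=
  @OModHom _ _ (free_omod (restr_space V) ker) (free_omod (restr_space V) (M p)) u_fun u_res.

Let v_map (x : V) z : v_fun x (free_map (res (hV x)) z) = mres M (hV x) (w z).
Proof.
rewrite /v_fun /w; elim/free_mod_ind: z => [|a b IHa IHb|i a]; first by rewrite !raddf0.
  by rewrite !raddfD /= IHa IHb.
by rewrite free_map_gen /= !free_lin_gen linearZ.
Qed.

Let v_epi : omod_epi v.
Proof.
move=> x m; have [t <-] := (bc (hV x)).1 m.
elim/tensor_ind: t => [|a b [a' aE] [b' bE]|n b].
- by exists 0; rewrite !raddf0.
- by exists (a' + b'); rewrite !raddfD /= -aE -bE.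
- by exists (free_gen n b); rewrite extend_scalarsE /= /v_fun free_lin_gen.
Qed.

Let u_ker (x : V) (z : free_mod (M p) (stalk p)) (b : O x) : w z = 0 ->
  exists y, u_fun x y = b *: free_map (res (hV x)) z.
Proof.
move=> wz; exists (free_gen (exist _ z wz : ker) b).
by rewrite /u_fun /= free_lin_gen.
Qed.

Let uv_exact : omod_exact u v.
Proof.
move=> x z; split=> [vz|[y <-]]; last first.
  rewrite -[LHS]/(v_fun x (u_fun x y)).
  elim/free_mod_ind: y => [|a b IHa IHb|[i wi] a]; first by rewrite !raddf0.
    have -> : v_fun x (u_fun x (a + b)) = v_fun x (u_fun x a) + v_fun x (u_fun x b).
      by rewrite !linearD.
    by rewrite IHa IHb addr0.
  rewrite -[u_fun x _]/(free_lin_fun _ _) free_lin_gen linearZ /= -[free_lin_fun _ _]/(v_fun x _).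
  by rewrite v_map wi raddf0 scaler0.
pose F := restr_scalars (res (hV x)) (O x)^o.
pose im := image (u_fun x).
(* m ⊗ b |-> b e_m is balanced modulo im, so that v z = 0 forces z ∈ im. *)
pose h (m : M p) (b : F) : modq im := qpi im (free_gen m (b : O x)).
have hbal : balanced h.
  (* It is applied to the relations e_(m + m') - e_m - e_m' and e_(a m) - a e_m, which give
     additivity in m and the exchange of scalars. *)
  have key (y : free_mod (M p) (stalk p)) (b : O x) : w y = 0 ->
      qpi im (b *: free_map (res (hV x)) y) = 0.
    by move=> wy; apply/qpi_eq0; exact: u_ker.
  split=> [m m' b|m b b'|a m b].
  - have := key (free_gen (m + m') 1 - free_gen m 1 - free_gen m' 1) b.
    rewrite {1}/w !raddfB /= !free_lin_gen !scale1r addrAC addrK subrr => /(_ erefl).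
    rewrite !free_map_gen !rmorph1 -!free_gen_scale mulr1.
    by move/eqP; rewrite subr_eq0 subr_eq => /eqP e; rewrite /h e addrC.
  - have e : free_gen m (b + b') = free_gen m b + free_gen m b' :> free_mod _ (O x).
      exact: (raddfD (additive_pack (@free_gen_zmod (M p) (O x) m))).
    by rewrite /h -linearD -e.
  - have := key (free_gen (a *: m) 1 - free_gen m a) b.
    rewrite {1}/w !raddfB /= !free_lin_gen !scale1r subrr => /(_ erefl).
    rewrite !free_map_gen !rmorph1 -!free_gen_scale mulr1.
    by move/eqP; rewrite subr_eq0 mulrC => /eqP.
have tens_zmod (m : M p) : zmod_morphism (fun b : O x => tens m (b : F)).
  move=> b b'; apply/eqP; rewrite eq_sym subr_eq -tensDr; apply/eqP; congr tens.
  by rewrite -[RHS]/(b - b' + b') subrK.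
(* [T] sends b e_m to m ⊗ b. Followed by the base change map it is [v]; followed by the lift of [h]
   it is the projection modulo the image of [u]. *)
have [T TE] : exists T : {additive free_mod (M p) (O x) -> tensor (M p) F},
    forall i a, T (free_gen i a) = tens i (a : F).
  exists (additive_pack (free_eval_zmod tens_zmod)) => i a.
  exact: free_eval_gen.
have extT y : extend_scalars (mres M (hV x)) (T y) = v_fun x y.
  elim/free_mod_ind: y => [|a b IHa IHb|i a]; first by rewrite !raddf0.
    by rewrite !raddfD /= IHa IHb.
  by rewrite TE extend_scalarsE /v_fun /= free_lin_gen.
have liftT y : tensor_lift hbal (T y) = qpi im y.
  elim/free_mod_ind: y => [|a b IHa IHb|i a]; first by rewrite !raddf0.
    by rewrite !raddfD /= IHa IHb.
  by rewrite TE tensor_liftE.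
have Tz : T z = 0 by apply: (bc (hV x)).2; rewrite extT.
by have := liftT z; rewrite Tz raddf0 => /esym/qpi_eq0.
Qed.

Lemma min_open_presentation : exists V' : set X, [/\ open V', V' p &
    exists (I J : Type) (u : omod_hom (free_omod (restr_space V') I)
                                      (free_omod (restr_space V') J))
           (v : omod_hom (free_omod (restr_space V') J) (restr_omod V' M)),
      omod_epi v /\ omod_exact u v].
Proof.
exists V; split; [exact: open_min_open|exact: leU_refl|].
by exists ker, (M p), u, v.
Qed.
End QuasiCoherence.

Lemma base_change_quasi_coherent (k : comPzRingType) (X : ringed_finite_space k)
    (M : omod X) :
  (forall (p q : X) (h : leU p q), base_change (mres M h)) -> quasi_coherent M.
Proof. by move=> bc p; exact: min_open_presentation. Qed.

(** * Sections *)

(** In a finite space these are exactly the open sets; arguments about sections need only the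
    order. *)
Definition upclosed (X : topologicalType) (V : set X) : Prop :=
  forall x y, V x -> leU x y -> V y.

Lemma upclosed_min_open (X : topologicalType) (p : X) : upclosed (min_open p).
Proof. by move=> x y px xy; exact: leU_trans px xy. Qed.

Section Sections.
Variables (k : comPzRingType) (X : ringed_finite_space k).

(** [sections M V p] is M(U_p ∩ V), as a module over O_p. *)
Section Stalk.
Variables (M : omod X) (V : set X) (p : X).

Definition section_index := {x : X | leU p x /\ V x}.

Definition section_family : lmodType (stalk p) :=
  family (fun i : section_index => M (sval i)) (fun i => res (svalP i).1).

Definition compatible (s : section_family) : Prop :=
  forall (i j : section_index) (l : leU (sval i) (sval j)), mres M l (s i) = s j.

Lemma compatible0 : compatible 0.
Proof. by move=> i j l; exact: linear0. Qed.

Lemma compatibleP a s t : compatible s -> compatible t -> compatible (a *: s + t).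
Proof.
move=> cs ct i j l; rewrite !famP linearP /= cs ct.
by rewrite (res_comp _ _ (svalP j).1).
Qed.

Definition sections : lmodType (stalk p) :=
  submod (Submodule compatible0 compatibleP).

Definition sec (s : sections) x (l : leU p x) (v : V x) : M x :=
  smval s (exist (fun x => leU p x /\ V x) x (conj l v)).

Lemma sec_compat (s : sections) x y (l : leU p x) (l' : leU p y) (v : V x) (v' : V y)
  (h : leU x y) : mres M h (sec s l v) = sec s l' v'.
Proof. exact: (smvalP s (exist _ x (conj l v)) (exist _ y (conj l' v')) h). Qed.

Lemma sec_eq (s t : sections) :
  (forall x (l : leU p x) (v : V x), sec s l v = sec t l v) -> s = t.
Proof.
move=> e; apply: smval_inj; apply: fam_eq => -[x [l v]]; exact: e.
Qed.

Lemma secP a (s t : sections) x (l : leU p x) (v : V x) :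
  sec (a *: s + t) l v = res l a *: sec s l v + sec t l v.
Proof.
rewrite /sec linearP famP; congr (res _ a *: _ + _); exact: Prop_irrelevance.
Qed.

Lemma secB (s t : sections) x (l : leU p x) (v : V x) :
  sec (s - t) l v = sec s l v - sec t l v.
Proof. by rewrite -scaleN1r addrC secP rmorphN1 scaleN1r addrC. Qed.

Lemma sec0 x (l : leU p x) (v : V x) : sec 0 l v = 0.
Proof. by rewrite /sec linear0. Qed.

Section Make.
Variable F : forall x, leU p x -> V x -> M x.
Hypothesis FC : forall x y (l : leU p x) (l' : leU p y) (v : V x) (v' : V y) (h : leU x y),
  mres M h (F l v) = F l' v'.

Let fam : section_family := fun i => F (svalP i).1 (svalP i).2.

Let fam_compat : compatible fam.
Proof. by move=> i j l; exact: FC. Qed.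

Definition make_sec : sections := submod_in (K := Submodule compatible0 compatibleP) fam_compat.

Lemma make_secE x (l : leU p x) (v : V x) : sec make_sec l v = F l v.
Proof. by rewrite /sec /=; congr F; exact: Prop_irrelevance. Qed.
End Make.
End Stalk.

Definition sections_res (M : omod X) (V : set X) p q (h : leU p q) (s : sections M V p) :
    sections M V q :=
  make_sec (F := fun x l v => sec s (leU_trans h l) v)
    (fun x y l l' v v' e => sec_compat s (leU_trans h l) (leU_trans h l') v v' e).

Lemma sections_resE (M : omod X) (V : set X) p q (h : leU p q) (s : sections M V p) x
    (l : leU q x) (l' : leU p x) (v : V x) : sec (sections_res h s) l v = sec s l' v.
Proof. by rewrite make_secE; congr (sec s _ v); exact: Prop_irrelevance. Qed.

Lemma sections_res_linear (M : omod X) (V : set X) p q (h : leU p q) :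
  linear_for (res h \; *:%R) (@sections_res M V p q h).
Proof.
move=> a s t; apply: sec_eq => x l v.
rewrite -[RHS]/(sec (res h a *: sections_res h s + sections_res h t) l v) secP.
rewrite !(sections_resE _ _ _ (leU_trans h l)) secP.
by rewrite (res_comp h l (leU_trans h l)).
Qed.

Lemma sections_res_id (M : omod X) (V : set X) p (h : leU p p) (s : sections M V p) :
  sections_res h s = s.
Proof. by apply: sec_eq => x l v; exact: sections_resE. Qed.

Lemma sections_res_comp (M : omod X) (V : set X) p q r (h : leU p q) (h' : leU q r)
    (h'' : leU p r) (s : sections M V p) :
  sections_res h' (sections_res h s) = sections_res h'' s.
Proof.
apply: sec_eq => x l v; rewrite (sections_resE _ _ _ (leU_trans h' l)).
by rewrite !(sections_resE _ _ _ (leU_trans h'' l)).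
Qed.

(** For open [V] with inclusion i this is i_* i^* M. *)
Definition sections_omod (M : omod X) (V : set X) : omod X :=
  @OMod k X (sections M V)
    (fun p q h => semilinear_pack (@sections_res_linear M V p q h))
    (@sections_res_id M V) (@sections_res_comp M V).

Section Hom.
Variables (M N : omod X) (g : omod_hom M N) (V : set X).

Lemma sections_map_subproof p (s : sections M V p) x y (l : leU p x) (l' : leU p y)
    (v : V x) (v' : V y) (h : leU x y) :
  mres N h (g x (sec s l v)) = g y (sec s l' v').
Proof. by rewrite -ohom_res (sec_compat s l l' v v'). Qed.

Definition sections_map p (s : sections M V p) : sections N V p :=
  make_sec (sections_map_subproof s).

Lemma sections_mapE p (s : sections M V p) x (l : leU p x) (v : V x) :
  sec (sections_map s) l v = g x (sec s l v).
Proof. exact: make_secE. Qed.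

Lemma sections_map_linear p : linear (@sections_map p).
Proof.
move=> a s t; apply: sec_eq => x l v.
by rewrite sections_mapE !secP linearP !sections_mapE.
Qed.

Lemma sections_map_res p q (h : leU p q) (s : sections M V p) :
  sections_map (sections_res h s) = sections_res h (sections_map s).
Proof.
apply: sec_eq => x l v.
by rewrite sections_mapE !(sections_resE _ _ _ (leU_trans h l)) sections_mapE.
Qed.

Definition sections_hom : omod_hom (sections_omod M V) (sections_omod N V) :=
  @OModHom k X (sections_omod M V) (sections_omod N V)
    (fun p => linear_pack (@sections_map_linear p)) sections_map_res.
End Hom.

Section Restrict.
Variables (M : omod X) (V W : set X) (WV : W `<=` V).

Definition sections_sub p (s : sections M V p) : sections M W p :=
  make_sec (F := fun x l w => sec s l (WV w))
    (fun x y l l' v v' e => sec_compat s l l' (WV v) (WV v') e).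

Lemma sections_subE p (s : sections M V p) x (l : leU p x) (w : W x) (v : V x) :
  sec (sections_sub s) l w = sec s l v.
Proof. by rewrite make_secE; congr sec; exact: Prop_irrelevance. Qed.

Lemma sections_sub_linear p : linear (@sections_sub p).
Proof.
move=> a s t; apply: sec_eq => x l w.
by rewrite secP !(sections_subE _ _ _ (WV w)) secP.
Qed.

Lemma sections_sub_res p q (h : leU p q) (s : sections M V p) :
  sections_sub (sections_res h s) = sections_res h (sections_sub s).
Proof.
apply: sec_eq => x l w.
rewrite (sections_subE _ _ _ (WV w)) !(sections_resE _ _ _ (leU_trans h l)).
by rewrite (sections_subE _ _ _ (WV w)).
Qed.

Definition sections_restrict : omod_hom (sections_omod M V) (sections_omod M W) :=
  @OModHom k X (sections_omod M V) (sections_omod M W)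
    (fun p => linear_pack (@sections_sub_linear p)) sections_sub_res.
End Restrict.

Lemma sections_restrictE (M : omod X) (V W : set X) (WV : W `<=` V) p (s : sections M V p) x
  (l : leU p x) (w : W x) (v : V x) :
  sec (sections_restrict M WV p s) l w = sec s l v.
Proof. exact: sections_subE. Qed.

Lemma sections_homE (M N : omod X) (g : omod_hom M N) V p (s : sections M V p) x
  (l : leU p x) (v : V x) : sec (sections_hom g V p s) l v = g x (sec s l v).
Proof. exact: sections_mapE. Qed.

Lemma sections_mresE (M : omod X) V p q (h : leU p q) (s : sections M V p) x
    (l : leU q x) (l' : leU p x) (v : V x) :
  sec (mres (sections_omod M V) h s) l v = sec s l' v.
Proof. exact: sections_resE. Qed.

Lemma sections_restrict_hom (M N : omod X) (g : omod_hom M N) (V W : set X) (WV : W `<=` V) p s :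
  sections_restrict N WV p (sections_hom g V p s) =
  sections_hom g W p (sections_restrict M WV p s).
Proof.
apply: sec_eq => x l w; rewrite (sections_restrictE _ _ _ _ (WV _ w)) !sections_homE.
by rewrite (sections_restrictE _ _ _ _ (WV _ w)).
Qed.

Section Union.
Variables (M : omod X) (V W : set X).
Hypotheses (uV : upclosed V) (uW : upclosed W).
Variable p : X.

Lemma sections_union_inj (s : sections M (V `|` W) p) :
  sections_restrict M (@subsetUl _ V W) p s = 0 ->
  sections_restrict M (@subsetUr _ V W) p s = 0 -> s = 0.
Proof.
move=> sV sW; apply: sec_eq => x l [v|w].
- by rewrite -(sections_restrictE (@subsetUl _ V W) s l v) sV.
- by rewrite -(sections_restrictE (@subsetUr _ V W) s l w) sW.
Qed.

Lemma sections_union_glue (s : sections M V p) (t : sections M W p) :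
  sections_restrict M (@subIsetl _ V W) p s = sections_restrict M (@subIsetr _ V W) p t ->
  exists z, sections_restrict M (@subsetUl _ V W) p z = s /\
            sections_restrict M (@subsetUr _ V W) p z = t.
Proof.
move=> e; have st x (l : leU p x) (v : V x) (w : W x) : sec s l v = sec t l w.
  rewrite -(sections_restrictE (@subIsetl _ V W) s l (conj v w)) e.
  exact: sections_restrictE.
(* The value 0 is never reached on the union. Compatibility holds because everything above a point
   of an up-closed set stays in it, so both ends of a restriction are evaluated in the same set. *)
pose F x (l : leU p x) (vw : (V `|` W) x) : M x :=
  match pselect (V x), pselect (W x) with
  | left v, _ => sec s l v
  | _, left w => sec t l w
  | _, _ => 0
  end.
have FV x (l : leU p x) vw (v : V x) : F x l vw = sec s l v.
  by rewrite /F; case: pselect => // v'; congr sec; exact: Prop_irrelevance.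
have FW x (l : leU p x) vw (w : W x) : F x l vw = sec t l w.
  rewrite /F; case: pselect => [v|_]; first exact: st.
  by case: pselect => // w'; congr sec; exact: Prop_irrelevance.
have FC x y (l : leU p x) (l' : leU p y) (vw : (V `|` W) x) (vw' : (V `|` W) y)
    (h : leU x y) : mres M h (F x l vw) = F y l' vw'.
  case: (vw) => [v|w].
  - by rewrite (FV _ _ _ v) (FV _ _ _ (uV v h)); exact: sec_compat.
  - by rewrite (FW _ _ _ w) (FW _ _ _ (uW w h)); exact: sec_compat.
exists (make_sec FC); split; apply: sec_eq => x l v.
- by rewrite (sections_restrictE _ _ _ _ (or_introl v)) make_secE; exact: FV.
- by rewrite (sections_restrictE _ _ _ _ (or_intror v)) make_secE; exact: FW.
Qed.
End Union.

(** Here [x] is the least point of [V], so evaluation at [x] identifies sections with germs. Taking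
    sections over such a [V] is therefore exact. *)
Lemma sections_germ (M : omod X) (V : set X) p x (lx : leU p x) (vx : V x) (m : M x) :
  V `<=` min_open x -> exists s : sections M V p, sec s lx vx = m.
Proof.
move=> Vx; have FC y z (l : leU p y) (l' : leU p z) (v : V y) (v' : V z) (h : leU y z) :
    mres M h (mres M (Vx y v) m) = mres M (Vx z v') m by exact: mres_comp.
by exists (make_sec FC); rewrite make_secE mres_id.
Qed.

Lemma sections_germ_inj (M : omod X) (V : set X) p x (lx : leU p x) (vx : V x)
    (s t : sections M V p) :
  V `<=` min_open x -> sec s lx vx = sec t lx vx -> s = t.
Proof.
move=> Vx e; apply: sec_eq => y l v.
by rewrite -!(sec_compat _ lx l vx v (Vx y v)) e.
Qed.

Section Exactness.
Variables (M N P : omod X) (f : omod_hom M N) (g : omod_hom N P) (V : set X) (p : X).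

Lemma sections_mono (s : sections M V p) :
  omod_mono f -> sections_hom f V p s = 0 -> s = 0.
Proof.
move=> fm fs; apply: sec_eq => x l v; apply: fm; rewrite -sections_homE fs.
by rewrite sec0 linear0.
Qed.

Lemma sections_left_exact (s : sections N V p) :
  omod_mono f -> omod_exact f g -> sections_hom g V p s = 0 ->
  exists t, sections_hom f V p t = s.
Proof.
move=> fm fg gs.
have ex x (l : leU p x) (v : V x) : exists m, f x m = sec s l v.
  by apply/fg; rewrite -sections_homE gs.
have FC x y (l : leU p x) (l' : leU p y) (v : V x) (v' : V y) (h : leU x y) :
    mres M h (projT1 (cid (ex x l v))) = projT1 (cid (ex y l' v')).
  apply: fm; rewrite ohom_res (projT2 (cid (ex x l v))) (projT2 (cid (ex y l' v'))).
  exact: sec_compat.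
exists (make_sec FC); apply: sec_eq => x l v.
by rewrite sections_homE make_secE (projT2 (cid (ex x l v))).
Qed.

Lemma sections_germ_exact x (lx : leU p x) (vx : V x) (s : sections N V p) :
  V `<=` min_open x -> omod_exact f g -> sections_hom g V p s = 0 ->
  exists t, sections_hom f V p t = s.
Proof.
move=> Vx fg gs; have /fg[m mE] : g x (sec s lx vx) = 0 by rewrite -sections_homE gs.
have [t tE] := sections_germ lx vx m Vx; exists t.
by apply: (sections_germ_inj (x := x) (lx := lx) (vx := vx)); rewrite ?sections_homE ?tE.
Qed.
End Exactness.

Section Complexes.
Variables (F : omod X) (I : inj_resolution F).

Lemma rdiffK n p (m : I n p) : rdiff I n.+1 p (rdiff I n p m) = 0.
Proof. by apply/rdiff_exact; exists m. Qed.

Lemma raugK p (m : F p) : rdiff I 0 p (raug I p m) = 0.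
Proof. by apply/raug_exact; exists m. Qed.

Lemma sections_diffK (V : set X) n p (s : sections_omod (I n) V p) :
  sections_hom (rdiff I n.+1) V p (sections_hom (rdiff I n) V p s) = 0.
Proof. by apply: sec_eq => x l v; rewrite !sections_homE rdiffK sec0. Qed.

Definition sections_complex (V : set X) : omod_complex X :=
  @OModComplex k X (fun n => sections_omod (I n) V) (fun n => sections_hom (rdiff I n) V)
    (@sections_diffK V).
End Complexes.
End Sections.

(** * Enough injectives *)

Section DivisibleInjective.
Variables (D M N : zmodType) (i : {additive M -> N}) (f : {additive M -> D}).
Hypothesis D_divisible : forall (d : D) n, exists e, e *+ n.+1 = d.
Hypothesis i_inj : injective i.

(** Graphs of additive maps defined on subgroups of N that contain the image of [i], with the
    prescribed values there; the middle clause is single-valuedness. *)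
Let partial (A : set (N * D)) : Prop :=
  [/\ forall x y, A x -> A y -> A (x - y), forall d, A (0, d) -> d = 0
    & forall m, A (i m, f m)].

Let graph : set (N * D) := [set x | exists m, x = (i m, f m)].

Let partial_graph : partial graph.
Proof.
split=> [_ _ [m ->] [m' ->]|d [m [im0 ->]]|m]; last by exists m.
- by exists (m - m'); rewrite !raddfB.
- by rewrite (i_inj (x1 := m) (x2 := 0)) ?raddf0.
Qed.

Let partial0 A : partial A -> A 0.
Proof. by case=> AB _ Ai; rewrite -(subrr (i 0, f 0)); apply: AB. Qed.

Let partialN A x : partial A -> A x -> A (- x).
Proof. by move=> pA Ax; rewrite -sub0r; case: (pA) => AB _ _; apply: AB => //; exact: partial0. Qed.

Let partialD A x y : partial A -> A x -> A y -> A (x + y).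
Proof.
by move=> pA Ax Ay; rewrite -[y]opprK; case: (pA) => AB _ _; apply: AB => //; exact: partialN.
Qed.

Let partialMn A x n : partial A -> A x -> A (x *+ n).
Proof.
move=> pA Ax; elim: n => [|n IH]; first by rewrite mulr0n; exact: partial0.
by rewrite mulrS; exact: partialD.
Qed.

Let partialMz A x (n : int) : partial A -> A x -> A (x *~ n).
Proof.
move=> pA Ax; case: n => n; first exact: partialMn.
by rewrite NegzE mulrNz; apply: partialN => //; exact: partialMn.
Qed.

Let pairMz (x : N) (d : D) (n : int) : (x, d) *~ n = (x *~ n, d *~ n).
Proof.
have Mn m : (x, d) *+ m = (x *+ m, d *+ m) by elim: m => // m; rewrite !mulrS => ->.
by case: n => n; rewrite ?NegzE ?mulrNz -!pmulrn Mn.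
Qed.

(** Supplies an admissible value [e] at a new element [n]: it has to agree with [A] on every
    multiple of [n] that is already in the domain. *)
Lemma partial_multiple A n : partial A -> exists e : D,
  forall (j : int) d, A (n *~ j, d) -> d = e *~ j.
Proof.
move=> pA; have [AB A0 Ai] := pA.
have [[m /andP[m_gt0 /asboolP ex]]|none] :=
  pselect (exists m, (0 < m)%N && `[< exists d, A (n *+ m, d) >]).
  have exm : exists m, (0 < m)%N && `[< exists d, A (n *+ m, d) >].
    by exists m; rewrite m_gt0; apply/asboolP.
  (* With m least such that m n lies in the domain, take e such that m e = d0. *)
  case: (ex_minnP exm) => {m m_gt0 ex} m /andP[m_gt0 /asboolP[d0 Ad0]] m_min.
  have [e] := D_divisible d0 m.-1; rewrite prednK // => eE; exists e => j d Ajd.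
  have m_neq0 : (m : int) != 0 by rewrite -lt0n in m_gt0 *; case: (m) m_gt0.
  have Ar : A (n *~ (j %% m)%Z, d - d0 *~ (j %/ m)%Z).
    have := AB _ _ Ajd (partialMz (j %/ m)%Z pA Ad0); rewrite pairMz.
    congr (A (_, _)); rewrite pmulrn -mulrzA -mulrzBr; congr (_ *~ _).
    by rewrite {1}(divz_eq j m) mulrC addrAC subrr add0r.
  have [r rE] : exists r : nat, (j %% m)%Z = r.
    by exists `|(j %% m)%Z|%N; rewrite gez0_abs // modz_ge0.
  have r_lt : (r < m)%N.
    by have := ltz_pmod j (d := m); rewrite rE ltz_nat; apply; rewrite ltz_nat.
  have r0 : r = 0%N.
    case: r rE r_lt => // r rE; rewrite ltnNge m_min //=; apply/asboolP.
    by exists (d - d0 *~ (j %/ m)%Z); move: Ar; rewrite rE.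
  rewrite rE r0 mulr0z in Ar; have /eqP := A0 _ Ar; rewrite subr_eq0 => /eqP ->.
  by rewrite -eE pmulrn -mulrzA {2}(divz_eq j m) rE r0 addr0 mulrC.
exists 0 => j d Ajd; rewrite mul0rz; have [j0|j_neq0] := eqVneq j 0.
  by apply: A0; rewrite j0 mulr0z in Ajd.
case: none; exists `|j|%N; rewrite absz_gt0 j_neq0; apply/asboolP.
case: (j) Ajd => j' Ajd; first by exists d.
exists (- d); have := partialN pA Ajd.
by rewrite NegzE mulrNz -[- (_, _)]/(- - _, - d) opprK.
Qed.

Lemma divisible_injective : exists g : {additive N -> D}, forall m, g (i m) = f m.
Proof.
have [|A [PA Amax]] := @Zorn_bigcup _ [set A | A = set0 \/ partial A].
  move=> F FP Ftot; have [F0|] := pselect (forall A, F A -> A = set0).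
    by left; apply/seteqP; split=> // x [A /F0->].
  move=> /existsNP[A0 /not_implyP[FA0 A0n]].
  have Fp A x : F A -> A x -> partial A by move=> FA Ax; case: (FP A FA) Ax => // ->.
  have pA0 : partial A0 by case: (FP _ FA0).
  right; split=> [x y [A FA Ax] [B FB By]|d [A FA Ad]|m].
  - have [AB|BA] := Ftot A B FA FB.
      have [BB _ _] := Fp B y FB By.
      by exists B => //; apply: BB => //; exact: AB.
    have [AA _ _] := Fp A x FA Ax.
    by exists A => //; apply: AA => //; exact: BA.
  - by have [_ + _] := Fp A _ FA Ad; apply.
  - by exists A0 => //; case: pA0.
have pA : partial A.
  case: PA => // A0; case: (Amax graph); last by right.
  rewrite A0; split; first exact: sub0set.
  by move=> /(_ (i 0, f 0)); apply; exists 0.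
have [AB A0 Ai] := pA.
have total n : exists d, A (n, d).
  apply: contrapT => nA; have [e eP] := partial_multiple n pA.
  (* The subgroup generated by [A] and (n, e); it contradicts maximality if [n] is outside the
     domain of [A]. *)
  pose B : set (N * D) := [set y | exists x (j : int), A x /\ y = x + (n *~ j, e *~ j)].
  case: (Amax B).
    split; first by move=> x Ax; exists x, 0; rewrite !mulr0z addr0.
    move=> BA; apply: nA; exists e; apply: BA.
    by exists 0, 1; rewrite !mulr1z add0r; split=> //; exact: partial0.
  right; split.
  - move=> _ _ [x [j [Ax ->]]] [y [l [Ay ->]]]; exists (x - y), (j - l).
    split; first exact: AB.
    by rewrite !mulrzBr opprD addrACA.
  - move=> d [[x d'] [j [Ax [+ ->]]]] => /eqP; rewrite eq_sym addrC addr_eq0 => /eqP nE.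
    have /eP <- : A (n *~ j, - d') by rewrite nE; exact: (partialN pA Ax).
    by rewrite subrr.
  - by move=> m; exists (i m, f m), 0; rewrite !mulr0z addr0.
pose g n := projT1 (cid (total n)).
have gP n : A (n, g n) by exact: projT2 (cid (total n)).
have uniq n d : A (n, d) -> d = g n.
  move=> Ad; apply/eqP; rewrite -subr_eq0; apply/eqP/A0.
  by have := AB _ _ Ad (gP n); rewrite -[_ - _]/(n - n, d - g n) subrr.
have gB : zmod_morphism g.
  by move=> x y; apply/esym/uniq; exact: (AB _ _ (gP x) (gP y)).
by exists (additive_pack gB) => m; apply/esym/uniq.
Qed.
End DivisibleInjective.

(** M = Z^(M)/K embeds into the divisible group Q^(M)/K. *)
Section DivisibleHull.
Variable M : zmodType.
Local Notation Q := (free_mod M rat).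
Local Notation inQ := (free_map (intr : {rmorphism int -> rat})).

Let mulz_zmod (m : M) : zmod_morphism (fun a : int => m *~ a).
Proof. by move=> a b; rewrite mulrzBr. Qed.

Let value := additive_pack (free_eval_zmod mulz_zmod).

Let K (x : Q) := exists2 w, inQ w = x & value w = 0.

Let K0 : K 0. Proof. by exists 0; rewrite raddf0. Qed.

Let KB x y : K x -> K y -> K (x - y).
Proof.
move=> [w <- w0] [v <- v0]; exists (w - v); first by rewrite raddfB.
by rewrite (raddfB value) w0 v0 subrr.
Qed.

Lemma divisible_hull : exists D : zmodType,
  (forall (d : D) n, exists e, e *+ n.+1 = d) /\
  exists i : {additive M -> D}, injective i.
Proof.
exists (zquot K0 KB); split=> [d n|].
  have [x ->] := zpi_surj d; exists (zpi K0 KB (n.+1%:R^-1 *: x)).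
  by rewrite -raddfMn -scaler_nat scalerA divff ?scale1r // Num.Theory.pnatr_eq0.
pose i m := zpi K0 KB (free_gen m 1).
have iB : zmod_morphism i.
  move=> x y; apply/eqP; rewrite -subr_eq0 -!raddfB; apply/eqP/zpi_eq0.
  exists (free_gen (x - y) 1 - (free_gen x 1 - free_gen y 1)).
    by rewrite !raddfB /= !free_map_gen.
  by rewrite !(raddfB value) -![value _]/(free_eval _ _) !free_eval_gen // !mulr1z subrr.
exists (additive_pack iB) => x y /eqP; rewrite -subr_eq0 -raddfB => /eqP/zpi_eq0[w wE w0].
have e : w = free_gen (x - y) 1.
  apply: free_mod_eq => j; apply: (@intr_inj rat).
  by have := congr1 (@fcoef _ _ ^~ j) wE => /= ->; case: asboolP.
move: w0; rewrite e -[value _]/(free_eval _ _) free_eval_gen // mulr1z.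
by move/eqP; rewrite subr_eq0 => /eqP.
Qed.
End DivisibleHull.

Definition module_injective (R : pzRingType) (E : lmodType R) : Prop :=
  forall (M N : lmodType R) (i : {linear M -> N}) (f : {linear M -> E}),
    injective i -> exists g : {linear N -> E}, forall m, g (i m) = f m.

(** Hom_Z(R, D) *)
Section Coinduced.
Variables (R : comPzRingType) (D : zmodType).

Record coinduced : Type := Coinduced {
  coind :> R -> D;
  coind_zmod : zmod_morphism coind }.
HB.instance Definition _ := gen_eqMixin coinduced.
HB.instance Definition _ := gen_choiceMixin coinduced.

Lemma coind_eq (u v : coinduced) : (forall r, u r = v r) -> u = v.
Proof.
case: u v => [u uB] [v vB] /= /funext e; rewrite {u}e in uB *.
by rewrite (Prop_irrelevance uB vB).
Qed.

Lemma coind_zero_zmod : zmod_morphism (fun _ : R => 0 : D).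
Proof. by move=> r s; rewrite subr0. Qed.
Definition coind_zero := Coinduced coind_zero_zmod.

Lemma coind_add_zmod (u v : coinduced) : zmod_morphism (fun r => u r + v r).
Proof. by move=> r s; rewrite !coind_zmod opprD addrACA. Qed.
Definition coind_add u v := Coinduced (coind_add_zmod u v).

Lemma coind_opp_zmod (u : coinduced) : zmod_morphism (fun r => - u r).
Proof. by move=> r s; rewrite coind_zmod opprD. Qed.
Definition coind_opp u := Coinduced (coind_opp_zmod u).

Lemma coind_scale_zmod (a : R) (u : coinduced) : zmod_morphism (fun r => u (r * a)).
Proof. by move=> r s; rewrite mulrBl coind_zmod. Qed.
Definition coind_scale a u := Coinduced (coind_scale_zmod a u).

Lemma coind_addA : associative coind_add.
Proof. by move=> u v w; apply: coind_eq => r; rewrite /= addrA. Qed.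
Lemma coind_addC : commutative coind_add.
Proof. by move=> u v; apply: coind_eq => r; rewrite /= addrC. Qed.
Lemma coind_add0 : left_id coind_zero coind_add.
Proof. by move=> u; apply: coind_eq => r; rewrite /= add0r. Qed.
Lemma coind_addN : left_inverse coind_zero coind_opp coind_add.
Proof. by move=> u; apply: coind_eq => r; rewrite /= addNr. Qed.
HB.instance Definition _ := GRing.isZmodule.Build coinduced
  coind_addA coind_addC coind_add0 coind_addN.

Lemma coind_scaleA a b u : coind_scale a (coind_scale b u) = coind_scale (a * b) u.
Proof. by apply: coind_eq => r; rewrite /= -mulrA. Qed.
Lemma coind_scale1 : left_id 1 coind_scale.
Proof. by move=> u; apply: coind_eq => r; rewrite /= mulr1. Qed.
Lemma coind_scaleDr : right_distributive coind_scale +%R.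
Proof. by move=> a u v; apply: coind_eq. Qed.
Lemma coind_scaleDl u : {morph coind_scale^~ u : a b / a + b}.
Proof.
move=> a b; apply: coind_eq => r; rewrite /= mulrDr.
exact: (raddfD (additive_pack (coind_zmod u))).
Qed.
HB.instance Definition _ := GRing.Zmodule_isLmodule.Build R coinduced
  coind_scaleA coind_scale1 coind_scaleDr coind_scaleDl.
End Coinduced.

(** Evaluation at 1 turns linear maps into Hom_Z(R, D) into additive maps into D, where divisibility
    provides extensions. *)
Lemma coinduced_injective (R : comPzRingType) (D : zmodType) :
  (forall (d : D) n, exists e, e *+ n.+1 = d) -> module_injective (coinduced R D).
Proof.
move=> D_div M N i f i_inj.
have fB : zmod_morphism (fun m => f m 1) by move=> m m'; rewrite linearB.
have [g gE] := divisible_injective (additive_pack fB) D_div i_inj.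
have hB n : zmod_morphism (fun r : R => g (r *: n)).
  by move=> r s; rewrite scalerBl raddfB.
have h_linear : linear (fun n => Coinduced (hB n)).
  move=> a n n'; apply: coind_eq => r.
  by rewrite /= scalerDr raddfD scalerA.
exists (linear_pack h_linear) => m; apply: coind_eq => r /=.
by rewrite -linearZ gE /= linearZ /= mul1r.
Qed.

Lemma module_enough_injectives (R : comPzRingType) (M : lmodType R) :
  exists E : lmodType R, module_injective E /\ exists j : {linear M -> E}, injective j.
Proof.
have [D [D_div [i i_inj]]] := divisible_hull M.
exists (coinduced R D); split; first exact: coinduced_injective.
have jB m : zmod_morphism (fun r : R => i (r *: m)).
  by move=> r s; rewrite scalerBl raddfB.
have j_linear : linear (fun m => Coinduced (jB m)).
  move=> a n n'; apply: coind_eq => r.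
  by rewrite /= scalerDr raddfD scalerA.
exists (linear_pack j_linear) => m m' /(congr1 (fun u : coinduced R D => u 1)) /=.
by rewrite !scale1r => /i_inj.
Qed.

(** The product over p of the skyscrapers at p with fibre E_p. *)
Section Godement.
Variables (k : comPzRingType) (X : ringed_finite_space k).
Variable E : forall p : X, lmodType (stalk p).

Definition godement_stalk (q : X) : lmodType (stalk q) :=
  family (fun i : {p : X | leU q p} => E (sval i)) (fun i => res (svalP i)).

Definition godement_res q q' (h : leU q q') (s : godement_stalk q) : godement_stalk q' :=
  fun i => s (exist (leU q) (sval i) (leU_trans h (svalP i))).

Lemma godement_res_linear q q' (h : leU q q') :
  linear_for (res h \; *:%R) (@godement_res q q' h).
Proof.
move=> a s t; apply: fam_eq => i; rewrite famP /godement_res famP /=.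
by rewrite (res_comp h _ (svalP (exist (leU q) (sval i) (leU_trans h (svalP i))))).
Qed.

Lemma godement_res_id q (h : leU q q) s : godement_res h s = s.
Proof.
apply: fam_eq => -[p l]; rewrite /godement_res /=.
by rewrite (Prop_irrelevance (leU_trans h _) l).
Qed.

Lemma godement_res_comp q r t (h : leU q r) (h' : leU r t) (h'' : leU q t) s :
  godement_res h' (godement_res h s) = godement_res h'' s.
Proof.
apply: fam_eq => -[p l]; rewrite /godement_res /=.
congr (s (exist _ p _)); exact: Prop_irrelevance.
Qed.

Definition godement : omod X :=
  @OMod k X godement_stalk (fun q q' h => semilinear_pack (@godement_res_linear q q' h))
    godement_res_id godement_res_comp.

Section Hom.
Variables (M : omod X) (e : forall p, {linear M p -> E p}).

Definition godement_fun q (m : M q) : godement_stalk q :=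
  fun i => e (sval i) (mres M (svalP i) m).

Lemma godement_fun_linear q : linear (@godement_fun q).
Proof. by move=> a m m'; apply: fam_eq => i; rewrite famP /godement_fun !linearP. Qed.

Lemma godement_fun_res q q' (h : leU q q') (m : M q) :
  godement_fun (mres M h m) = godement_res h (godement_fun m).
Proof.
apply: fam_eq => i; rewrite /godement_fun /godement_res /=; congr (e _ _).
exact: mres_comp.
Qed.

Definition godement_hom : omod_hom M godement :=
  @OModHom k X M godement (fun q => linear_pack (@godement_fun_linear q)) godement_fun_res.
End Hom.

(** A morphism into a product of skyscrapers is a family of linear maps M_p -> E_p, so it can be
    extended one stalk at a time. *)
Lemma godement_injective : (forall p, module_injective (E p)) -> omod_injective godement.
Proof.
move=> E_inj M N i f i_mono.
(* Of the stalk at [p] only the component of index [p] is extended; the others are recovered by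
   restriction. *)
have e_linear p : linear (fun m : M p => f p m (exist (leU p) p (leU_refl p))).
  by move=> a m m'; rewrite linearP famP res_id.
have ex p := E_inj p _ _ (i p) (linear_pack (e_linear p)) (i_mono p).
exists (godement_hom (fun p => projT1 (cid (ex p)))) => q m.
apply: fam_eq => -[p l]; rewrite /= /godement_fun /= -ohom_res.
rewrite (projT2 (cid (ex p))) /= ohom_res /= /godement_res /=.
congr (f q m (exist _ p _)); exact: Prop_irrelevance.
Qed.

End Godement.

Lemma omod_enough_injectives (k : comPzRingType) (X : ringed_finite_space k) (M : omod X) :
  exists I : omod X, omod_injective I /\ exists j : omod_hom M I, omod_mono j.
Proof.
pose E p := projT1 (cid (module_enough_injectives (M p))).
have EP p := projT2 (cid (module_enough_injectives (M p))).
pose j p := projT1 (cid (EP p).2).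
have j_inj p : injective (j p) := projT2 (cid (EP p).2).
exists (godement E); split; first by apply: godement_injective => p; exact: (EP p).1.
exists (godement_hom j) => p m m'.
move=> /(congr1 (fun s : godement_stalk E p => s (exist (leU p) p (leU_refl p)))).
by rewrite /= /godement_fun /= !mres_id => /j_inj.
Qed.

(** * Quotients of O-modules and existence of injective resolutions *)

Section OmodQuotient.
Variables (k : comPzRingType) (X : ringed_finite_space k) (M : omod X).
Variable K : forall p, submodule (M p).
Hypothesis K_res : forall p q (h : leU p q) m, K p m -> K q (mres M h m).

Definition omod_quot_stalk p : lmodType (stalk p) := modq (K p).

Definition omod_quot_res p q (h : leU p q) (c : omod_quot_stalk p) : omod_quot_stalk q :=
  qpi (K q) (mres M h (qrepr c)).

Lemma omod_quot_resE p q (h : leU p q) m :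
  omod_quot_res h (qpi (K p) m) = qpi (K q) (mres M h m).
Proof.
apply: (qrepr_lift (h := fun m => qpi (K q) (mres M h m))) => [x y|x Kx].
  by rewrite !linearB.
by apply/qpi_eq0; exact: K_res.
Qed.

Lemma omod_quot_res_linear p q (h : leU p q) : linear_for (res h \; *:%R) (omod_quot_res h).
Proof.
move=> a c c'; have [x ->] := qpi_surj c; have [y ->] := qpi_surj c'.
by rewrite -linearP !omod_quot_resE linearP /= linearP.
Qed.

Lemma omod_quot_res_id p (h : leU p p) c : omod_quot_res h c = c.
Proof. by have [x ->] := qpi_surj c; rewrite omod_quot_resE mres_id. Qed.

Lemma omod_quot_res_comp p q r (h : leU p q) (h' : leU q r) (h'' : leU p r) c :
  omod_quot_res h' (omod_quot_res h c) = omod_quot_res h'' c.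
Proof.
by have [x ->] := qpi_surj c; rewrite !omod_quot_resE (mres_comp h h' h'').
Qed.

Definition omod_quot : omod X :=
  @OMod k X omod_quot_stalk (fun p q h => semilinear_pack (omod_quot_res_linear h))
    omod_quot_res_id omod_quot_res_comp.

Definition omod_quot_pi : omod_hom M omod_quot :=
  @OModHom k X M omod_quot (fun p => qpi (K p))
    (fun p q h m => esym (omod_quot_resE h m)).

Section Lift.
Variables (N : omod X) (f : omod_hom M N) (fK : forall p m, K p m -> f p m = 0).

Definition omod_quot_fun p (c : omod_quot_stalk p) : N p := f p (qrepr c).

Lemma omod_quot_funE p m : omod_quot_fun (qpi (K p) m) = f p m.
Proof. by apply: qrepr_lift => [x y|]; [rewrite linearB|exact: fK]. Qed.

Lemma omod_quot_fun_linear p : linear (@omod_quot_fun p).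
Proof.
move=> a c c'; have [x ->] := qpi_surj c; have [y ->] := qpi_surj c'.
by rewrite -linearP !omod_quot_funE linearP.
Qed.

Lemma omod_quot_fun_res p q (h : leU p q) (c : omod_quot_stalk p) :
  omod_quot_fun (omod_quot_res h c) = mres N h (omod_quot_fun c).
Proof.
by have [x ->] := qpi_surj c; rewrite omod_quot_resE !omod_quot_funE ohom_res.
Qed.

Definition omod_quot_lift : omod_hom omod_quot N :=
  @OModHom k X omod_quot N (fun p => linear_pack (@omod_quot_fun_linear p))
    omod_quot_fun_res.
End Lift.
End OmodQuotient.

Definition omod_comp (k : comPzRingType) (X : ringed_finite_space k) (M N P : omod X)
    (g : omod_hom N P) (f : omod_hom M N) : omod_hom M P.
Proof.
exists (fun p => linear_pack (g := fun m => g p (f p m))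
  (fun a x y => etrans (congr1 (g p) (linearP (f p) a x y)) (linearP (g p) a _ _))).
by move=> p q h m; rewrite /= !ohom_res.
Defined.

Section Resolution.
Variables (k : comPzRingType) (X : ringed_finite_space k).

Lemma omod_image_res (M N : omod X) (f : omod_hom M N) p q (h : leU p q) n :
  image (f p) n -> image (f q) (mres N h n).
Proof. by move=> [m <-]; exists (mres M h m); rewrite ohom_res. Qed.

(** Some injective module containing [M], not an injective envelope. *)
Definition hull (M : omod X) : omod X := projT1 (cid (omod_enough_injectives M)).

Lemma hull_injective M : omod_injective (hull M).
Proof. exact: (projT2 (cid (omod_enough_injectives M))).1. Qed.

Definition to_hull M : omod_hom M (hull M) :=
  projT1 (cid (projT2 (cid (omod_enough_injectives M))).2).

Lemma to_hull_mono M : omod_mono (to_hull M).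
Proof. exact: projT2 (cid (projT2 (cid (omod_enough_injectives M))).2). Qed.

Definition cosyzygy (M : omod X) : omod X := omod_quot (@omod_image_res _ _ (to_hull M)).

Definition to_cosyzygy (M : omod X) : omod_hom (hull M) (cosyzygy M) :=
  omod_quot_pi (@omod_image_res _ _ (to_hull M)).

Lemma cosyzygy_exact M : omod_exact (to_hull M) (to_cosyzygy M).
Proof. by move=> p n; exact: qpi_eq0. Qed.

Lemma to_cosyzygy_epi M : omod_epi (to_cosyzygy M).
Proof. by move=> p c; have [m ->] := qpi_surj c; exists m. Qed.

(** The resolution is spliced from the short exact sequences 0 -> Z n -> hull (Z n) -> Z (n+1) ->
    0. *)
Lemma inj_resolution_exists (F : omod X) : inhabited (inj_resolution F).
Proof.
pose Z n := iter n cosyzygy F.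
pose d n : omod_hom (hull (Z n)) (hull (Z n.+1)) :=
  omod_comp (to_hull (Z n.+1)) (to_cosyzygy (Z n)).
have d0 n p (m : hull (Z n) p) : d n p m = 0 <-> to_cosyzygy (Z n) p m = 0.
  split=> [e|e]; last by rewrite /= e linear0.
  by apply: (@to_hull_mono (Z n.+1)); rewrite linear0.
constructor; apply: (@InjResolution k X F (fun n => hull (Z n)) d (to_hull F)).
- by move=> n; exact: hull_injective.
- exact: to_hull_mono.
- by move=> p m; rewrite d0; exact: cosyzygy_exact.
- move=> n p m; rewrite d0; split=> [/cosyzygy_exact[c <-]|[m' <-]].
    by have [m' <-] := to_cosyzygy_epi c; exists m'.
  by apply/cosyzygy_exact; eexists.
Qed.
End Resolution.

(** * Comparison of resolutions and extension by zero *)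

Section Comparison.
Variables (k : comPzRingType) (X : ringed_finite_space k).

(** The quotient of M by the kernel of [d] embeds into N, and [g] descends to it; injectivity of I
    does the rest. Chain maps and homotopies are both built from this. *)
Lemma injective_factor (M N I : omod X) (d : omod_hom M N) (g : omod_hom M I) :
  omod_injective I -> (forall p m, d p m = 0 -> g p m = 0) ->
  exists h : omod_hom N I, forall p m, h p (d p m) = g p m.
Proof.
move=> I_inj gd.
have K_res p q (h : leU p q) m : kernel (d p) m -> kernel (d q) (mres M h m).
  by rewrite /= ohom_res => ->; rewrite linear0.
pose dbar := @omod_quot_lift _ _ _ _ K_res _ d (fun p m e => e).
have dbarE p m : dbar p (qpi _ m) = d p m by exact: omod_quot_funE.
have dbar_mono : omod_mono dbar.
  move=> p c c'; have [x ->] := qpi_surj c; have [y ->] := qpi_surj c'.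
  rewrite !dbarE => /eqP; rewrite -subr_eq0 -linearB => /eqP dxy.
  by apply/eqP; rewrite -subr_eq0 -linearB; apply/eqP/qpi_eq0.
have [h hE] := I_inj _ _ dbar (@omod_quot_lift _ _ _ _ K_res _ g gd) dbar_mono.
by exists h => p m; rewrite -dbarE hE; exact: omod_quot_funE.
Qed.

Lemma omod_sub_linear (M N : omod X) (f g : omod_hom M N) p :
  linear (fun m => f p m - g p m).
Proof. by move=> a x y; rewrite (linearP (f p)) (linearP (g p)) opprD addrACA scalerBr. Qed.

Lemma omod_sub_res (M N : omod X) (f g : omod_hom M N) p q (h : leU p q) (m : M p) :
  linear_pack (@omod_sub_linear M N f g q) (mres M h m) =
  mres N h (linear_pack (@omod_sub_linear M N f g p) m).
Proof. by rewrite /= !ohom_res linearB. Qed.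

Definition omod_sub (M N : omod X) (f g : omod_hom M N) : omod_hom M N :=
  OModHom (omod_sub_res f g).

Lemma omod_subE (M N : omod X) (f g : omod_hom M N) p m : omod_sub f g p m = f p m - g p m.
Proof. by []. Qed.

Definition omod_id (M : omod X) : omod_hom M M :=
  @OModHom k X M M (fun p => idfun) (fun p q h m => erefl).

Section ChainMap.
Variables (F : omod X) (I J : inj_resolution F).

(** The invariant of the recursion: [a] preserves cocycles, as [injective_factor] requires for the
    next map. *)
Let P n (a : omod_hom (I n) (J n)) := forall p m, rdiff I n p m = 0 -> rdiff J n p (a p m) = 0.

Let step n (a : {a : omod_hom (I n) (J n) | P a}) :
  exists b : omod_hom (I n.+1) (J n.+1), P b /\
    forall p m, b p (rdiff I n p m) = rdiff J n p (sval a p m).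
Proof.
case: a => a Pa /=; have [b bE] := injective_factor (d := rdiff I n)
  (g := omod_comp (rdiff J n) a) (@rterm_injective _ _ _ J n.+1) Pa.
exists b; split=> // p m /rdiff_exact[m' <-]; rewrite bE; exact: rdiffK.
Qed.

Let start : exists a : omod_hom (I 0) (J 0), P a /\
  forall p m, a p (raug I p m) = raug J p m.
Proof.
have [a aE] := @rterm_injective _ _ _ J 0 _ _ (raug I) (raug J) (@raug_mono _ _ _ I).
exists a; split=> // p m /raug_exact[m' <-]; rewrite aE; exact: raugK.
Qed.

Lemma resolution_map : exists a : forall n, omod_hom (I n) (J n),
  (forall p m, a 0 p (raug I p m) = raug J p m) /\
  forall n p m, a n.+1 p (rdiff I n p m) = rdiff J n p (a n p m).
Proof.
pose a := nat_rect (fun n => {a : omod_hom (I n) (J n) | P a})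
  (exist _ (sval (cid start)) (svalP (cid start)).1)
  (fun n a => exist _ (sval (cid (step a))) (svalP (cid (step a))).1).
exists (fun n => sval (a n)); split; first exact: (svalP (cid start)).2.
by move=> n; exact: (svalP (cid (step (a n)))).2.
Qed.
End ChainMap.

Section Homotopy.
Variables (F : omod X) (J : inj_resolution F) (f : forall n, omod_hom (J n) (J n)).
Hypothesis f_aug : forall p m, f 0 p (raug J p m) = raug J p m.
Hypothesis fd : forall n p m, f n.+1 p (rdiff J n p m) = rdiff J n p (f n p m).

(** Equivalently, f - 1 - d h vanishes on coboundaries in degree n+1, the condition under which the
    next homotopy exists. *)
Let P n (h : omod_hom (J n.+1) (J n)) :=
  forall p m, rdiff J n p (f n p m - m - h p (rdiff J n p m)) = 0.

Let start : exists h : omod_hom (J 1) (J 0), P h.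
Proof.
have [|h hE] := injective_factor (d := rdiff J 0) (g := omod_sub (f 0) (omod_id _))
  (@rterm_injective _ _ _ J 0).
  by move=> p m /raug_exact[m' <-]; rewrite omod_subE f_aug subrr.
by exists h => p m; rewrite hE omod_subE subrr linear0.
Qed.

Let step n (h : {h : omod_hom (J n.+1) (J n) | P h}) :
  exists g : omod_hom (J n.+2) (J n.+1), P g /\
    forall p m, g p (rdiff J n.+1 p m) = f n.+1 p m - m - rdiff J n p (sval h p m).
Proof.
case: h => h Ph /=.
have [|g gE] := injective_factor (d := rdiff J n.+1)
  (g := omod_sub (omod_sub (f n.+1) (omod_id _)) (omod_comp (rdiff J n) h))
  (@rterm_injective _ _ _ J n.+1).
  by move=> p m /rdiff_exact[m' <-]; rewrite !omod_subE fd -!linearB Ph.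
exists g; split=> // p m; rewrite gE !omod_subE opprB addrC subrK; exact: rdiffK.
Qed.

(** The identity is recorded in positive degrees, where cohomology is to vanish. *)
Lemma resolution_homotopy : exists h : forall n, omod_hom (J n.+1) (J n),
  forall n p m, h n.+1 p (rdiff J n.+1 p m) = f n.+1 p m - m - rdiff J n p (h n p m).
Proof.
pose h := nat_rect (fun n => {h : omod_hom (J n.+1) (J n) | P h})
  (exist _ (sval (cid start)) (svalP (cid start)))
  (fun n h => exist _ (sval (cid (step h))) (svalP (cid (step h))).1).
exists (fun n => sval (h n)) => n p m.
exact: (svalP (cid (step (h n)))).2.
Qed.
End Homotopy.

(** With chain maps [a], [b] between the resolutions and a homotopy [h] from 1 to a b, a cocycle s
    equals a(b s) - d(h s). If b s = d t, then s is the coboundary of a t - h s. *)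
Lemma sections_acyclic_transfer (F : omod X) (I J : inj_resolution F) (V : set X) p n :
  (forall s, sections_hom (rdiff I n.+1) V p s = 0 ->
    exists t, sections_hom (rdiff I n) V p t = s) ->
  forall s, sections_hom (rdiff J n.+1) V p s = 0 ->
    exists t, sections_hom (rdiff J n) V p t = s.
Proof.
move=> I_acyclic s ds.
have [a [a_aug ad]] := resolution_map I J; have [b [b_aug bd]] := resolution_map J I.
have [||h hE] := @resolution_homotopy _ J (fun n => omod_comp (a n) (b n)).
- by move=> q m; rewrite /= b_aug a_aug.
- by move=> m q x; rewrite /= bd ad.
have [|t tE] := I_acyclic (sections_hom (b n.+1) V p s).
  apply: sec_eq => x l v; rewrite !sections_homE -bd -sections_homE ds.
  by rewrite !sec0 linear0.
exists (sections_hom (a n) V p t - sections_hom (h n) V p s).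
apply: sec_eq => x l v.
rewrite sections_homE secB linearB (sections_homE (a n)) (sections_homE (h n)) -ad.
rewrite -(sections_homE (rdiff I n) _ l v) tE sections_homE.
have := hE n x (sec s l v); rewrite -(sections_homE (rdiff J n.+1)) ds sec0 linear0.
move/esym/eqP; rewrite subr_eq0 => /eqP <-.
by rewrite /= opprB addrC subrK.
Qed.
End Comparison.

(** * Extension by zero; injectives restrict to injectives and are flasque *)

Section ExtensionByZero.
Variables (k : comPzRingType) (X : ringed_finite_space k) (V : set X).
Hypothesis V_up : upclosed V.

Definition point_of x (v : V x) : restr_space V := SigSub (mem_set v).

Section Stalks.
Variable M : omod (restr_space V).

(** Functions on the proofs of [V x]: the stalk at x if x ∈ V, and 0 otherwise. *)
Definition extz_stalk (x : X) : lmodType (stalk x) :=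
  @family (stalk x) (V x) (fun v => @stalk k (restr_space V) (point_of v))
    (fun v => M (point_of v)) (fun v => idfun).

Definition extz_res x y (h : leU x y) (s : extz_stalk x) : extz_stalk y :=
  fun w => match pselect (V x) with
    | left v => mres M (leU_sub (p := point_of v) (q := point_of w) h) (s v)
    | right _ => 0
    end.

Lemma extz_resE x y (h : leU x y) (s : extz_stalk x) v w :
  extz_res h s w = mres M (leU_sub (p := point_of v) (q := point_of w) h) (s v).
Proof.
by rewrite /extz_res; case: pselect => // v'; rewrite (Prop_irrelevance v' v).
Qed.

Lemma extz_res0 x y (h : leU x y) (s : extz_stalk x) w : ~ V x -> extz_res h s w = 0.
Proof. by rewrite /extz_res; case: pselect. Qed.

Lemma extz_res_linear x y (h : leU x y) : linear_for (res h \; *:%R) (extz_res h).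
Proof.
move=> a s t; apply: fam_eq => w.
rewrite -[RHS]/((res h a : @stalk k (restr_space V) (point_of w)) *: extz_res h s w
  + extz_res h t w).
have [v|nv] := pselect (V x); last by rewrite !extz_res0 // scaler0 addr0.
rewrite !(extz_resE _ _ v) famP linearP /=; congr (_ *: _ + _).
congr (res _ a); exact: Prop_irrelevance.
Qed.

Lemma extz_res_id x (h : leU x x) s : extz_res h s = s.
Proof. by apply: fam_eq => v; rewrite (extz_resE _ _ v) mres_id. Qed.

Lemma extz_res_comp x y z (h : leU x y) (h' : leU y z) (h'' : leU x z) s :
  extz_res h' (extz_res h s) = extz_res h'' s.
Proof.
apply: fam_eq => w; have [v|nv] := pselect (V x).
  rewrite (extz_resE h' _ (V_up v h)) !(extz_resE _ _ v).
  exact: mres_comp.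
rewrite [RHS]extz_res0 //; have [u|nu] := pselect (V y).
  by rewrite (extz_resE _ _ u) extz_res0 // linear0.
by rewrite extz_res0.
Qed.

Definition extz : omod X :=
  @OMod k X extz_stalk (fun x y h => semilinear_pack (extz_res_linear h))
    extz_res_id extz_res_comp.

Section Adjunct.
Variables (I : omod X) (f : omod_hom M (restr_omod V I)).

Definition extz_fun x (s : extz_stalk x) : I x :=
  match pselect (V x) with
  | left v => f (point_of v) (s v)
  | right _ => 0
  end.

Lemma extz_funE x (s : extz_stalk x) (v : V x) : extz_fun s = f (point_of v) (s v).
Proof. by rewrite /extz_fun; case: pselect => // v'; rewrite (Prop_irrelevance v' v). Qed.

Lemma extz_fun0 x (s : extz_stalk x) : ~ V x -> extz_fun s = 0.
Proof. by rewrite /extz_fun; case: pselect. Qed.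

Lemma extz_fun_linear x : linear (@extz_fun x).
Proof.
move=> a s t; have [v|nv] := pselect (V x); last by rewrite !extz_fun0 // scaler0 addr0.
by rewrite !(extz_funE _ v) famP linearP.
Qed.

Lemma extz_fun_res x y (h : leU x y) (s : extz_stalk x) :
  extz_fun (extz_res h s) = mres I h (extz_fun s).
Proof.
have [v|nv] := pselect (V x); last first.
  rewrite [in RHS]extz_fun0 // linear0; have [w|nw] := pselect (V y).
    by rewrite (extz_funE _ w) extz_res0 // linear0.
  by rewrite extz_fun0.
rewrite (extz_funE _ (V_up v h)) (extz_funE _ v) (extz_resE _ _ v) ohom_res /=.
by congr (mres I _ _); exact: Prop_irrelevance.
Qed.

Definition extz_hom : omod_hom extz I :=
  @OModHom k X extz I (fun x => linear_pack (@extz_fun_linear x)) extz_fun_res.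

Lemma extz_homE x (s : extz x) (v : V x) : extz_hom x s = f (point_of v) (s v).
Proof. exact: extz_funE. Qed.

Lemma extz_hom_mono : omod_mono f -> omod_mono extz_hom.
Proof.
move=> fm x s t; have [v|nv] := pselect (V x); last first.
  by move=> _; apply: fam_eq => v; case: (nv v).
move=> e; apply: fam_eq => w; apply: fm; move: e.
by rewrite !(extz_homE _ w).
Qed.
End Adjunct.

(** The unit of the adjunction. [x] and [point_of v] are the same point with different membership
    proofs, so their stalks are identified by the restriction along x <= x. *)
Definition extz_germ (x : restr_space V) (m : M x) : extz (set_val x) :=
  fun v => mres M (leU_sub (p := x) (q := point_of v) (leU_refl (set_val x))) m.
End Stalks.

Lemma extz_map_subproof (M N : omod (restr_space V)) (i : omod_hom M N) x :
  linear (fun (s : extz M x) => (fun v => i (point_of v) (s v)) : extz N x).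
Proof. by move=> a s t; apply: fam_eq => v; rewrite famP linearP. Qed.

Definition extz_map (M N : omod (restr_space V)) (i : omod_hom M N) :
  omod_hom (extz M) (extz N).
Proof.
exists (fun x => linear_pack (@extz_map_subproof M N i x)).
move=> x y h s; apply: fam_eq => w /=; have [v|nv] := pselect (V x).
  by rewrite !(extz_resE _ _ v) ohom_res.
by rewrite !extz_res0 // linear0.
Defined.

(** Restriction to [V] has extension by zero as a left adjoint, and the latter preserves
    monomorphisms. *)
Lemma restr_injective (I : omod X) : omod_injective I -> omod_injective (restr_omod V I).
Proof.
move=> I_inj M N i f i_mono.
have i'_mono : omod_mono (extz_map i).
  move=> x s t e; apply: fam_eq => v; apply: i_mono.
  exact: (congr1 (fun s : extz N x => s v) e).
have [g gE] := I_inj _ _ (extz_map i) (extz_hom f) i'_mono.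
have g'_linear (x : restr_space V) : linear (fun n : N x => g (set_val x) (extz_germ n)).
  move=> a n n'; rewrite -linearP; congr (g _ _); apply: fam_eq => v.
  rewrite famP /extz_germ linearP /=; congr (_ *: _ + _).
  by rewrite res_id.
have g'_res (x y : restr_space V) (h : leU x y) (n : N x) :
    linear_pack (g'_linear y) (mres N h n) = mres (restr_omod V I) h (linear_pack (g'_linear x) n).
  rewrite /= -ohom_res; congr (g _ _); apply: fam_eq => v /=.
  have l : @leU (restr_space V) x (point_of v) :=
    leU_sub (p := x) (q := point_of v) (leU_val h).
  by rewrite (extz_resE _ _ (set_valP x)) /extz_germ !(mres_comp _ _ l).
exists (@OModHom k _ N (restr_omod V I) (fun x => linear_pack (g'_linear x)) g'_res) => x m /=.
have -> : extz_germ (i x m) = extz_map i _ (extz_germ m).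
  by apply: fam_eq => v; rewrite /extz_germ /= ohom_res.
rewrite gE (extz_homE _ _ (set_valP x)) /extz_germ ohom_res /=.
exact: mres_id.
Qed.

Section Extend.
Variables (I : omod X) (t : forall x, V x -> I x).
Hypothesis t_compat : forall x y (v : V x) (w : V y) (h : leU x y), mres I h (t v) = t w.

Let O := restr_omod V (structure_omod X).

Let scale_linear (x : restr_space V) :
  linear ((fun a => a *: t (set_valP x)) : O x -> restr_omod V I x).
Proof. by move=> a b c; rewrite scalerDl scalerA. Qed.

Let scale_res (x y : restr_space V) (h : leU x y) (a : O x) :
  linear_pack (@scale_linear y) (mres O h a) =
  mres (restr_omod V I) h (linear_pack (@scale_linear x) a).
Proof. by rewrite /= linearZ /= (t_compat _ (set_valP y)). Qed.

(** A compatible family over [V] is a morphism from the structure sheaf of [V] extended by zero.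
    This sheaf embeds into O, the morphism extends to O, and [T] is the image of 1. *)
Lemma injective_extend : omod_injective I ->
  exists T : forall x, I x, (forall x y (h : leU x y), mres I h (T x) = T y) /\
    forall x (v : V x), T x = t v.
Proof.
move=> I_inj; pose phi : omod_hom O (restr_omod V I) := OModHom scale_res.
have id_mono : omod_mono (omod_id O) by move=> x a b.
have [g gE] := I_inj _ _ (extz_hom (I := structure_omod X) (omod_id O)) (extz_hom phi)
  (extz_hom_mono id_mono).
exists (fun x => g x (1 : stalk x)); split=> [x y h|x v].
  rewrite -ohom_res; congr (g y _); exact: rmorph1.
pose e : extz O x := fun v => (1 : stalk x).
have := gE x e; rewrite !(extz_homE _ _ v) /= scale1r => ->.
exact: (congr1 (@t x) (Prop_irrelevance _ _)).
Qed.
End Extend.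
End ExtensionByZero.

(** The section over U_p ∩ W extends to the whole space and is then restricted. This gives the
    degreewise surjectivity used in Mayer-Vietoris. *)
Lemma sections_flasque (k : comPzRingType) (X : ringed_finite_space k) (I : omod X)
    (V W : set X) (WV : W `<=` V) p : upclosed W -> omod_injective I ->
  forall s, exists t, sections_restrict I WV p t = s.
Proof.
move=> W_up I_inj s; pose A : set X := fun x => leU p x /\ W x.
have A_up : upclosed A.
  by move=> x y [l w] h; split; [exact: leU_trans l h|exact: W_up h].
have s_compat x y (v : A x) (w : A y) (h : leU x y) :
  mres I h (sec s v.1 v.2) = sec s w.1 w.2 by exact: sec_compat.
have [T [TC TE]] := injective_extend A_up s_compat I_inj.
exists (make_sec (V := V) (F := fun x (_ : leU p x) (_ : V x) => T x)
  (fun x y _ _ _ _ h => TC x y h)).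
apply: sec_eq => x l w; rewrite (sections_restrictE _ _ _ _ (WV _ w)) make_secE.
by rewrite (TE x (conj l w)); congr sec; exact: Prop_irrelevance.
Qed.

Definition restr_hom (k : comPzRingType) (X : ringed_finite_space k) (V : set X)
    (M N : omod X) (f : omod_hom M N) : omod_hom (restr_omod V M) (restr_omod V N) :=
  @OModHom k (restr_space V) (restr_omod V M) (restr_omod V N)
    (fun p => f (set_val p)) (fun p q h => ohom_res f (leU_val h)).

Definition restr_resolution (k : comPzRingType) (X : ringed_finite_space k) (V : set X)
    (V_up : upclosed V) (F : omod X) (I : inj_resolution F) :
    inj_resolution (restr_omod V F) :=
  @InjResolution k (restr_space V) (restr_omod V F) (fun n => restr_omod V (I n))
    (fun n => restr_hom V (rdiff I n)) (restr_hom V (raug I))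
    (fun n => restr_injective V_up (@rterm_injective _ _ _ I n))
    (fun p => @raug_mono _ _ _ I (set_val p))
    (fun p => @raug_exact _ _ _ I (set_val p))
    (fun n p => @rdiff_exact _ _ _ I n (set_val p)).

(** * Stalks of direct images *)

Section CohomologyMap.
Variables (k : comPzRingType) (Y Z : ringed_finite_space k).
Variables (E : omod_complex Y) (E' : omod_complex Z).

Section Stalk.
Variables (y : Y) (z : Z) (i : {rmorphism @stalk k Y y -> @stalk k Z z}).
Variable al : forall n, {linear E n y -> E' n z | (i \; *:%R)}.
Hypothesis al_d : forall n m, al n.+1 (cdiff E n y m) = cdiff E' n z (al n m).

Lemma cocycle_map_subproof n (c : cocycle E n y) : cdiff E' n z (al n (cval c)) = 0.
Proof. by rewrite -al_d cvalP linear0. Qed.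

Definition cohomology_map n (c : cohomology E n y) : cohomology E' n z :=
  cohomology_pi (projT1 (cid (cocycleP
    (cocycle_map_subproof (projT1 (cid (cohomology_pi_surj c))))))).

Lemma is_coboundary_map n (m : E n y) : is_coboundary m -> is_coboundary (al n m).
Proof.
case: n m => [|n] m /=; first by move=> ->; rewrite linear0.
by move=> [m' <-]; exists (al n m'); rewrite al_d.
Qed.

Lemma cohomology_mapE n (c : cocycle E n y) (c' : cocycle E' n z) :
  cval c' = al n (cval c) -> cohomology_map (cohomology_pi c) = cohomology_pi c'.
Proof.
move=> e; rewrite /cohomology_map; case: cid => w /= wE; case: cid => w' /= w'E.
apply/eqP; rewrite -subr_eq0 -linearB; apply/eqP/cohomology_pi_eq0.
rewrite linearB /= w'E e -linearB; apply: is_coboundary_map.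
by rewrite -linearB; apply/cohomology_pi_eq0; rewrite linearB /= -wE subrr.
Qed.

Lemma cohomology_map_linear n : linear_for (i \; *:%R) (@cohomology_map n).
Proof.
move=> a c c'; have [x ->] := cohomology_pi_surj c; have [x' ->] := cohomology_pi_surj c'.
have [w wE] := cocycleP (cocycle_map_subproof x).
have [w' w'E] := cocycleP (cocycle_map_subproof x').
have e : cval (i a *: w + w') = al n (cval (a *: x + x')).
  by rewrite !linearP /= wE w'E.
by rewrite -linearP (cohomology_mapE wE) (cohomology_mapE w'E) (cohomology_mapE e) linearP.
Qed.
HB.instance Definition _ n := GRing.isLinear.Build (@stalk k Y y) (cohomology E n y)
  (cohomology E' n z) (i \; *:%R) (@cohomology_map n) (@cohomology_map_linear n).

Hypothesis al_inj : forall n m, al n m = 0 -> m = 0.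
Hypothesis al_surj : forall n m', exists m, al n m = m'.

Lemma is_coboundary_mapK n (m : E n y) : is_coboundary (al n m) -> is_coboundary m.
Proof.
case: n m => [|n] m /=; first exact: al_inj.
move=> [m' m'E]; have [m'' mE] := al_surj m'; exists m''.
apply/eqP; rewrite -subr_eq0; apply/eqP/al_inj.
by rewrite linearB /= al_d mE m'E subrr.
Qed.

Lemma cohomology_map_inj n (c : cohomology E n y) : cohomology_map c = 0 -> c = 0.
Proof.
have [x ->] := cohomology_pi_surj c; have [w wE] := cocycleP (cocycle_map_subproof x).
rewrite (cohomology_mapE wE) => /cohomology_pi_eq0; rewrite wE => /is_coboundary_mapK.
by move/cohomology_pi_eq0.
Qed.

Lemma cohomology_map_surj n (c' : cohomology E' n z) : exists c, @cohomology_map n c = c'.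
Proof.
have [w ->] := cohomology_pi_surj c'; have [m mE] := al_surj (cval w).
have [x xE] : exists x : cocycle E n y, cval x = m.
  by apply: cocycleP; apply: al_inj; rewrite al_d mE cvalP.
by exists (cohomology_pi x); apply: cohomology_mapE; rewrite xE mE.
Qed.
End Stalk.

Section BaseChange.
Variables (y y' : Y) (z z' : Z) (h : leU y y') (h' : leU z z').
Variables (i : {rmorphism @stalk k Y y -> @stalk k Z z}).
Variables (j : {rmorphism @stalk k Y y' -> @stalk k Z z'}).
Hypothesis ij : forall a, res h' (i a) = j (res h a).
Variable al : forall n, {linear E n y -> E' n z | (i \; *:%R)}.
Variable be : forall n, {linear E n y' -> E' n z' | (j \; *:%R)}.
Hypothesis al_d : forall n m, al n.+1 (cdiff E n y m) = cdiff E' n z (al n m).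
Hypothesis be_d : forall n m, be n.+1 (cdiff E n y' m) = cdiff E' n z' (be n m).
Hypothesis al_be : forall n m, mres (E' n) h' (al n m) = be n (mres (E n) h m).
Hypothesis al_inj : forall n m, al n m = 0 -> m = 0.
Hypothesis al_surj : forall n m', exists m, al n m = m'.
Hypothesis be_inj : forall n m, be n m = 0 -> m = 0.
Hypothesis be_surj : forall n m', exists m, be n m = m'.

Lemma cohomology_map_res n (c : cohomology E n y) :
  mres (cohomology E' n) h' (cohomology_map al_d c) =
  cohomology_map be_d (mres (cohomology E n) h c).
Proof.
have [x ->] := cohomology_pi_surj c; have [w wE] := cocycleP (cocycle_map_subproof al_d x).
rewrite (cohomology_mapE al_d wE) !cohomology_res_piE; apply/esym/cohomology_mapE.
by rewrite /= wE al_be.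
Qed.

(** Compares complexes on two spaces whose cochains agree as groups but are modules over different
    rings. The generation hypothesis is what surjectivity of [change_base] requires. *)
Lemma cohomology_base_change_extend n :
  (forall b', exists s : seq (@stalk k Y y' * @stalk k Z z),
     b' = \sum_(u <- s) j u.1 * res h' u.2) ->
  base_change (mres (cohomology E n) h) -> base_change (mres (cohomology E' n) h').
Proof.
move=> gen.
pose A : {linear cohomology E n y -> cohomology E' n z | (i \; *:%R)} :=
  @cohomology_map _ _ _ _ al_d n.
pose B : {linear cohomology E n y' -> cohomology E' n z' | (j \; *:%R)} :=
  @cohomology_map _ _ _ _ be_d n.
apply: (base_change_extend ij (al := A) (be := B)) => //.
- exact: cohomology_map_res.
- exact: (cohomology_map_surj al_d al_inj al_surj).
- exact: (cohomology_map_inj be_inj be_surj).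
- exact: (cohomology_map_surj be_d be_inj be_surj).
Qed.
End BaseChange.
End CohomologyMap.

(** When f^-1(U_y) = U_a ∩ V, the stalk at y of the direct image along f is
    the module of sections over U_a ∩ V. *)
Section PushSections.
Variables (k : comPzRingType) (X Y : ringed_finite_space k) (f : rfs_morphism X Y).
Variables (V : set X) (a : X) (y : Y) (i : {rmorphism stalk a -> @stalk k Y y}).
Hypothesis yV : forall x, leU y (f x) <-> leU a x /\ V x.
Hypothesis i_sharp : forall x (l : leU y (f x)) (l' : leU a x) b,
  rfs_sharp f x (res l (i b)) = res l' b.

Section Stalk.
Variable M : omod X.

Definition push_of_sections (s : sections M V a) : push_stalk f M y :=
  @PushStalk k X Y f M y (fun x l => sec s ((yV x).1 l).1 ((yV x).1 l).2)
    (fun x x' l l' h => sec_compat s _ _ _ _ h).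

Lemma push_of_sectionsE (s : sections M V a) x (l : leU y (f x)) (l' : leU a x) (v : V x) :
  push_of_sections s x l = sec s l' v.
Proof. by rewrite /=; congr sec; exact: Prop_irrelevance. Qed.

Lemma push_of_sections_linear : linear_for (i \; *:%R) push_of_sections.
Proof.
move=> b s t; apply: push_stalk_eq => x l; have [l' v] := (yV x).1 l.
rewrite -[RHS]/(rfs_sharp f x (res l (i b)) *: push_of_sections s x l + push_of_sections t x l).
by rewrite !(push_of_sectionsE _ l l' v) secP (i_sharp _ l').
Qed.

Lemma push_of_sections_inj s : push_of_sections s = 0 -> s = 0.
Proof.
move=> e; apply: sec_eq => x l v; have l' := (yV x).2 (conj l v).
by rewrite -(push_of_sectionsE s l') e sec0.
Qed.

Lemma push_of_sections_surj t : exists s, push_of_sections s = t.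
Proof.
have FC x x' (l : leU a x) (l' : leU a x') (v : V x) (v' : V x') (h : leU x x') :
  mres M h (t x ((yV x).2 (conj l v))) = t x' ((yV x').2 (conj l' v')) by exact: psec_compat.
exists (make_sec FC); apply: push_stalk_eq => x l; have [l' v] := (yV x).1 l.
by rewrite (push_of_sectionsE _ l l' v) make_secE; congr (t x _); exact: Prop_irrelevance.
Qed.
End Stalk.

Lemma push_of_sections_hom (M N : omod X) (g : omod_hom M N) s :
  push_of_sections (sections_hom g V a s) = push_hom f g y (push_of_sections s).
Proof.
apply: push_stalk_eq => x l; have [l' v] := (yV x).1 l.
rewrite -[RHS]/(g x (push_of_sections s x l)) !(push_of_sectionsE _ l l' v).
exact: sections_homE.
Qed.
End PushSections.

Section PushSectionsRes.
Variables (k : comPzRingType) (X Y : ringed_finite_space k) (f : rfs_morphism X Y).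
Variables (V : set X) (a a' : X) (y y' : Y) (h : leU a a') (h' : leU y y').
Hypothesis yV : forall x, leU y (f x) <-> leU a x /\ V x.
Hypothesis yV' : forall x, leU y' (f x) <-> leU a' x /\ V x.

Lemma push_of_sections_res (M : omod X) (s : sections M V a) :
  push_of_sections yV' (mres (sections_omod M V) h s) =
  mres (push_omod f M) h' (push_of_sections yV s).
Proof.
apply: push_stalk_eq => x l; have [l' v] := (yV' x).1 l.
rewrite (push_of_sectionsE _ _ l l' v) (sections_mresE _ _ _ (leU_trans h l')).
rewrite -[RHS]/(push_of_sections yV s x (leU_trans h' l)).
by rewrite (push_of_sectionsE _ _ _ (leU_trans h l') v).
Qed.
End PushSectionsRes.

(** * Restriction to an open subset *)

Lemma diag_sharp_atens (k : comPzRingType) (X : ringed_finite_space k) (y : prod_space X X)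
    (x : X) (l : leU y (diag X x)) b c :
  rfs_sharp (diag X) x (res l (atens (struct y.1) (struct y.2) b c)) =
  res (leU_fst l) b * res (leU_snd l) c.
Proof. by rewrite /= atensor_mapE atensor_liftE. Qed.

Section RestrictPush.
Variables (k : comPzRingType) (X : ringed_finite_space k) (V : set X).
Hypothesis V_up : upclosed V.
Local Notation U := (restr_space V).

Definition val2 (y : prod_space U U) : prod_space X X := (set_val y.1, set_val y.2).

Lemma leU_val2 (y y' : prod_space U U) : leU y y' -> leU (val2 y) (val2 y').
Proof.
by move=> h; apply: leU_prod; [exact: leU_val (leU_fst h)|exact: leU_val (leU_snd h)].
Qed.

Lemma leU_sub2 (y : prod_space U U) (x : X) (v : V x) :
  leU (val2 y) (diag X x) -> leU y (diag U (point_of v)).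
Proof.
move=> h; apply: leU_prod.
- exact: (leU_sub (p := y.1) (q := point_of v) (leU_fst h)).
- exact: (leU_sub (p := y.2) (q := point_of v) (leU_snd h)).
Qed.

Section Stalk.
Variables (M : omod X) (y : prod_space U U).

Definition restr_push (s : push_omod (diag X) M (val2 y)) :
    push_omod (diag U) (restr_omod V M) y :=
  @PushStalk k U (prod_space U U) (diag U) (restr_omod V M) y
    (fun x l => psec s (leU_val2 l : leU _ (diag X (set_val x))))
    (fun x x' l l' h => psec_compat s (leU_val2 l) (leU_val2 l') (leU_val h)).

(** The stalks of the two product spaces at [val2 y] and at [y] are convertible rings, so the ring
    map is the identity. *)
Lemma restr_push_linear : linear_for ((idfun : {rmorphism @stalk k (prod_space X X) (val2 y) ->
  @stalk k (prod_space U U) y}) \; *:%R) restr_push.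
Proof.
move=> a s t; apply: push_stalk_eq => x l.
pose l' : leU (val2 y) (diag X (set_val x)) := leU_val2 l.
suff e : rfs_sharp (diag X) (set_val x) (res l' a) = rfs_sharp (diag U) x (res l a).
  rewrite -[LHS]/(rfs_sharp (diag X) (set_val x) (res l' a) *: psec s l' + psec t l').
  by rewrite e.
elim/atens_ind: a => [|b c a IH].
  by rewrite (rmorph0 (res l)) (rmorph0 (res l')) !rmorph0.
rewrite (rmorphD (res l)) (rmorphD (res l')) !rmorphD IH; congr (_ + _).
have -> := diag_sharp_atens l b c; have -> := diag_sharp_atens l' b c.
by congr (res _ b * res _ c); exact: Prop_irrelevance.
Qed.

(** If [val2 y] lies below a diagonal point (x, x), then x is above a point of [V], hence in [V]:
    both families range over the same points. *)
Lemma restr_push_inj s : restr_push s = 0 -> s = 0.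
Proof.
move=> e; apply: push_stalk_eq => x l.
have v : V x by apply: V_up (leU_fst l); exact: set_valP.
have := congr1 (fun t : push_omod (diag U) (restr_omod V M) y => psec t (leU_sub2 v l)) e.
move=> /= <-; congr (psec s _); exact: Prop_irrelevance.
Qed.

Lemma restr_push_surj t : exists s, restr_push s = t.
Proof.
have Vx x (l : leU (val2 y) (diag X x)) : V x.
  by apply: V_up (leU_fst l); exact: set_valP.
have FC x x' (l : leU (val2 y) (diag X x)) (l' : leU (val2 y) (diag X x')) (h : leU x x') :
    mres M h (psec t (leU_sub2 (Vx x l) l)) = psec t (leU_sub2 (Vx x' l') l').
  have h' : leU (point_of (Vx x l)) (point_of (Vx x' l')).
    exact: (leU_sub (p := point_of (Vx x l)) (q := point_of (Vx x' l')) h).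
  rewrite -(psec_compat t (leU_sub2 (Vx x l) l) (leU_sub2 (Vx x' l') l') h').
  congr (mres M _ _); exact: Prop_irrelevance.
exists (@PushStalk k X (prod_space X X) (diag X) M (val2 y)
  (fun x l => psec t (leU_sub2 (Vx x l) l)) FC).
apply: push_stalk_eq => x l.
have v : V (set_val x) by exact: set_valP.
have h : @leU U (point_of v) x.
  exact: (leU_sub (p := point_of v) (q := x) (leU_refl (set_val x))).
rewrite -(psec_compat t (leU_sub2 v (leU_val2 l)) l h).
rewrite [RHS](mres_id (leU_val h)) /=.
by rewrite (Prop_irrelevance (Vx _ _) v).
Qed.
End Stalk.
End RestrictPush.

(** Quasi-coherence is turned into base change and back, which spares the restriction of local
    presentations to [V]. *)
Lemma restr_schematic (k : comPzRingType) (X : ringed_finite_space k) (V : set X) :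
  upclosed V -> schematic X -> schematic (restr_space V).
Proof.
move=> V_up [flatX qcX]; split=> [p q h|n]; first exact: flatX.
have [I qcI] := qcX n.
exists (restr_resolution V_up I : inj_resolution (structure_omod (restr_space V))).
apply: base_change_quasi_coherent => y y' h.
have h' := leU_val2 h.
apply: (@cohomology_base_change_extend k (prod_space X X)
  (prod_space (restr_space V) (restr_space V))
  (push_resolution (diag X) I) (push_resolution (diag (restr_space V)) (restr_resolution V_up I))
  (val2 y) (val2 y') y y' h' h idfun idfun _
  (fun n => semilinear_pack (@restr_push_linear k X V (I n) y))
  (fun n => semilinear_pack (@restr_push_linear k X V (I n) y'))).
- elim/atens_ind => [|b c a IH]; first by rewrite !rmorph0.
  rewrite (rmorphD (res h)) (rmorphD (res h')) /= in IH *; rewrite IH !atensor_mapE.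
  by congr (atens _ _ (res _ b) (res _ c) + _); exact: Prop_irrelevance.
- by move=> m s; apply: push_stalk_eq.
- by move=> m s; apply: push_stalk_eq.
- move=> m s; apply: push_stalk_eq => x l /=; congr (psec s _); exact: Prop_irrelevance.
- by move=> m s; exact: restr_push_inj.
- by move=> m s; exact: restr_push_surj.
- by move=> m s; exact: restr_push_inj.
- by move=> m s; exact: restr_push_surj.
- by move=> b; exists [:: (b, 1)]; rewrite big_seq1 rmorph1 mulr1.
- exact: quasi_coherent_base_change.
Qed.

(** * Mayer-Vietoris induction *)

Lemma tmap_comm (R : comPzRingType) (F M N N' P : lmodType R) (f : {linear M -> N})
    (g : {linear N -> P}) (f' : {linear M -> N'}) (g' : {linear N' -> P}) :
  (forall m, g (f m) = g' (f' m)) ->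
  forall t : tensor M F, tmap g (tmap f t) = tmap g' (tmap f' t).
Proof.
move=> e; elim/tensor_ind => [|x y IHx IHy|m b]; first by rewrite !raddf0.
  by rewrite !raddfD /= IHx IHy.
by rewrite !tmapE e.
Qed.

Lemma tmap_comp0 (R : comPzRingType) (F M N P : lmodType R) (f : {linear M -> N})
    (g : {linear N -> P}) :
  (forall m, g (f m) = 0) -> forall t : tensor M F, tmap g (tmap f t) = 0.
Proof.
move=> e; elim/tensor_ind => [|x y IHx IHy|m b]; first by rewrite !raddf0.
  by rewrite !raddfD /= IHx IHy addr0.
by rewrite !tmapE e tens0l.
Qed.

Lemma count_proper (T : eqType) (a b : pred T) (s : seq T) z :
  subpred a b -> z \in s -> b z -> ~~ a z -> (count a s < count b s)%N.
Proof.
move=> ab; elim: s => // x s IH; rewrite inE => /orP[/eqP <- bz naz|zs bz naz] /=.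
  by rewrite bz (negPf naz) add0n add1n ltnS sub_count.
rewrite -addnS leq_add ?IH //; case ax : (a x) => //.
by rewrite (ab x ax).
Qed.

Section FiniteInduction.
Variables (k : comPzRingType) (X : ringed_finite_space k).

(** The specialization order is only a preorder, so a minimal x may have equivalent points in V.
    Removing all y <= x rather than x alone keeps [W] up-closed. Both [W] and U_x ∩ W miss x, so
    they are smaller. *)
Lemma upclosed_ind (P : set X -> Prop) (p : X) :
  P set0 -> (forall x, leU p x -> P (min_open x)) ->
  (forall x W, leU p x -> upclosed W -> P (min_open x) -> P W -> P (min_open x `&` W) ->
    P (min_open x `|` W)) ->
  forall V, upclosed V -> V `<=` min_open p -> P V.
Proof.
move=> P0 Pmin PU; have /finite_seqP[s es] := space_finite X.
have ins x : x \in s by have : [set: X] x by []; rewrite es.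
pose c (V : set X) := count (fun x => `[< V x >]) s.
have c_lt (V W : set X) z : V `<=` W -> W z -> ~ V z -> (c V < c W)%N.
  move=> VW Wz nVz; apply: (count_proper (z := z)) => //; last exact/asboolPn.
    by move=> x /asboolP/VW Wx; apply/asboolP.
  exact/asboolP.
move=> V; have [n] := ubnP (c V); elim: n V => // n IH V; rewrite ltnS => cV V_up Vp.
have [[x0 Vx0]|V0] := pselect (exists x, V x); last first.
  suff -> : V = set0 by [].
  by apply/seteqP; split=> // x Vx; case: V0; exists x.
(* A point whose minimal open set counts most points is minimal in V, since a strictly smaller point
   would have a larger minimal open set. *)
have exm : exists m, `[< exists x, V x /\ c (min_open x) = m >].
  by exists (c (min_open x0)); apply/asboolP; exists x0.
have bound m : `[< exists x, V x /\ c (min_open x) = m >] -> (m <= size s)%N.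
  by move=> /asboolP[x [_ <-]]; exact: count_size.
case: (ex_maxnP exm bound) => m /asboolP[x [Vx <-]] x_max {exm bound m}.
have x_min y : V y -> leU y x -> leU x y.
  move=> Vy yx; apply: contrapT => nxy.
  have := x_max (c (min_open y)); rewrite leqNgt (c_lt _ _ y) //.
  - by move/(_ (introT (asboolP _) (ex_intro _ y (conj Vy erefl)))).
  - by move=> z; exact: leU_trans yx.
  - exact: leU_refl.
pose W : set X := fun y => V y /\ ~ leU y x.
have W_up : upclosed W.
  move=> y z [Vy nyx] yz; split; first exact: V_up yz.
  by move=> zx; apply: nyx; exact: leU_trans yz zx.
have -> : V = min_open x `|` W.
  apply/seteqP; split=> [y Vy|y [xy|[]]] //; last exact: V_up xy.
  by have [yx|nyx] := pselect (leU y x); [left; exact: x_min|right].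
have WV : W `<=` V by move=> y [].
have nWx : ~ W x by move=> [_]; apply; exact: leU_refl.
apply: PU => //; first exact: Vp; first by apply: Pmin; exact: Vp.
  apply: IH => //; last exact: (subset_trans WV).
  exact: leq_trans (c_lt _ _ x WV Vx nWx) cV.
apply: IH.
- apply: leq_trans cV; apply: (c_lt _ _ x) => //; first by move=> y [_ /WV].
  by move=> [_ /nWx].
- by move=> y z [xy Wy] yz; split; [exact: leU_trans xy yz|exact: W_up yz].
- by move=> y [_ /WV /Vp].
Qed.
End FiniteInduction.

(** * The quasi-isomorphism from J(V) ⊗ O_p' to J(V ∩ U_p') *)

Section QuasiIsomorphism.
Variables (k : comPzRingType) (X : ringed_finite_space k) (F : omod X) (J : inj_resolution F).
Variables (p p' : X) (h : leU p p').
Hypothesis flat_h : flat_morphism (res h).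
Hypothesis sections_bc :
  forall x, leU p x -> base_change (mres (sections_omod F (min_open x)) h).
Hypothesis sections_acyclic : forall x, leU p x -> forall n s,
  sections_hom (rdiff J n.+1) (min_open x) p' s = 0 ->
  exists t, sections_hom (rdiff J n) (min_open x) p' t = s.
Local Notation B := (restr_scalars (res h) (stalk p')^o).
Local Notation E V := (sections_complex J V).
Local Notation S := (sections_hom).

Let flatB : flat_module B. Proof. by []. Qed.

(** The two sides are exact for different reasons. U_p ∩ U_x = U_x has a least point, so its
    sections are germs and flatness preserves exactness; U_p' ∩ U_x need not have one, and there the
    assumed acyclicity enters. *)
Lemma qiso_min_open x : leU p x -> base_change_qiso (E (min_open x)) h.
Proof.
move=> px; have xx : min_open x x by exact: leU_refl.
apply: (cone_acyclic_resolution (K := fun n => tensor (E (min_open x) n p) B)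
  (L := fun n => E (min_open x) n p')
  (KA := tensor (sections_omod F (min_open x) p) B) (LA := sections_omod F (min_open x) p')
  (d := fun n => tmap (S (rdiff J n) (min_open x) p))
  (e := fun n => S (rdiff J n) (min_open x) p')
  (phi := fun n => extend_scalars (mres (sections_omod (J n) (min_open x)) h))
  (i := tmap (S (raug J) (min_open x) p)) (j := S (raug J) (min_open x) p')
  (psi := extend_scalars (mres (sections_omod F (min_open x)) h))).
- by move=> n t; apply: extend_scalars_tmap => s; rewrite ohom_res.
- apply: tmap_comp0 => s; apply: sec_eq => y l v.
  by rewrite !sections_homE raugK sec0.
- by move=> t; apply: extend_scalars_tmap => s; rewrite ohom_res.
- apply: (tmap_exact flatB) => s; apply: (sections_germ_exact px xx) => //.
  exact: raug_exact.
- move=> n; apply: (tmap_exact flatB) => s; apply: (sections_germ_exact px xx) => //.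
  exact: rdiff_exact.
- by move=> s; apply: sections_mono; exact: raug_mono.
- by move=> s; apply: sections_left_exact; [exact: raug_mono|exact: raug_exact].
- by move=> n s; exact: sections_acyclic.
- exact: (sections_bc px).2.
- exact: (sections_bc px).1.
Qed.

(** The gluing of sections presents J(V ∪ W) as a pullback, flatness keeps it one after tensoring,
    and the injective terms being flasque gives the required surjectivity. *)
Lemma qiso_union V W : upclosed V -> upclosed W -> base_change_qiso (E V) h ->
  base_change_qiso (E W) h -> base_change_qiso (E (V `&` W)) h ->
  base_change_qiso (E (V `|` W)) h.
Proof.
move=> V_up W_up.
pose V1 := @subsetUl _ V W; pose V2 := @subsetUr _ V W.
pose I1 := @subIsetl _ V W; pose I2 := @subIsetr _ V W.
have VW_up : upclosed (V `&` W).
  by move=> x y [v w] xy; split; [exact: V_up xy|exact: W_up xy].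
pose R (A C : set X) (CA : C `<=` A) n q := sections_restrict (J n) CA q.
have rr n q s : R _ _ I1 n q (R _ _ V1 n q s) = R _ _ I2 n q (R _ _ V2 n q s).
  apply: sec_eq => x l [v w].
  rewrite (sections_restrictE _ _ _ _ v) (sections_restrictE _ _ _ _ (or_introl v)).
  rewrite (sections_restrictE _ _ _ _ w) (sections_restrictE _ _ _ _ (or_intror w)).
  by congr sec; exact: Prop_irrelevance.
have R_surj n q s : exists t, R _ _ I2 n q t = s.
  by apply: sections_flasque => //; exact: rterm_injective.
have R_inj n q s : R _ _ V1 n q s = 0 -> R _ _ V2 n q s = 0 -> s = 0.
  exact: sections_union_inj.
have R_glue n q s t : R _ _ I1 n q s = R _ _ I2 n q t ->
    exists z, R _ _ V1 n q z = s /\ R _ _ V2 n q z = t.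
  by move=> e; apply: sections_union_glue.
pose tm A C (CA : C `<=` A) n : {additive tensor (E A n p) B -> tensor (E C n p) B} :=
  tmap (R A C CA n p).
pose rm A C (CA : C `<=` A) n : {additive E A n p' -> E C n p'} := R A C CA n p'.
apply: (cone_acyclic_pullback (K := fun n => tensor (E (V `|` W) n p) B)
  (K1 := fun n => tensor (E V n p) B) (K2 := fun n => tensor (E W n p) B)
  (K3 := fun n => tensor (E (V `&` W) n p) B)
  (L := fun n => E (V `|` W) n p') (L1 := fun n => E V n p') (L2 := fun n => E W n p')
  (L3 := fun n => E (V `&` W) n p')
  (d := fun n => tmap (S (rdiff J n) (V `|` W) p)) (d1 := fun n => tmap (S (rdiff J n) V p))
  (d2 := fun n => tmap (S (rdiff J n) W p)) (d3 := fun n => tmap (S (rdiff J n) (V `&` W) p))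
  (e := fun n => S (rdiff J n) (V `|` W) p') (e1 := fun n => S (rdiff J n) V p')
  (e2 := fun n => S (rdiff J n) W p') (e3 := fun n => S (rdiff J n) (V `&` W) p')
  (phi := fun n => extend_scalars (mres (sections_omod (J n) (V `|` W)) h))
  (phi1 := fun n => extend_scalars (mres (sections_omod (J n) V) h))
  (phi2 := fun n => extend_scalars (mres (sections_omod (J n) W) h))
  (phi3 := fun n => extend_scalars (mres (sections_omod (J n) (V `&` W)) h))
  (a1 := tm _ _ V1) (a2 := tm _ _ V2) (b1 := tm _ _ I1) (b2 := tm _ _ I2)
  (u1 := rm _ _ V1) (u2 := rm _ _ V2) (v1 := rm _ _ I1) (v2 := rm _ _ I2)).
- by move=> n; apply: tmap_comp0; exact: sections_diffK.
- by move=> n; exact: sections_diffK.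
- by move=> n t; apply: extend_scalars_tmap => s; rewrite ohom_res.
- by move=> n; apply: tmap_comm => s; exact: sections_restrict_hom.
- by move=> n; apply: tmap_comm => s; exact: sections_restrict_hom.
- by move=> n; apply: tmap_comm => s; exact: sections_restrict_hom.
- by move=> n; apply: tmap_comm => s; exact: sections_restrict_hom.
- by move=> n s; exact: sections_restrict_hom.
- by move=> n s; exact: sections_restrict_hom.
- by move=> n s; exact: sections_restrict_hom.
- by move=> n s; exact: sections_restrict_hom.
- by move=> n t; apply/esym/extend_scalars_tmap => s; exact: esym (ohom_res _ _ _).
- by move=> n t; apply/esym/extend_scalars_tmap => s; exact: esym (ohom_res _ _ _).
- by move=> n t; apply/esym/extend_scalars_tmap => s; exact: esym (ohom_res _ _ _).
- by move=> n t; apply/esym/extend_scalars_tmap => s; exact: esym (ohom_res _ _ _).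
- by move=> n; apply: tmap_comm; exact: rr.
- by move=> n s; exact: rr.
- by move=> n; apply: (tmap_pullback_inj flatB) => s; exact: R_inj.
- by move=> n s; exact: R_inj.
- move=> n; apply: (tmap_pullback_glue flatB) => [s|s t|s].
  + exact: rr.
  + exact: R_glue.
  + exact: R_surj.
- by move=> n s t; exact: R_glue.
- by move=> n; apply: tmap_surj => s; exact: R_surj.
- by move=> n s; exact: R_surj.
Qed.

Lemma base_change_qiso_upclosed V :
  upclosed V -> V `<=` min_open p -> base_change_qiso (E V) h.
Proof.
apply: (upclosed_ind (P := fun V => base_change_qiso (E V) h)).
- have E0 n q (s : E set0 n q) : s = 0 by apply: sec_eq.
  have T0 n (t : tensor (E set0 n p) B) : t = 0.
    elim/tensor_ind: t => [//|x y -> ->|m b]; first by rewrite addr0.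
    by rewrite (E0 _ _ m) tens0l.
  split=> [t _ _|t l _ _|n t l _ _]; first exact: T0.
    by exists 0; rewrite !raddf0 (T0 _ t) (E0 _ _ l).
  by exists 0, 0; rewrite !raddf0 (T0 _ t) (E0 _ _ l) addr0.
- by move=> x px; exact: qiso_min_open.
- by move=> x W px W_up Qx QW QxW; apply: qiso_union => //; exact: upclosed_min_open.
Qed.
End QuasiIsomorphism.

(** * From the open sets U_p to X *)

Section RestrictSections.
Variables (k : comPzRingType) (X : ringed_finite_space k) (V : set X).
Hypothesis V_up : upclosed V.
Local Notation U := (restr_space V).
Variables (W : set X) (W' : set U).
Hypothesis WW : forall y : U, W' y <-> W (set_val y).
Variable y : U.

(** [W'] is tied to [W] by a pointwise equivalence so that the minimal open sets computed in [U] and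
    in [X] can be matched. *)
Definition restr_sections (M : omod X) (s : sections M W (set_val y)) :
    sections (restr_omod V M) W' y :=
  @make_sec k U (restr_omod V M) W' y
    (fun z (l : leU y z) (w : W' z) => sec s (leU_val l) ((WW z).1 w))
    (fun z z' l l' w w' h => sec_compat s (leU_val l) (leU_val l') _ _ (leU_val h)).

Lemma restr_sectionsE (M : omod X) (s : sections M W (set_val y)) z (l : leU y z) (w' : W' z)
  (l' : leU (set_val y) (set_val z)) (w : W (set_val z)) :
  sec (restr_sections s) l w' = sec s l' w.
Proof.
rewrite make_secE (Prop_irrelevance l' (leU_val l)).
by rewrite (Prop_irrelevance w ((WW z).1 w')).
Qed.

Lemma restr_sections_linear (M : omod X) : linear (@restr_sections M).
Proof.
move=> a s t; apply: sec_eq => z l w'.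
have l' := leU_val l; have w := (WW z).1 w'.
rewrite secP !(restr_sectionsE _ _ _ l' w) secP; congr (_ *: _ + _).
by congr (res _ a); exact: Prop_irrelevance.
Qed.
HB.instance Definition _ (M : omod X) := GRing.isLinear.Build (stalk (set_val y))
  (sections M W (set_val y)) (sections (restr_omod V M) W' y) *:%R
  (@restr_sections M) (@restr_sections_linear M).

Lemma restr_sections_hom (M N : omod X) (g : omod_hom M N) s :
  restr_sections (sections_hom g W (set_val y) s) =
  sections_hom (restr_hom V g) W' y (restr_sections s).
Proof.
apply: sec_eq => z l w'; have l' := leU_val l; have w := (WW z).1 w'.
rewrite sections_homE !(restr_sectionsE _ _ _ l' w); exact: (sections_homE g s l' w).
Qed.

Lemma restr_sections_inj (M : omod X) (s : sections M W (set_val y)) :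
  restr_sections s = 0 -> s = 0.
Proof.
move=> e; apply: sec_eq => x l w.
have v : V x by apply: V_up l; exact: set_valP.
have l' : leU y (point_of v) by exact: (leU_sub (p := y) (q := point_of v) l).
have w' : W' (point_of v) by apply/WW.
by rewrite -(restr_sectionsE s l' w' l w) e !sec0.
Qed.

Lemma restr_sections_surj (M : omod X) t :
  exists s : sections M W (set_val y), restr_sections s = t.
Proof.
have Vx x (l : leU (set_val y) x) : V x by apply: V_up l; exact: set_valP.
have lx x (l : leU (set_val y) x) : leU y (point_of (Vx x l)).
  exact: (leU_sub (p := y) (q := point_of (Vx x l)) l).
have wx x (l : leU (set_val y) x) (w : W x) : W' (point_of (Vx x l)) by apply/WW.
have FC x x' (l : leU (set_val y) x) (l' : leU (set_val y) x') (w : W x) (w' : W x')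
    (h : leU x x') : mres M h (sec t (lx x l) (wx x l w)) = sec t (lx x' l') (wx x' l' w').
  have h' : leU (point_of (Vx x l)) (point_of (Vx x' l')).
    exact: (leU_sub (p := point_of (Vx x l)) (q := point_of (Vx x' l')) h).
  rewrite -(sec_compat t (lx x l) (lx x' l') (wx x l w) (wx x' l' w') h').
  congr (mres M _ _); exact: Prop_irrelevance.
exists (make_sec (V := W) (F := fun x l w => sec t (lx x l) (wx x l w)) FC).
apply: sec_eq => z l w'; have l' := leU_val l; have w := (WW z).1 w'.
rewrite (restr_sectionsE _ _ _ l' w) make_secE.
have h : @leU U (point_of (Vx _ l')) z.
  exact: (leU_sub (p := point_of (Vx _ l')) (q := z) (leU_refl (set_val z))).
rewrite -(sec_compat t (lx _ l') l (wx _ l' w) w' h).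
by rewrite [RHS](mres_id (leU_val h)).
Qed.
End RestrictSections.

Lemma restr_sections_res (k : comPzRingType) (X : ringed_finite_space k) (V W : set X)
    (W' : set (restr_space V)) (WW : forall y : restr_space V, W' y <-> W (set_val y))
    (y z : restr_space V) (h : leU y z) (h' : leU (set_val y) (set_val z)) (M : omod X)
    (s : sections M W (set_val y)) :
  restr_sections WW (mres (sections_omod M W) h' s) =
  mres (sections_omod (restr_omod V M) W') h (restr_sections WW s).
Proof.
apply: sec_eq => u l w'; have l' := leU_val l; have w := (WW u).1 w'.
rewrite (restr_sectionsE _ _ _ _ l' w) (sections_mresE _ _ _ (leU_trans h' l')).
by rewrite (sections_mresE _ _ _ (leU_trans h l)) (restr_sectionsE _ _ _ _ (leU_trans h' l') w).
Qed.

Section DiagonalStalks.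
Variables (k : comPzRingType) (X : ringed_finite_space k).

Lemma leU_diag (y : prod_space X X) (x : X) : leU y (diag X x) <-> leU y.1 x /\ leU y.2 x.
Proof.
split=> [l|[l1 l2]]; first by split; [exact: leU_fst l|exact: leU_snd l].
exact: leU_prod.
Qed.

Lemma diag_sharp_inl (y : prod_space X X) x (l : leU y (diag X x)) (l' : leU y.1 x) b :
  rfs_sharp (diag X) x (res l (atensor_inl (struct y.1) (struct y.2) b)) = res l' b.
Proof.
have -> := diag_sharp_atens l b 1; rewrite rmorph1 mulr1.
by congr (res _ b); exact: Prop_irrelevance.
Qed.

Lemma diag_sharp_inr (y : prod_space X X) x (l : leU y (diag X x)) (l' : leU y.2 x) b :
  rfs_sharp (diag X) x (res l (atensor_inr (struct y.1) (struct y.2) b)) = res l' b.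
Proof.
have -> := diag_sharp_atens l 1 b; rewrite rmorph1 mul1r.
by congr (res _ b); exact: Prop_irrelevance.
Qed.
End DiagonalStalks.

(** * Consequences on X of U_p being schematic *)

Section Local.
Variables (k : comPzRingType) (X : ringed_finite_space k) (p : X).
Local Notation U := (restr_space (min_open p)).
Hypothesis U_schematic : schematic U.
Variables (p' x : X) (h : leU p p') (px : leU p x).

Let P : U := point_of (leU_refl p).
Let P' : U := point_of h.
Let x' : U := point_of px.
Let Px : prod_space U U := (P, x').
Let P'x : prod_space U U := (P', x').

Let hU : @leU U P P'. Proof. exact: (leU_sub (p := P) (q := P') h). Qed.

Let hUx : leU Px P'x. Proof. exact: (@leU_prod U U Px P'x hU (leU_refl x')). Qed.

Let yV (y : U) z : leU ((y, x') : prod_space U U) (diag U z) <-> leU y z /\ min_open x' z.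
Proof. exact: leU_diag. Qed.

Let WW (y : U) : min_open x' y <-> min_open x (set_val y).
Proof. by split=> [|l]; [exact: leU_val|exact: (leU_sub (p := x') (q := y) l)]. Qed.

(** The stalk at (p, x) is the cohomology of U_p ∩ U_x = U_x, which has the least point x. *)
Let germ_acyclic n (I : inj_resolution (structure_omod U))
    (c : cohomology (push_resolution (diag U) I) n.+1 Px) : c = 0.
Proof.
have [z ->] := cohomology_pi_surj c; apply/cohomology_pi_eq0.
have [s sE] := push_of_sections_surj (yV P) (cval z).
have Px' : leU P x' by exact: (leU_sub (p := P) (q := x') px).
have ds : sections_hom (rdiff I n.+1) (min_open x') P s = 0.
  apply: (push_of_sections_inj (yV := yV P)); rewrite push_of_sections_hom sE.
  exact: (cvalP z).
have [|t tE] := sections_germ_exact Px' (leU_refl x') _ (@rdiff_exact _ _ _ I n) ds.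
  by [].
exists (push_of_sections (yV P) t); rewrite -sE -tE.
by rewrite push_of_sections_hom.
Qed.

(** By base change the stalk at (p', x) is generated by the image of the one at (p, x), which is
    zero in positive degrees. *)
Lemma local_sections_acyclic (J : inj_resolution (structure_omod X)) n s :
  sections_hom (rdiff J n.+1) (min_open x) p' s = 0 ->
  exists t, sections_hom (rdiff J n) (min_open x) p' t = s.
Proof.
move=> ds; have [_ /(_ n.+1)[I qcI]] := U_schematic.
have p_up := @upclosed_min_open X p.
pose J' : inj_resolution (structure_omod U) := restr_resolution p_up J.
pose al n := semilinear_pack (push_of_sections_linear (M := I n) (yV P') (@diag_sharp_inl k U P'x)).
have I_acyclic u : sections_hom (rdiff I n.+1) (min_open x') P' u = 0 ->
    exists t, sections_hom (rdiff I n) (min_open x') P' t = u.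
  move=> du.
  have dpu : cdiff (push_resolution (diag U) I) n.+1 P'x (push_of_sections (yV P') u) = 0.
    by rewrite -[LHS]/(push_hom _ _ _ _) -push_of_sections_hom du; exact: push_stalk_eq.
  have [z zE] := cocycleP dpu.
  have : cohomology_pi z = 0.
    have [t <-] := (quasi_coherent_base_change hUx qcI).1 (cohomology_pi z).
    elim/tensor_ind: t => [|a b IHa IHb|c b]; first by rewrite raddf0.
      by rewrite raddfD /= IHa IHb addr0.
    by rewrite extend_scalarsE (germ_acyclic c) linear0 scaler0.
  move=> /cohomology_pi_eq0[m mE].
  have [t tE] := push_of_sections_surj (yV P') m; exists t.
  apply/eqP; rewrite -subr_eq0; apply/eqP/(push_of_sections_inj (yV := yV P')).
  rewrite -[LHS]/(al n.+1 _) linearB; apply/eqP; rewrite subr_eq0; apply/eqP.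
  by rewrite /= push_of_sections_hom tE mE zE.
(* Passage from the resolution [I] provided by the hypothesis on [U] to the restriction of [J]. *)
have [|t tE] := sections_acyclic_transfer (J := J') I_acyclic (s := restr_sections WW (y := P') s).
  rewrite -[rdiff J' n.+1]/(restr_hom _ (rdiff J n.+1)) -restr_sections_hom ds; exact: linear0.
have [t' t'E] := restr_sections_surj p_up WW t; exists t'.
apply/eqP; rewrite -subr_eq0; apply/eqP/(restr_sections_inj p_up (WW := WW) (y := P')).
by rewrite linearB /= restr_sections_hom t'E -tE subrr.
Qed.

Section ZerothCohomology.
Variable I : inj_resolution (structure_omod U).
Local Notation O := (structure_omod X).

Let aug (y : U) (s : sections O (min_open x) (set_val y)) :
    push_omod (diag U) (I 0) ((y, x') : prod_space U U) :=
  push_of_sections (yV y) (sections_hom (raug I) (min_open x') y (restr_sections WW s)).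

Let aug_linear (y : U) :
  linear_for (@atensor_inl _ _ _ (struct (set_val y)) (struct x) \; *:%R) (@aug y).
Proof.
move=> a s t; rewrite /aug (linearP (@restr_sections _ _ _ _ _ WW y O)).
rewrite (linearP (sections_hom (raug I) (min_open x') y)).
exact: (push_of_sections_linear (yV y) (@diag_sharp_inl k U (y, x'))).
Qed.

Let aug_cocycle y s : cdiff (push_resolution (diag U) I) 0 (y, x') (@aug y s) = 0.
Proof.
rewrite -[LHS]/(push_hom _ _ _ _) -push_of_sections_hom.
rewrite (_ : sections_hom _ _ _ _ = 0); first exact: push_stalk_eq.
by apply: sec_eq => z l v; rewrite !sections_homE raugK sec0.
Qed.

Let augc y s : cocycle (push_resolution (diag U) I) 0 (y, x') :=
  projT1 (cid (cocycleP (@aug_cocycle y s))).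

Let augcE y s : cval (@augc y s) = aug s.
Proof. exact: projT2 (cid (cocycleP (@aug_cocycle y s))). Qed.

(** The identification of O(U_y ∩ U_x) with the stalk of δ_* O at (y, x), computed as the degree 0
    cohomology of the resolution. *)
Let al (y : U) s : cohomology (push_resolution (diag U) I) 0 (y, x') :=
  cohomology_pi (@augc y s).

Let al_linear (y : U) :
  linear_for (@atensor_inl _ _ _ (struct (set_val y)) (struct x) \; *:%R) (@al y).
Proof.
move=> a s t; rewrite /al -[RHS](linearP (@cohomology_pi _ _ _ _ _)); congr cohomology_pi.
apply: val_inj; rewrite -[LHS]/(cval _) augcE aug_linear -!augcE.
by rewrite [RHS](linearP (@cval _ _ _ _ _)).
Qed.

Let al_inj y s : @al y s = 0 -> s = 0.
Proof.
move=> /cohomology_pi_eq0 /=; rewrite augcE => /push_of_sections_inj.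
move=> /(sections_mono (@raug_mono _ _ _ I)).
move=> e; exact: (@restr_sections_inj _ _ _ (@upclosed_min_open X p) _ _ WW y O s e).
Qed.

Let al_surj y c : exists s, @al y s = c.
Proof.
have [z ->] := cohomology_pi_surj c.
have [t tE] := push_of_sections_surj (yV y) (cval z).
have dt : sections_hom (rdiff I 0) (min_open x') y t = 0.
  apply: (push_of_sections_inj (yV := yV y)); rewrite push_of_sections_hom tE.
  exact: (cvalP z).
have [u uE] := sections_left_exact (@raug_mono _ _ _ I) (@raug_exact _ _ _ I) dt.
have [s sE] := restr_sections_surj (@upclosed_min_open X p) WW (M := O) u.
exists s; congr cohomology_pi; apply: val_inj.
by rewrite -[LHS]/(cval _) augcE /aug sE uE.
Qed.

Let al_res s : mres (cohomology (push_resolution (diag U) I) 0) hUx (@al P s) =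
  @al P' (mres (sections_omod O (min_open x)) h s).
Proof.
rewrite /al cohomology_res_piE; congr cohomology_pi; apply: val_inj.
rewrite -[LHS]/(mres (push_omod (diag U) (I 0)) hUx (cval (augc s))) -[RHS]/(cval _) !augcE.
rewrite /aug (restr_sections_res WW hU) ohom_res.
by rewrite (push_of_sections_res hU hUx (yV P) (yV P')).
Qed.

(** The case A = O_p, B = O_p', C = O_x of [base_change_tensor]: base change of the stalks from (p,
    x) to (p', x) becomes base change over O_p. *)
Lemma zeroth_base_change :
  base_change (mres (cohomology (push_resolution (diag U) I) 0) hUx) ->
  base_change (mres (sections_omod O (min_open x)) h).
Proof.
have f'E (a : stalk p) (c : stalk x) : (res hUx : {rmorphism _ -> _})
    (atens (struct p) (struct x) a c) = atens (struct p') (struct x) (res h a) c.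
  rewrite /= atensor_mapE res_id; congr (atens _ _ (res _ a) c); exact: Prop_irrelevance.
apply: (base_change_tensor (res_struct h) f'E (al := semilinear_pack (al_linear (y := P)))
  (be := semilinear_pack (al_linear (y := P')))).
- exact: al_res.
- exact: al_inj.
- exact: al_surj.
- exact: al_inj.
Qed.
End ZerothCohomology.

Lemma local_sections_base_change :
  base_change (mres (sections_omod (structure_omod X) (min_open x)) h).
Proof.
have [_ /(_ 0)[I qcI]] := U_schematic.
exact: zeroth_base_change (quasi_coherent_base_change hUx qcI).
Qed.
End Local.

(** * Base change of the higher direct images on X × X *)

Section Assembly.
Variables (k : comPzRingType) (X : ringed_finite_space k) (flatX : finite_space X).
Hypothesis locX : forall p : X, schematic (restr_space (min_open p)).
Variable J : inj_resolution (structure_omod X).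
Local Notation H n := (cohomology (push_resolution (diag X) J) n).

Lemma sections_cohomology_base_change (p p' : X) (h : leU p p') (V : set X) n :
  upclosed V -> V `<=` min_open p ->
  base_change (mres (cohomology (sections_complex J V) n) h).
Proof.
move=> V_up Vp; apply: base_change_cohomology; first exact: flatX.
apply: base_change_qiso_upclosed => //.
- by move=> x px; exact: (local_sections_base_change (locX p)).
- by move=> x px m s; exact: (local_sections_acyclic (locX p)).
Qed.

Let upclosed_meet (p q : X) : upclosed (min_open p `&` min_open q).
Proof.
by move=> x y [px qx] xy; split; [exact: leU_trans px xy|exact: leU_trans qx xy].
Qed.

(** [V] contains the factor U_p so as to lie inside U_p, as the induction demands. Over p' nothing
    is lost: U_p' lies in U_p, so U_p' ∩ V = U_p' ∩ U_q. *)
Lemma base_change_fst (p p' q : X) (h : leU p p')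
    (hq : @leU (prod_space X X) (p, q) (p', q)) n : base_change (mres (H n) hq).
Proof.
pose V := min_open p `&` min_open q.
have yV x : leU ((p, q) : prod_space X X) (diag X x) <-> leU p x /\ V x.
  by rewrite leU_diag; split=> [[]|[? []]].
have yV' x : leU ((p', q) : prod_space X X) (diag X x) <-> leU p' x /\ V x.
  by rewrite leU_diag; split=> [[px qx]|[? []]] //; split=> //; split=> //; exact: leU_trans h px.
apply: (@cohomology_base_change_extend k X (prod_space X X) (sections_complex J V)
  (push_resolution (diag X) J) p p' (p, q) (p', q) h hq
  (@atensor_inl _ _ _ (struct p) (struct q)) (@atensor_inl _ _ _ (struct p') (struct q)) _
  (fun m => semilinear_pack
    (push_of_sections_linear (M := J m) yV (@diag_sharp_inl k X (p, q))))
  (fun m => semilinear_pack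
    (push_of_sections_linear (M := J m) yV' (@diag_sharp_inl k X (p', q))))).
- move=> a; rewrite /= atensor_mapE rmorph1.
  by congr (atens _ _ (res _ a) 1); exact: Prop_irrelevance.
- by move=> m s; exact: push_of_sections_hom.
- by move=> m s; exact: push_of_sections_hom.
- by move=> m s; apply/esym; exact: push_of_sections_res.
- by move=> m s; exact: push_of_sections_inj.
- by move=> m s; exact: push_of_sections_surj.
- by move=> m s; exact: push_of_sections_inj.
- by move=> m s; exact: push_of_sections_surj.
- elim/atens_ind => [|b c x [s ->]]; first by exists [::]; rewrite big_nil.
  exists ((b, atens (struct p) (struct q) 1 c) :: s); rewrite big_cons; congr (_ + _).
  rewrite /= atensor_mapE rmorph1 res_id /atensor_inl.
  by rewrite -[RHS]/(atens _ _ b 1 * atens _ _ 1 c) atensM mulr1 mul1r.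
- by apply: sections_cohomology_base_change; [exact: upclosed_meet|move=> x []].
Qed.

Lemma base_change_snd (p q q' : X) (h : leU q q')
    (hq : @leU (prod_space X X) (p, q) (p, q')) n : base_change (mres (H n) hq).
Proof.
pose V := min_open q `&` min_open p.
have yV x : leU ((p, q) : prod_space X X) (diag X x) <-> leU q x /\ V x.
  by rewrite leU_diag; split=> [[]|[? []]].
have yV' x : leU ((p, q') : prod_space X X) (diag X x) <-> leU q' x /\ V x.
  by rewrite leU_diag; split=> [[px qx]|[? []]] //; split=> //; split=> //; exact: leU_trans h qx.
apply: (@cohomology_base_change_extend k X (prod_space X X) (sections_complex J V)
  (push_resolution (diag X) J) q q' (p, q) (p, q') h hq
  (@atensor_inr _ _ _ (struct p) (struct q)) (@atensor_inr _ _ _ (struct p) (struct q')) _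
  (fun m => semilinear_pack
    (push_of_sections_linear (M := J m) yV (@diag_sharp_inr k X (p, q))))
  (fun m => semilinear_pack
    (push_of_sections_linear (M := J m) yV' (@diag_sharp_inr k X (p, q'))))).
- move=> a; rewrite /= atensor_mapE rmorph1.
  by congr (atens _ _ 1 (res _ a)); exact: Prop_irrelevance.
- by move=> m s; exact: push_of_sections_hom.
- by move=> m s; exact: push_of_sections_hom.
- by move=> m s; apply/esym; exact: push_of_sections_res.
- by move=> m s; exact: push_of_sections_inj.
- by move=> m s; exact: push_of_sections_surj.
- by move=> m s; exact: push_of_sections_inj.
- by move=> m s; exact: push_of_sections_surj.
- elim/atens_ind => [|b c x [s ->]]; first by exists [::]; rewrite big_nil.
  exists ((c, atens (struct p) (struct q) b 1) :: s); rewrite big_cons; congr (_ + _).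
  rewrite /= atensor_mapE rmorph1 res_id /atensor_inr.
  by rewrite -[RHS]/(atens _ _ 1 c * atens _ _ b 1) atensM mulr1 mul1r.
- by apply: sections_cohomology_base_change; [exact: upclosed_meet|move=> x []].
Qed.

Lemma higher_direct_image_quasi_coherent n : quasi_coherent (higher_direct_image (diag X) J n).
Proof.
apply: base_change_quasi_coherent => -[p q] [p' q'] h.
have h1 : leU p p' := leU_fst h; have h2 : leU q q' := leU_snd h.
have hl : @leU (prod_space X X) (p, q) (p', q)
  by exact: (@leU_prod X X (p, q) (p', q) h1 (leU_refl q)).
have hr : @leU (prod_space X X) (p', q) (p', q')
  by exact: (@leU_prod X X (p', q) (p', q') (leU_refl p') h2).
have resE a : res h a = res hr (res hl a) by rewrite (res_comp hl hr h).
have mresE m : mres (H n) h m = mres (H n) hr (mres (H n) hl m).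
  by apply/esym; exact: mres_comp.
by apply: (base_change_comp resE mresE); [exact: base_change_fst|exact: base_change_snd].
Qed.
End Assembly.

Theorem proposition4p9 (k : comPzRingType) (X : ringed_finite_space k)
  (hX : finite_space X) :
  schematic X <-> forall p : X, schematic (restr_space (min_open p)).
Proof.
split=> [sX p|locX]; first exact: restr_schematic (@upclosed_min_open X p) sX.
(* Any injective resolution of O serves, in every degree. *)
split=> // n; have [J] := inj_resolution_exists (structure_omod X).
by exists J; exact: higher_direct_image_quasi_coherent.
Qed.
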